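(* Set $\mathcal{A}= \mathbb{C}\langle X_1,\ldots,X_k,Y_1,\ldots,Y_{\ell}\rangle$, $\mathcal{A}_1=\mathbb{C}\langle X_1,\ldots,X_k\rangle$ and $\mathcal{A}_2=\mathbb{C}\langle Y_1,\ldots,Y_{\ell}\rangle$. Let $(\mathbf{A}_N)_{N\geq 1}$ and $(\mathbf{B}_N)_{N\geq 1}$ be two deterministic sequences of $k$-tuples and $\ell$-tuples of $N\times N$ complex matrices, and $(v_N)_{N\geq 1}$ a sequence of unit vectors of $\mathbb{C}^N$. Assume there are maps $\tau:\mathcal{A}_1\cup\mathcal{A}_2\to\mathbb{C}$ and $\varphi:\mathcal{A}_1\to\mathbb{C}$ such that for all $P\in \mathcal{A}_1$, $\tau_{\mathbf{A}_N}(P)=\tau(P)+o(1)$ and $\tau_{\mathbf{A}_N}^{v_N}(P)=\varphi(P)+o(1)$, and for all $P\in \mathcal{A}_2$, $\tau_{\mathbf{B}_N}(P)=\tau(P)+o(1)$. Let $(U_N)_{N\geq 1}$ be a sequence of Haar distributed unitary random matrices of size $N$. Then $\tau$ and $\varphi$ extend to linear functionals on $\mathcal{A}$ such that, for all $P\in\mathcal{A}$, $\mathbb{E}[ \tau_{\mathbf{A}_N, U_N\mathbf{B}_NU_N^*}(P)]=\tau(P)+o(1)$ and $\mathbb{E}[ \tau^{v_N}_{\mathbf{A}_N, U_N\mathbf{B}_NU_N^*}(P)]=\varphi(P)+o(1)$; moreover $\mathcal{A}_1$ and $\mathcal{A}_2$ are conditionally free with respect to $(\tau,\varphi)$, and $\varphi|_{\mathcal{A}_2}=\tau|_{\mathcal{A}_2}$.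 Furthermore, if all matrices of $\mathbf{A}_N$ and $\mathbf{B}_N$ are self-adjoint, then for all $P\in \mathcal{A}$, $\tau_{\mathbf{A}_N, U_N\mathbf{B}_NU_N^*}(P)=\tau(P)+o(1)$ almost surely and $\tau_{\mathbf{A}_N, U_N\mathbf{B}_NU_N^*}^{v_N}(P)=\varphi(P)+o(1)$ almost surely.
   Context: $\operatorname{tr}_N=\frac1N\operatorname{Tr}$; $\tau_{\mathbf{A}_N}(P)=\operatorname{tr}_N(P(\mathbf{A}_N))$ and $\tau^{v_N}_{\mathbf{A}_N}(P)=\langle P(\mathbf{A}_N)v_N,v_N\rangle$; joint versions are $\tau_{\mathbf{A}_N,U_N\mathbf{B}_NU_N^*}(P)=\operatorname{tr}_N(P(\mathbf{A}_N,U_N\mathbf{B}_NU_N^* ))$ and $\tau^{v_N}_{\mathbf{A}_N,U_N\mathbf{B}_NU_N^*}(P)=\langle P(\mathbf{A}_N,U_N\mathbf{B}_NU_N^* )v_N,v_N\rangle$, where $U_N\mathbf{B}_NU_N^*=(U_NB_N^{(1)}U_N^*,\dots,U_NB_N^{(\ell)}U_N^* )$. Unital subalgebras $\mathcal{A}_1,\mathcal{A}_2$ are conditionally free w.r.t. $(\tau,\varphi)$ if whenever $n>1$, $a_j\in\mathcal{A}_{i_j}$ with consecutive indices different and $\tau(a_j)=0$ for all $j$, one has $\tau(a_1\cdots a_n)=0$ and $\varphi(a_1\cdots a_n)=\varphi(a_1)\cdots\varphi(a_n)$. *)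

(* Defs.v *)
From HB Require Import structures.
From mathcomp Require Import all_boot all_order all_algebra.
From mathcomp Require Import all_classical all_reals all_analysis.
From mathcomp Require Import complex.
Set Implicit Arguments. Unset Strict Implicit. Unset Printing Implicit Defensive.
Import Order.TTheory GRing.Theory Num.Theory.
Import numFieldNormedType.Exports.
Local Open Scope classical_set_scope.
Local Open Scope ring_scope.

(* Letters of A = C<X_1..X_k, Y_1..Y_l>: inl i = X_(i+1), inr j = Y_(j+1). *)
Definition letter (k l : nat) := ('I_k + 'I_l)%type.
Definition word (k l : nat) := seq (letter k l).

Definition isX k l (x : letter k l) : bool := if x is inl _ then true else false.
Definition isY k l (x : letter k l) : bool := if x is inr _ then true else false.
Definition pureX k l (w : word k l) : bool := all (@isX k l) w.
Definition pureY k l (w : word k l) : bool := all (@isY k l) w.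

(* A noncommutative polynomial is a finite formal linear combination of words
   (every element of A has such a representation). *)
Definition ncpoly (R : realType) k l := seq (R[i] * word k l).

Definition inA1 (R : realType) k l (P : ncpoly R k l) : bool :=
  all (fun cw => pureX cw.2) P.
Definition inA2 (R : realType) k l (P : ncpoly R k l) : bool :=
  all (fun cw => pureY cw.2) P.

Definition ncmul (R : realType) k l (P Q : ncpoly R k l) : ncpoly R k l :=
  [seq (a.1 * b.1, a.2 ++ b.2) | a <- P, b <- Q].
Definition ncprod (R : realType) k l (s : seq (ncpoly R k l)) : ncpoly R k l :=
  foldr (@ncmul R k l) [:: (1, [::])] s.

Definition lin (R : realType) k l (t : word k l -> R[i]) (P : ncpoly R k l) : R[i] :=
  \sum_(cw <- P) cw.1 * t cw.2.

Definition adj (R : realType) m n (M : 'M[R[i]]_(m, n)) : 'M[R[i]]_(n, m) :=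
  (map_mx conjc M)^T.
Definition unitary (R : realType) n (M : 'M[R[i]]_n) : Prop := M *m adj M = 1%:M.
Definition selfadj (R : realType) n (M : 'M[R[i]]_n) : Prop := adj M = M.
Definition unit_vec (R : realType) n (v : 'cV[R[i]]_n) : Prop := (adj v *m v) 0 0 = 1.

Definition mxs (R : realType) k l n (A : 'I_k -> 'M[R[i]]_n.+1)
  (B : 'I_l -> 'M[R[i]]_n.+1) (x : letter k l) : 'M[R[i]]_n.+1 :=
  match x with inl i => A i | inr j => B j end.
Definition conjB (R : realType) l n (U : 'M[R[i]]_n.+1) (B : 'I_l -> 'M[R[i]]_n.+1) :=
  fun j => U *m B j *m adj U.

Definition evalw (R : realType) k l n (M : letter k l -> 'M[R[i]]_n.+1) (w : word k l)
  : 'M[R[i]]_n.+1 := \prod_(x <- w) M x.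
Definition evalp (R : realType) k l n (M : letter k l -> 'M[R[i]]_n.+1) (P : ncpoly R k l)
  : 'M[R[i]]_n.+1 := \sum_(cw <- P) cw.1 *: evalw M cw.2.

Definition trn (R : realType) n (M : 'M[R[i]]_n.+1) : R[i] := \tr M / n.+1%:R.
Definition vstate (R : realType) n (v : 'cV[R[i]]_n.+1) (M : 'M[R[i]]_n.+1) : R[i] :=
  (adj v *m M *m v) 0 0.

Definition cvgC (R : realType) (u : nat -> R[i]) (l : R[i]) : Prop :=
  (fun N => ComplexField.Normc.normc (u N - l)) @ \oo --> (0 : R).

Definition Ec (R : realType) d (T : measurableType d) (P : probability T R)
  (X : T -> R[i]) : R[i] :=
  ((fine (expectation P (fun w => complex.Re (X w))))
   +i* (fine (expectation P (fun w => complex.Im (X w)))))%C.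

Definition realify (R : realType) n (M : 'M[R[i]]_n) : 'M[R]_(n, n + n) :=
  row_mx (map_mx (@complex.Re R) M) (map_mx (@complex.Im R) M).

(* U is a Haar distributed random unitary matrix of size n.+1 on (T, P):
   unitary valued, measurable, and its law is invariant under left
   multiplication by any fixed unitary (tested against continuous functions);
   on the compact group U(n+1) this characterizes the Haar probability. *)
Definition haar_unitary (R : realType) d (T : measurableType d) (P : probability T R)
  n (U : T -> 'M[R[i]]_n.+1) : Prop :=
  [/\ forall w, unitary (U w),
      forall i j, measurable_fun setT (fun w => complex.Re (U w i j)) /\
                  measurable_fun setT (fun w => complex.Im (U w i j)) &
      forall V : 'M[R[i]]_n.+1, unitary V ->
      forall f : 'M[R]_(n.+1, n.+1 + n.+1) -> R, continuous f ->
        expectation P (fun w => f (realify (V *m U w))) =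
        expectation P (fun w => f (realify (U w)))].

Definition cond_free (R : realType) k l (tau phi : word k l -> R[i]) : Prop :=
  forall s : seq (bool * ncpoly R k l),
    (1 < size s)%N ->
    all (fun p => if p.1 then inA1 p.2 else inA2 p.2) s ->
    sorted (fun a b => a.1 != b.1) s ->
    all (fun p => lin tau p.2 == 0) s ->
    lin tau (ncprod (map snd s)) = 0 /\
    lin phi (ncprod (map snd s)) = \prod_(p <- s) lin phi p.2.

(* Main.v *)
Require Import Defs.
From HB Require Import structures.
From mathcomp Require Import all_boot all_order all_algebra.
From mathcomp Require Import all_classical all_reals all_analysis.
From mathcomp Require Import measurable_realfun complex ring lra zify.
Import Order.TTheory GRing.Theory Num.Theory.
Import numFieldNormedType.Exports.
Local Open Scope classical_set_scope.
Local Open Scope ring_scope.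

Set Implicit Arguments.
Unset Strict Implicit.
Unset Printing Implicit Defensive.

(** Write n for the matrix size and h = n^(-1/2). Haar invariance enters through a single identity:
    if F is a polynomial in the entries of a unitary and their conjugates, and G is its gradient
    along left multiplication, then the expectation of G vanishes ([haar_grad]). Applied to entries
    of products of deterministic matrices and conjugates [U B U*], this gives Schwinger-Dyson
    equations ([schwinger_dyson]): a product splits into two traces, or it merges with another
    functional at the price of a factor n^-1 or n^-2.

    A word is cut into maximal blocks of X letters and of Y letters, and each block is centered by
    its own normalized trace at size n. The quantities estimated are expectations of products of
    several functionals, each a normalized trace or the vector state, of alternating products of
    centered blocks ([Ecf]); products of functionals are unavoidable, since a split creates a new
    trace. The main estimate ([moment_bounds]) is that such a moment is O(h^e), where every
    nontrivial trace contributes 2 to e and every vector state containing a Y block contributes 1.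

    The estimate is proved by induction on the total number D of letters. Since a single centered
    block has trace zero, the Schwinger-Dyson equation can be solved for a chosen moment
    ([Ecf_schwinger_dyson]). On the other side stand moments with as many letters that carry at
    least one more power of h and, after adjacent blocks of one kind are merged, moments with fewer
    letters and no loss of power. If Bd is the best constant for D letters and K the one for fewer,
    then Bd <= c (K + h Bd), which bounds Bd as soon as c h <= 1/2 ([step_bound],
    [contraction_bound], [step_closed]); a crude bound depending on n ([Ecf_crude]) makes Bd finite
    beforehand.

    Hence all centered alternating moments tend to 0, except the empty product, with value 1, and
    the vector state of a single X block, which tends to phi minus tau. A centered product differs
    from the plain word only by shorter words, so induction on length gives the limits of all words
    ([functional_limit]). The vanishing of centered alternating products is conditional freeness
    ([cond_free_of_cent]): with at least two alternating factors one of them lies in the second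
    algebra, where phi = tau = 0 on it, so both sides of the factorization of phi are 0.

    In the self-adjoint case the conjugate of a functional is the same functional of the reversed
    word. The second absolute moment of a trace and the fourth of a vector state are then moments of
    order h^4 = n^-2, which is summable, and almost sure convergence follows ([ae_fval]). The
    induction on words is then run for each outcome separately ([functional_cvg]). *)

Notation nc := ComplexField.Normc.normc.

(** * The real-valued modulus on complex numbers *)

Section ComplexNorm.
Context {R : realType}.
Implicit Types x y : R[i].

Lemma ncM x y : nc (x * y) = nc x * nc y.
Proof. exact: ComplexField.Normc.normcM. Qed.

Lemma ncD x y : nc (x + y) <= nc x + nc y.
Proof. exact: le_normcD. Qed.

Lemma ncN x : nc (- x) = nc x.
Proof. exact: normcN. Qed.

Lemma nc0 : nc (0 : R[i]) = 0.
Proof. exact: ComplexField.Normc.normc0. Qed.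

Lemma nc1 : nc (1 : R[i]) = 1.
Proof. exact: ComplexField.Normc.normc1. Qed.

Lemma nc_ge0 x : 0 <= nc x.
Proof. by case: x => a b /=; apply: sqrtr_ge0. Qed.

Lemma nc_eq0 x : nc x = 0 -> x = 0.
Proof. exact: ComplexField.Normc.eq0_normc. Qed.

Lemma ncB x y : nc (x - y) <= nc x + nc y.
Proof. by rewrite -(ncN y); apply: ncD. Qed.

Lemma ncV x : nc x^-1 = (nc x)^-1.
Proof. exact: ComplexField.Normc.normcV. Qed.

Lemma nc_real (r : R) : nc r%:C%C = `|r|.
Proof. by rewrite /= expr0n /= addr0 sqrtr_sqr. Qed.

Lemma nc_nat n : nc (n%:R : R[i]) = n%:R.
Proof.
have -> : (n%:R : R[i]) = (n%:R)%:C%C by rewrite raddfMn.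
by rewrite nc_real ger0_norm.
Qed.

Lemma nc_conj x : nc (conjc x) = nc x.
Proof. by case: x => a b /=; rewrite sqrrN. Qed.

Lemma sqr_nc x : (nc x ^+ 2)%:C%C = x * conjc x.
Proof.
case: x => a b; rewrite /= sqr_sqrtr ?addr_ge0 ?sqr_ge0 //.
by apply/eqP; rewrite eq_complex /=; apply/andP; split; apply/eqP; ring.
Qed.

Lemma ler_absRe_nc x : `|complex.Re x| <= nc x.
Proof. by case: x => a b /=; rewrite -sqrtr_sqr ler_wsqrtr // lerDl sqr_ge0. Qed.

Lemma ler_absIm_nc x : `|complex.Im x| <= nc x.
Proof. by case: x => a b /=; rewrite -sqrtr_sqr ler_wsqrtr // lerDr sqr_ge0. Qed.

Lemma nc_le_absReIm x : nc x <= `|complex.Re x| + `|complex.Im x|.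
Proof.
case: x => a b /=; rewrite -(ger0_norm (addr_ge0 (normr_ge0 a) (normr_ge0 b))).
rewrite -sqrtr_sqr ler_wsqrtr // sqrrD !real_normK ?num_real //.
by rewrite lerD2r lerDl mulrn_wge0 // mulr_ge0.
Qed.

Lemma nc_sum (I : Type) (r : seq I) (P : pred I) (F : I -> R[i]) :
  nc (\sum_(i <- r | P i) F i) <= \sum_(i <- r | P i) nc (F i).
Proof.
elim/big_rec2: _ => [|i y x _ h]; first by rewrite nc0.
by apply: le_trans (ncD _ _) _; rewrite lerD2l.
Qed.

Lemma nc_prod (I : Type) (r : seq I) (P : pred I) (F : I -> R[i]) :
  nc (\prod_(i <- r | P i) F i) = \prod_(i <- r | P i) nc (F i).
Proof. exact: (big_morph _ ncM nc1). Qed.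

Lemma ncX x n : nc (x ^+ n) = nc x ^+ n.
Proof. by elim: n => [|n IH]; rewrite ?expr0 ?nc1 // !exprS ncM IH. Qed.

End ComplexNorm.

(** * Arithmetic of limits of complex sequences *)

Section CvgC.
Context {R : realType}.
Implicit Types (u v : nat -> R[i]) (a b : R[i]).

Lemma cvgC_squeeze u a (e : nat -> R) :
  (forall N, nc (u N - a) <= e N) -> e @ \oo --> (0 : R) -> cvgC u a.
Proof.
move=> ue e0; apply: (@squeeze_cvgr _ _ _ _ (fun=> 0) e) => //; last exact: cvg_cst.
by apply: nearW => N; rewrite nc_ge0 ue.
Qed.

Lemma cvgC_squeeze_near u a (e : nat -> R) N0 :
  (forall N, (N0 <= N)%N -> nc (u N - a) <= e N) -> e @ \oo --> (0 : R) -> cvgC u a.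
Proof.
move=> ue e0; apply: (@squeeze_cvgr _ _ _ _ (fun=> 0) e) => //; last exact: cvg_cst.
by exists N0 => // N /= h; rewrite nc_ge0 ue.
Qed.

Lemma cvgC_ext u v a : (forall N, u N = v N) -> cvgC u a -> cvgC v a.
Proof. by move=> /funext ->. Qed.

Lemma cvgC_cst a : cvgC (fun=> a) a.
Proof. by rewrite /cvgC subrr nc0; apply: cvg_cst. Qed.

Lemma cvgCD u v a b : cvgC u a -> cvgC v b -> cvgC (fun N => u N + v N) (a + b).
Proof.
move=> ua vb; apply: (@cvgC_squeeze _ _ (fun N => nc (u N - a) + nc (v N - b))).
  by move=> N; rewrite opprD addrACA; apply: ncD.
by rewrite -[X in _ --> X]addr0; apply: cvgD.
Qed.

Lemma cvgC_bounded u a : cvgC u a -> exists2 M : R, 0 <= M & forall N, nc (u N) <= M.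
Proof.
move=> ua; have [M [Mr HM]] := cvg_seq_bounded (cvgP _ ua).
have HM' N : `|nc (u N - a)| <= `|M| + 1.
  by apply: (HM (`|M| + 1)) => //; rewrite (le_lt_trans (ler_norm M)) // ltrDl.
exists (`|M| + 1 + nc a); first by rewrite !addr_ge0 // nc_ge0.
move=> N; rewrite -[u N](subrK a); apply: le_trans (ncD _ _) _.
by rewrite lerD2r; apply: le_trans (HM' N); apply: ler_norm.
Qed.

Lemma cvgCM u v a b : cvgC u a -> cvgC v b -> cvgC (fun N => u N * v N) (a * b).
Proof.
move=> ua vb; have [M M0 HM] := cvgC_bounded vb.
apply: (@cvgC_squeeze _ _ (fun N => nc (u N - a) * M + nc a * nc (v N - b))).
  move=> N; have -> : u N * v N - a * b = (u N - a) * v N + a * (v N - b) by ring.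
  by apply: le_trans (ncD _ _) _; rewrite !ncM lerD2r ler_wpM2l // nc_ge0.
rewrite -[X in _ --> X]addr0; apply: cvgD.
  by rewrite -[X in _ --> X](mul0r M); apply: cvgMl.
by rewrite -[X in _ --> X](mulr0 (nc a)); apply: cvgMr.
Qed.

Lemma cvgCN u a : cvgC u a -> cvgC (fun N => - u N) (- a).
Proof.
move=> /(cvgCM (cvgC_cst (-1))) h.
by rewrite -mulN1r; apply: cvgC_ext h => N; rewrite mulN1r.
Qed.

Lemma cvgCB u v a b : cvgC u a -> cvgC v b -> cvgC (fun N => u N - v N) (a - b).
Proof. by move=> ua vb; apply: cvgCD => //; apply: cvgCN. Qed.

Lemma cvgC_sum (I : Type) (r : seq I) (F : I -> nat -> R[i]) (L : I -> R[i]) :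
  (forall i, cvgC (F i) (L i)) ->
  cvgC (fun N => \sum_(i <- r) F i N) (\sum_(i <- r) L i).
Proof.
move=> FL; elim: r => [|i r IH].
  by rewrite big_nil; apply: cvgC_ext (cvgC_cst 0) => N; rewrite big_nil.
rewrite big_cons; apply: cvgC_ext (cvgCD (FL i) IH) => N.
by rewrite big_cons.
Qed.

Lemma cvgC_unique u a b : cvgC u a -> cvgC u b -> a = b.
Proof.
move=> ua ub; have := cvgCB ua ub; rewrite /cvgC.
have -> : (fun N => nc (u N - u N - (a - b))) = (fun=> nc (a - b)).
  by apply/funext => N; rewrite subrr sub0r ncN.
move=> /(cvg_unique _ (cvg_cst _)) h; apply/eqP; rewrite -subr_eq0; apply/eqP/nc_eq0.
exact: h.
Qed.

End CvgC.

(** * Expectation of bounded complex random variables *)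

Section BoundedMeasurable.
Context {R : realType} {d : measure_display} {T : measurableType d}.
Variable P : probability T R.
Implicit Types X Y : T -> R[i].

Lemma Rintegral_prob_cst (r : R) : Rintegral P setT (fun=> r) = r.
Proof.
have h : fine (P setT) = 1 by rewrite probability_setT.
by rewrite Rintegral_cst // -[RHS]mulr1 -h.
Qed.

Definition bmeas X : Prop :=
  [/\ measurable_fun setT (fun w => complex.Re (X w)),
      measurable_fun setT (fun w => complex.Im (X w)) &
      exists K : R, forall w, nc (X w) <= K].

Lemma bmeas_cst c : bmeas (fun=> c).
Proof. by split; [exact: measurable_cst|exact: measurable_cst|exists (nc c)]. Qed.

Lemma bmeasD X Y : bmeas X -> bmeas Y -> bmeas (fun w => X w + Y w).
Proof.
move=> [rX iX [K KX]] [rY iY [L LY]]; split.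
- under eq_fun => w do rewrite raddfD /=.
  exact: measurable_realfun.measurable_funD.
- under eq_fun => w do rewrite raddfD /=.
  exact: measurable_realfun.measurable_funD.
- by exists (K + L) => w; apply: le_trans (ncD _ _) _; apply: lerD.
Qed.

Lemma ReM (x y : R[i]) :
  complex.Re (x * y) = complex.Re x * complex.Re y - complex.Im x * complex.Im y.
Proof. by case: x; case: y. Qed.

Lemma ImM (x y : R[i]) :
  complex.Im (x * y) = complex.Re x * complex.Im y + complex.Im x * complex.Re y.
Proof. by case: x => a b; case: y => c e /=; rewrite addrC addrC. Qed.

Lemma bmeasM X Y : bmeas X -> bmeas Y -> bmeas (fun w => X w * Y w).
Proof.
move=> [rX iX [K KX]] [rY iY [L LY]]; split.
- under eq_fun => w do rewrite ReM.
  by apply: measurable_realfun.measurable_funB; apply: measurable_realfun.measurable_funM.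
- under eq_fun => w do rewrite ImM.
  by apply: measurable_realfun.measurable_funD; apply: measurable_realfun.measurable_funM.
- exists (K * L) => w; rewrite ncM; apply: ler_pM => //; exact: nc_ge0.
Qed.

Lemma bmeas_conj X : bmeas X -> bmeas (fun w => conjc (X w)).
Proof.
move=> [rX iX [K KX]]; split.
- by apply: eq_measurable_fun rX => w _; case: (X w).
- rewrite (_ : (fun w => _) = (fun w => - complex.Im (X w))); last first.
    by apply/funext => w; case: (X w).
  exact: measurable_realfun.measurable_funN.
- by exists K => w; rewrite nc_conj.
Qed.

Lemma bmeas_integrable (f : T -> R) (K : R) :
  measurable_fun setT f -> (forall w, `|f w| <= K) -> P.-integrable setT (EFin \o f).
Proof.
move=> mf bf; apply: measurable_bounded_integrable => //.
  by apply: (le_lt_trans (probability_le1 P measurableT)); rewrite ltry.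
by exists K; split => [|M KM x _]; [exact: num_real|exact: le_trans (bf x) (ltW KM)].
Qed.

Lemma bmeas_Re X : bmeas X -> P.-integrable setT (EFin \o (fun w => complex.Re (X w))).
Proof.
move=> [rX _ [K KX]]; apply: (@bmeas_integrable _ K) => // w.
exact: le_trans (ler_absRe_nc _) (KX w).
Qed.

Lemma bmeas_Im X : bmeas X -> P.-integrable setT (EFin \o (fun w => complex.Im (X w))).
Proof.
move=> [_ iX [K KX]]; apply: (@bmeas_integrable _ K) => // w.
exact: le_trans (ler_absIm_nc _) (KX w).
Qed.

Lemma EcE X : Ec P X =
  (Rintegral P setT (fun w => complex.Re (X w)) +i*
   Rintegral P setT (fun w => complex.Im (X w)))%C.
Proof. by rewrite /Ec unlock. Qed.

Lemma EcD X Y : bmeas X -> bmeas Y -> Ec P (fun w => X w + Y w) = Ec P X + Ec P Y.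
Proof.
move=> bX bY; rewrite !EcE.
have -> : Rintegral P setT (fun w => complex.Re (X w + Y w)) =
    Rintegral P setT (fun w => complex.Re (X w) + complex.Re (Y w)).
  by apply: eq_Rintegral => w _; rewrite raddfD.
have -> : Rintegral P setT (fun w => complex.Im (X w + Y w)) =
    Rintegral P setT (fun w => complex.Im (X w) + complex.Im (Y w)).
  by apply: eq_Rintegral => w _; rewrite raddfD.
by rewrite !RintegralD //; first [exact: bmeas_Re | exact: bmeas_Im].
Qed.

Lemma EcZ c X : bmeas X -> Ec P (fun w => c * X w) = c * Ec P X.
Proof.
move=> bX; rewrite !EcE; case: c => a b.
have ir := bmeas_Re bX; have ii := bmeas_Im bX.
have ZZ r f : P.-integrable setT (EFin \o f) ->
    P.-integrable setT (EFin \o (fun w => r * f w)).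
  move=> h; rewrite (_ : EFin \o _ = (fun w => r%:E * (EFin \o f) w)%E) //.
  exact: integrableZl.
congr (_ +i* _)%C.
  rewrite -!RintegralZl // -RintegralB //; try exact: ZZ.
  by apply: eq_Rintegral => w _; rewrite ReM.
rewrite -!RintegralZl // -RintegralD //; try exact: ZZ.
by apply: eq_Rintegral => w _; rewrite ImM.
Qed.

Lemma Ec_cst c : Ec P (fun=> c) = c.
Proof.
by case: c => a b; rewrite EcE !Rintegral_prob_cst.
Qed.

Lemma Ec_sum (I : Type) (r : seq I) (F : I -> T -> R[i]) :
  (forall i, bmeas (F i)) ->
  Ec P (fun w => \sum_(i <- r) F i w) = \sum_(i <- r) Ec P (F i).
Proof.
move=> bF; suff [] : Ec P (fun w => \sum_(i <- r) F i w) = \sum_(i <- r) Ec P (F i)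
  /\ bmeas (fun w => \sum_(i <- r) F i w) by [].
elim: r => [|i r [IH bIH]].
  under eq_fun => w do rewrite big_nil.
  by rewrite big_nil Ec_cst; split=> //; apply: bmeas_cst.
under eq_fun => w do rewrite big_cons.
by rewrite big_cons EcD // IH; split=> //; apply: bmeasD.
Qed.

(** Real and imaginary parts are estimated separately, hence the factor 2, which is harmless in all
    later uses. *)
Lemma nc_Ec X (K : R) : bmeas X -> (forall w, nc (X w) <= K) -> nc (Ec P X) <= K + K.
Proof.
move=> bX KX; rewrite EcE; apply: le_trans (nc_le_absReIm _) _ => /=.
have bound f : P.-integrable setT (EFin \o f) -> (forall w, `|f w| <= K) ->
    `|Rintegral P setT f| <= K.
  move=> If fK; apply: le_trans (le_normr_Rintegral _ If) _ => //.
  apply: le_trans (_ : Rintegral P setT (fun=> K) <= _); last first.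
    by rewrite Rintegral_prob_cst.
  apply: le_Rintegral => // [|].
    exact: (integrable_norm If).
  exact: finite_measure_integrable_cst.
apply: lerD.
  by apply: bound => [|w]; [exact: bmeas_Re|exact: le_trans (ler_absRe_nc _) (KX w)].
by apply: bound => [|w]; [exact: bmeas_Im|exact: le_trans (ler_absIm_nc _) (KX w)].
Qed.

End BoundedMeasurable.

(** * Polynomial functions of a unitary matrix and Haar invariance *)

Section MatrixFunctions.
Context {R : realType} {n : nat}.
Local Notation C := R[i].
Local Notation M_ := 'M[C]_n.+1.
Implicit Types (F : M_ -> C) (G : M_ -> M_).

Lemma adjM m p q (A : 'M[C]_(m, p)) (B : 'M[C]_(p, q)) :
  adj (A *m B) = adj B *m adj A.
Proof. by rewrite /adj map_mxM trmx_mul. Qed.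

Lemma adjD m p (A B : 'M[C]_(m, p)) : adj (A + B) = adj A + adj B.
Proof. by rewrite /adj map_mxD linearD. Qed.

Lemma adjZ m p c (A : 'M[C]_(m, p)) : adj (c *: A) = conjc c *: adj A.
Proof. by rewrite /adj map_mxZ linearZ. Qed.

Lemma adj1 m : adj 1%:M = 1%:M :> 'M[C]_m.
Proof. by rewrite /adj map_mx1 trmx1. Qed.

Lemma adjK m p (A : 'M[C]_(m, p)) : adj (adj A) = A.
Proof. by apply/matrixP => i j; rewrite !mxE conjcK. Qed.

Lemma adjE m p (A : 'M[C]_(m, p)) i j : adj A i j = conjc (A j i).
Proof. by rewrite !mxE. Qed.

Lemma unitaryC (M : M_) : unitary M -> adj M *m M = 1%:M.
Proof. exact: mulmx1C. Qed.

Lemma unitaryM (V M : M_) : unitary V -> unitary M -> unitary (V *m M).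
Proof. by rewrite /unitary adjM => hV hM; rewrite mulmxA -(mulmxA V) hM mulmx1. Qed.

Lemma nc_unitary (M : M_) i j : unitary M -> nc (M i j) <= 1.
Proof.
move=> /matrixP /(_ i i); rewrite !mxE eqxx (bigD1 j) //= !mxE -sqr_nc => h.
have h2 : (nc (M i j)) ^+ 2 <= 1.
  have := congr1 (@complex.Re R) h; rewrite raddfD /= raddf_sum /= => <-.
  rewrite lerDl sumr_ge0 // => p _; rewrite !mxE -sqr_nc /=; exact: sqr_ge0.
by rewrite -(@ler_pXn2r _ 2) ?nnegrE ?nc_ge0 ?expr1n.
Qed.

(** Polynomials in the entries and their conjugates. This class is closed under all operations used
    below; its members are bounded on unitaries, measurable along [U], and continuous in real
    coordinates, so that Haar invariance may be tested on them. *)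
Inductive polyf : (M_ -> C) -> Prop :=
| polyf_cst c : polyf (fun=> c)
| polyf_entry i j : polyf (fun M => M i j)
| polyf_conj F : polyf F -> polyf (fun M => conjc (F M))
| polyfD F1 F2 : polyf F1 -> polyf F2 -> polyf (fun M => F1 M + F2 M)
| polyfM F1 F2 : polyf F1 -> polyf F2 -> polyf (fun M => F1 M * F2 M).

Lemma polyf_ext F1 F2 : F1 =1 F2 -> polyf F1 -> polyf F2.
Proof. by move=> /funext ->. Qed.

Lemma polyf_sum (I : Type) (r : seq I) (F : I -> M_ -> C) :
  (forall i, polyf (F i)) -> polyf (fun M => \sum_(i <- r) F i M).
Proof.
move=> hF; elim: r => [|i r IH].
  by apply: polyf_ext (polyf_cst 0) => M; rewrite big_nil.
by apply: polyf_ext (polyfD (hF i) IH) => M; rewrite big_cons.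
Qed.

Lemma polyf_prod (I : Type) (r : seq I) (F : I -> M_ -> C) :
  (forall i, polyf (F i)) -> polyf (fun M => \prod_(i <- r) F i M).
Proof.
move=> hF; elim: r => [|i r IH].
  by apply: polyf_ext (polyf_cst 1) => M; rewrite big_nil.
by apply: polyf_ext (polyfM (hF i) IH) => M; rewrite big_cons.
Qed.

Lemma polyf_bounded F : polyf F -> exists K : R, forall M, unitary M -> nc (F M) <= K.
Proof.
elim=> [c|i j|{}F _ [K hK]|F1 F2 _ [K1 h1] _ [K2 h2]|F1 F2 _ [K1 h1] _ [K2 h2]].
- by exists (nc c).
- by exists 1 => M hM; apply: nc_unitary.
- by exists K => M hM; rewrite nc_conj; apply: hK.
- by exists (K1 + K2) => M hM; apply: le_trans (ncD _ _) _; rewrite lerD ?h1 ?h2.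
- by exists (K1 * K2) => M hM; rewrite ncM ler_pM ?nc_ge0 ?h1 ?h2.
Qed.

Definition polymx m p (G : M_ -> 'M[C]_(m, p)) : Prop :=
  forall i j, polyf (fun M => G M i j).

Lemma polymx_cst m p (A : 'M[C]_(m, p)) : polymx (fun=> A).
Proof. by move=> i j; apply: polyf_cst. Qed.

Lemma polymx_id : polymx (fun M => M).
Proof. by move=> i j; apply: polyf_entry. Qed.

Lemma polymxD m p (G1 G2 : M_ -> 'M[C]_(m, p)) :
  polymx G1 -> polymx G2 -> polymx (fun M => G1 M + G2 M).
Proof. by move=> h1 h2 i j; apply: polyf_ext (polyfD (h1 i j) (h2 i j)) => M; rewrite mxE. Qed.

Lemma polymxM m p q (G1 : M_ -> 'M[C]_(m, p)) (G2 : M_ -> 'M[C]_(p, q)) :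
  polymx G1 -> polymx G2 -> polymx (fun M => G1 M *m G2 M).
Proof.
move=> h1 h2 i j; apply: polyf_ext
  (polyf_sum (index_enum 'I_p) (fun a => polyfM (h1 i a) (h2 a j))) => M.
by rewrite mxE.
Qed.

Lemma polymxZ m p F (G : M_ -> 'M[C]_(m, p)) :
  polyf F -> polymx G -> polymx (fun M => F M *: G M).
Proof. by move=> h1 h2 i j; apply: polyf_ext (polyfM h1 (h2 i j)) => M; rewrite mxE. Qed.

Lemma polymxB m p (G1 G2 : M_ -> 'M[C]_(m, p)) :
  polymx G1 -> polymx G2 -> polymx (fun M => G1 M - G2 M).
Proof.
move=> h1 h2 i j.
apply: polyf_ext (polyfD (h1 i j) (polyfM (polyf_cst (-1)) (h2 i j))) => M.
by rewrite !mxE mulN1r.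
Qed.

Lemma polymx_adj m p (G : M_ -> 'M[C]_(m, p)) : polymx G -> polymx (fun M => adj (G M)).
Proof. by move=> h i j; apply: polyf_ext (polyf_conj (h j i)) => M; rewrite !mxE. Qed.

Lemma polyf_tr m (G : M_ -> 'M[C]_m) : polymx G -> polyf (fun M => \tr (G M)).
Proof. by move=> h; apply: polyf_sum => i; apply: h. Qed.

Definition complexify (M : 'M[R]_(n.+1, n.+1 + n.+1)) : M_ :=
  \matrix_(i, j) (M i (lshift n.+1 j) +i* M i (rshift n.+1 j))%C.

Lemma realifyK : cancel (@realify R n.+1) complexify.
Proof.
move=> M; apply/matrixP => i j; rewrite /realify mxE row_mxEl row_mxEr !mxE.
by case: (M i j).
Qed.

Lemma polyf_continuous F : polyf F ->
  continuous (fun M => complex.Re (F (complexify M))) /\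
  continuous (fun M => complex.Im (F (complexify M))).
Proof.
elim=> [c|i j|{}F _ [rF iF]|F1 F2 _ [r1 i1] _ [r2 i2]|F1 F2 _ [r1 i1] _ [r2 i2]].
- by split; [exact: (@cst_continuous _ _ (complex.Re c))|exact: (@cst_continuous _ _ (complex.Im c))].
- split.
    rewrite (_ : (fun M => _) = (fun M : 'M[R]_(n.+1, n.+1 + n.+1) => M i (lshift n.+1 j))).
      by move=> M; apply: (@coord_continuous R).
    by apply/funext => M; rewrite mxE.
  rewrite (_ : (fun M => _) = (fun M : 'M[R]_(n.+1, n.+1 + n.+1) => M i (rshift n.+1 j))).
    by move=> M; apply: (@coord_continuous R).
  by apply/funext => M; rewrite mxE.
- split.
    rewrite (_ : (fun M => _) = (fun M => complex.Re (F (complexify M)))) //.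
    by apply/funext => M; case: (F _).
  rewrite (_ : (fun M => _) = (fun M => - complex.Im (F (complexify M)))).
    by move=> M; exact: (cvgN (iF M)).
  by apply/funext => M; case: (F _).
- split.
    rewrite (_ : (fun M => _) = (fun M => complex.Re (F1 (complexify M)) +
      complex.Re (F2 (complexify M)))); last by apply/funext => M; rewrite raddfD.
    by move=> M; exact: (cvgD (r1 M) (r2 M)).
  rewrite (_ : (fun M => _) = (fun M => complex.Im (F1 (complexify M)) +
    complex.Im (F2 (complexify M)))); last by apply/funext => M; rewrite raddfD.
  by move=> M; exact: (cvgD (i1 M) (i2 M)).
- split.
    under eq_fun => M do rewrite ReM.
    by move=> M; exact: (cvgB (cvgM (r1 M) (r2 M)) (cvgM (i1 M) (i2 M))).
  under eq_fun => M do rewrite ImM.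
  by move=> M; exact: (cvgD (cvgM (r1 M) (i2 M)) (cvgM (i1 M) (r2 M))).
Qed.

Section Haar.
Context {d : measure_display} {T : measurableType d} {P : probability T R}.
Variable U : T -> M_.
Hypothesis haarU : haar_unitary P U.

Lemma polyf_bmeas F : polyf F -> bmeas (fun w => F (U w)).
Proof.
have [uU mU _] := haarU.
elim=> [c|i j|{}F _ IH|F1 F2 _ IH1 _ IH2|F1 F2 _ IH1 _ IH2].
- exact: bmeas_cst.
- by have [h1 h2] := mU i j; split=> //; exists 1 => w; apply: nc_unitary.
- exact: bmeas_conj.
- exact: bmeasD.
- exact: bmeasM.
Qed.

Definition haarE F : C := Ec P (fun w => F (U w)).

Lemma haarE_ext F1 F2 : F1 =1 F2 -> haarE F1 = haarE F2.
Proof. by move=> /funext ->. Qed.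

Lemma haarED F1 F2 : polyf F1 -> polyf F2 ->
  haarE (fun M => F1 M + F2 M) = haarE F1 + haarE F2.
Proof. by move=> p1 p2; apply: EcD; apply: polyf_bmeas. Qed.

Lemma haarEZ c F : polyf F -> haarE (fun M => c * F M) = c * haarE F.
Proof. by move=> p; apply: EcZ; apply: polyf_bmeas. Qed.

Lemma haarEB F1 F2 : polyf F1 -> polyf F2 ->
  haarE (fun M => F1 M - F2 M) = haarE F1 - haarE F2.
Proof.
move=> p1 p2; rewrite -mulN1r -haarEZ // -haarED //.
  by apply: haarE_ext => M; rewrite mulN1r.
by apply: polyfM => //; exact: polyf_cst.
Qed.

Lemma haarE_cst c : haarE (fun=> c) = c.
Proof. exact: Ec_cst. Qed.

Lemma haarE_sum (I : Type) (r : seq I) (F : I -> M_ -> C) : (forall i, polyf (F i)) ->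
  haarE (fun M => \sum_(i <- r) F i M) = \sum_(i <- r) haarE (F i).
Proof.
by move=> p; apply: (Ec_sum P r (F := fun i w => F i (U w))) => i; apply: polyf_bmeas.
Qed.

Lemma haarE_bound F (K : R) : polyf F -> (forall M, unitary M -> nc (F M) <= K) ->
  nc (haarE F) <= K + K.
Proof.
have [uU _ _] := haarU.
by move=> p hK; apply: nc_Ec => [|w]; [exact: polyf_bmeas|exact: hK].
Qed.

(** Invariance is given for continuous real functions of [realify M]; it is applied to the real and
    imaginary parts of [F] composed with [complexify]. *)
Lemma haar_invariant F (V : M_) : polyf F -> unitary V ->
  haarE (fun M => F (V *m M)) = haarE F.
Proof.
move=> pF uV; have [_ _ inv] := haarU; have [cr ci] := polyf_continuous pF.
have hr := inv V uV _ cr; have hi := inv V uV _ ci.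
rewrite /haarE /Ec; congr (_ +i* _)%C; congr fine.
  transitivity (expectation P (fun w => complex.Re (F (complexify (realify (V *m U w)))))).
    by congr expectation; apply/funext => w; rewrite realifyK.
  by rewrite hr; congr expectation; apply/funext => w; rewrite realifyK.
transitivity (expectation P (fun w => complex.Im (F (complexify (realify (V *m U w)))))).
  by congr expectation; apply/funext => w; rewrite realifyK.
by rewrite hi; congr expectation; apply/funext => w; rewrite realifyK.
Qed.

End Haar.
End MatrixFunctions.

(** * First-order calculus along unitaries near the identity *)

Section Gradient.
Context {R : realType} {n : nat}.
Local Notation C := R[i].
Local Notation M_ := 'M[C]_n.+1.
Implicit Types (F : M_ -> C) (G : M_ -> M_).

(** For a unit vector [u], this multiplies [u] by [z] and fixes its orthogonal complement. Such
    matrices give explicit unitaries close to the identity without a matrix exponential. *)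
Definition rot (u : 'cV[C]_n.+1) (z : C) : M_ := 1%:M + (z - 1) *: (u *m adj u).

Lemma circle_sub1 (z : C) : z * conjc z = 1 -> (z - 1) + conjc (z - 1) = - ((z - 1) * conjc (z - 1)).
Proof. by move=> h; rewrite rmorphB rmorph1; ring: h. Qed.

Lemma adj_rank1 (u : 'cV[C]_n.+1) : adj (u *m adj u) = u *m adj u.
Proof. by rewrite adjM adjK. Qed.

Lemma rank1_idem (u : 'cV[C]_n.+1) : unit_vec u -> (u *m adj u) *m (u *m adj u) = u *m adj u.
Proof.
move=> hu; rewrite mulmxA -(mulmxA u).
have -> : adj u *m u = 1%:M by rewrite [LHS]mx11_scalar hu.
by rewrite mulmx1.
Qed.

Lemma adj_rot u z : adj (rot u z) = 1%:M + conjc (z - 1) *: (u *m adj u).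
Proof. by rewrite adjD adj1 adjZ adj_rank1. Qed.

Lemma rot_unitary u z : unit_vec u -> z * conjc z = 1 -> unitary (rot u z).
Proof.
move=> hu hz; rewrite /unitary adj_rot mulmxDr mulmx1 -scalemxAr mulmxDl mul1mx.
rewrite -scalemxAl rank1_idem // scalerDr scalerA -!addrA -!scalerDl.
by rewrite addrA circle_sub1 // (mulrC (conjc _)) addNr scale0r addr0.
Qed.

(* [G] represents the derivative of [F] along left multiplication by unitaries close to the
   identity: in the direction of the projection [u u*] it is [tr (u u* G)]. *)
Definition grad F G : Prop := [/\ polyf F, polymx G &
  forall u, unit_vec u -> exists K : R, forall M z, unitary M -> z * conjc z = 1 ->
    nc (F (rot u z *m M) - F M - (z - 1) * \tr (u *m adj u *m G M)) <= K * nc (z - 1) ^+ 2].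

Lemma grad_ext F1 F2 G1 G2 : F1 =1 F2 -> G1 =1 G2 -> grad F1 G1 -> grad F2 G2.
Proof. by move=> /funext -> /funext ->. Qed.

Lemma grad_cst c : grad (fun=> c) (fun=> 0).
Proof.
split; [exact: polyf_cst|exact: polymx_cst|move=> u _; exists 0 => M z _ _].
by rewrite mulmx0 mxtrace0 mulr0 subrr subr0 nc0 mul0r.
Qed.

Lemma gradD F1 F2 G1 G2 : grad F1 G1 -> grad F2 G2 ->
  grad (fun M => F1 M + F2 M) (fun M => G1 M + G2 M).
Proof.
move=> [p1 q1 h1] [p2 q2 h2]; split; [exact: polyfD|exact: polymxD|move=> u hu].
have [K1 hK1] := h1 u hu; have [K2 hK2] := h2 u hu.
exists (K1 + K2) => M z hM hz; rewrite mulmxDr mxtraceD.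
set a := F1 (_ *m _); set b := F2 (_ *m _).
have := hK1 M z hM hz; have := hK2 M z hM hz; rewrite -/a -/b.
set s := \tr _; set t := \tr _ => le2 le1.
have -> : a + b - (F1 M + F2 M) - (z - 1) * (t + s) =
  (a - F1 M - (z - 1) * t) + (b - F2 M - (z - 1) * s) by ring.
by apply: le_trans (ncD _ _) _; rewrite [leRHS]mulrDl lerD.
Qed.

(** The Leibniz rule. The cross term is a product of two first-order increments, hence quadratic in
    z - 1. *)
Lemma gradM F1 F2 G1 G2 : grad F1 G1 -> grad F2 G2 ->
  grad (fun M => F1 M * F2 M) (fun M => F2 M *: G1 M + F1 M *: G2 M).
Proof.
move=> [p1 q1 h1] [p2 q2 h2].
split; [exact: polyfM|by apply: polymxD; apply: polymxZ|move=> u hu].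
have [K1 hK1] := h1 u hu; have [K2 hK2] := h2 u hu.
have [B1 hB1] := polyf_bounded p1; have [B2 hB2] := polyf_bounded p2.
have [L hL] := polyf_bounded (polyf_tr (polymxM (polymx_cst (u *m adj u)) q1)).
have [L2 hL2] := polyf_bounded (polyf_tr (polymxM (polymx_cst (u *m adj u)) q2)).
exists (K1 * B2 + B1 * K2 + L * (L2 + K2 * (1 + 1))) => M z hM hz.
have nz : nc z = 1.
  have := congr1 (@ComplexField.Normc.normc R) hz; rewrite ncM nc_conj nc1 => h.
  by apply/eqP; rewrite -(@eqrXn2 _ 2) ?nc_ge0 // expr2 h expr1n.
have hx : nc (z - 1) <= 1 + 1 by apply: le_trans (ncB _ _) _; rewrite nz nc1.
have hV : unitary (rot u z *m M) by apply: unitaryM => //; exact: rot_unitary.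
rewrite mulmxDr mxtraceD -!scalemxAr !mxtraceZ.
have := hB2 _ hV; have := hB1 _ hM; have := hB2 _ hM.
have := hK1 M z hM hz; have := hK2 M z hM hz.
have := hL M hM; have := hL2 M hM.
set a := F1 (_ *m _); set b := F2 (_ *m _).
set a0 := F1 M; set b0 := F2 M; set s := \tr _; set t := \tr _; set x := z - 1.
move=> lt_ ls_ e2 e1 hb0 ha0 hb.
have K2ge : 0 <= nc x ^+ 2 * K2.
  by rewrite mulrC; apply: le_trans e2; apply: nc_ge0.
have -> : a * b - a0 * b0 - x * (b0 * t + a0 * s) =
  (a - a0 - x * t) * b + a0 * (b - b0 - x * s) + (x * t) * ((b - b0 - x * s) + x * s).
  by ring.
have xge := nc_ge0 x.
apply: le_trans (ncD _ _) _; rewrite [leRHS]mulrDl; apply: lerD.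
  apply: le_trans (ncD _ _) _; rewrite [leRHS]mulrDl !ncM; apply: lerD.
    by rewrite mulrAC; apply: ler_pM => //; apply: nc_ge0.
  by rewrite -mulrA; apply: ler_pM => //; apply: nc_ge0.
rewrite !ncM.
have step : nc (b - b0 - x * s + x * s) <= nc x * (L2 + K2 * (1 + 1)).
  apply: le_trans (ncD _ _) _; rewrite mulrDr [leRHS]addrC; apply: lerD.
    (* Nothing is known about the sign of [K2] unless the increment is nonzero, hence the case
       split; one power of |x| is then traded for the bound |x| <= 2. *)
    apply: le_trans e2 _; have [x0|x0] := eqVneq (nc x) 0.
      by rewrite x0 expr0n /= mulr0 mul0r.
    have xgt : 0 < nc x ^+ 2 by rewrite exprn_gt0 // lt_neqAle eq_sym x0.
    have K2p : 0 <= K2 by rewrite -(pmulr_rge0 K2 xgt).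
    by rewrite (_ : K2 * _ = nc x * (K2 * nc x)) ?ler_wpM2l //; ring.
  by rewrite ncM ler_wpM2l.
have -> : L * (L2 + K2 * (1 + 1)) * nc x ^+ 2 = (nc x * L) * (nc x * (L2 + K2 * (1 + 1))) by ring.
apply: ler_pM => //; rewrite ?nc_ge0 ?mulr_ge0 ?nc_ge0 //.
by rewrite ler_wpM2l.
Qed.

Lemma tr_mul_delta m p (A : 'M[C]_(m, p)) i j : \tr (A *m delta_mx i j) = A j i.
Proof.
rewrite /mxtrace (bigD1 j) //= big1 ?addr0 => [|a aj].
  rewrite mxE (bigD1 i) //= big1 ?addr0 => [|b bi]; first by rewrite mxE !eqxx mulr1.
  by rewrite mxE (negbTE bi) mulr0.
by rewrite mxE big1 // => b _; rewrite mxE (negbTE aj) andbF mulr0.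
Qed.

Definition conjU (B M : M_) : M_ := M *m B *m adj M.

Lemma polymx_conjU B : polymx (conjU B).
Proof.
by apply: polymxM; [apply: polymxM; [exact: polymx_id|exact: polymx_cst]|apply: polymx_adj; exact: polymx_id].
Qed.

(** With Q = [u *m adj u], D = [conjU B M] and x = z - 1, the conjugate becomes (1 + xQ) D (1 +
    conj(x) Q). On the unit circle conj(x) = -x - |x|^2, so the first-order part is x (QD - DQ), and
    the remainder is |x|^2 (QDQ - DQ). *)
Lemma grad_conjU B i j : grad (fun M => conjU B M i j)
  (fun M => conjU B M *m delta_mx j i - delta_mx j i *m conjU B M).
Proof.
split; first exact: polymx_conjU.
  by apply: polymxB; apply: polymxM; solve [exact: polymx_conjU|exact: polymx_cst].
move=> u hu; set Q := u *m adj u.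
have pq : polymx (fun M => Q *m conjU B M *m Q - conjU B M *m Q).
  apply: polymxB; apply: polymxM; solve [exact: polymx_conjU|exact: polymx_cst|
    by apply: polymxM; solve [exact: polymx_conjU|exact: polymx_cst]].
have [K hK] := polyf_bounded (pq i j); exists K => M z hM hz.
have eC : conjU B (rot u z *m M) = rot u z *m conjU B M *m adj (rot u z).
  by rewrite /conjU adjM !mulmxA.
rewrite eC adj_rot -/Q /rot -/Q; set D := conjU B M in hK *.
have -> : \tr (Q *m (D *m delta_mx j i - delta_mx j i *m D)) = (Q *m D) i j - (D *m Q) i j.
  rewrite mulmxBr raddfB /= mulmxA tr_mul_delta; congr (_ - _).
  by rewrite mulmxA mxtrace_mulC mulmxA tr_mul_delta.
have -> : ((1%:M + (z - 1) *: Q) *m D *m (1%:M + conjc (z - 1) *: Q)) i j - D i j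
    - (z - 1) * ((Q *m D) i j - (D *m Q) i j) =
    ((z - 1) * conjc (z - 1)) * ((Q *m D *m Q - D *m Q) i j).
  rewrite mulmxDl mul1mx mulmxDr mulmx1 -!scalemxAr -!scalemxAl mulmxDl -!scalemxAl.
  clearbody D; move: (Q *m D) (D *m Q) (Q *m D *m Q) => b a c; rewrite !mxE.
  have := circle_sub1 hz; set x := z - 1; set y := conjc x => e.
  have e2 : y = - (x * y) - x by rewrite -e; ring.
  transitivity (y * (a i j + x * c i j) + x * a i j); first by ring.
  by rewrite mulrDr {1}e2; ring.
rewrite ncM ncM nc_conj -expr2 mulrC ler_wpM2r ?sqr_ge0 //.
exact: hK.
Qed.

End Gradient.

(** * Gradients of products of deterministic and conjugated factors *)

Section Splits.
Context {T : Type}.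

(** All ways to single out one element between a prefix and a suffix: the index set of the Leibniz
    rule for a product over a list. *)
Fixpoint splits (s : seq T) : seq (seq T * T * seq T) :=
  if s is x :: s' then
    ([::], x, s') :: [seq (x :: t.1.1, t.1.2, t.2) | t <- splits s']
  else [::].

Lemma size_splits s : size (splits s) = size s.
Proof. by elim: s => //= x s IH; rewrite size_map IH. Qed.

End Splits.

Lemma splitsP (T : eqType) (s : seq T) t : t \in splits s -> s = t.1.1 ++ t.1.2 :: t.2.
Proof.
elim: s t => //= x s IH t; rewrite inE => /orP[/eqP-> //|/mapP[t' /IH e ->]] /=.
by rewrite [in LHS]e.
Qed.

Lemma splits_map (T T' : Type) (f : T -> T') s :
  splits (map f s) = [seq (map f t.1.1, f t.1.2, map f t.2) | t <- splits s].
Proof. by elim: s => //= x s ->; rewrite -!map_comp. Qed.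

Section SchwingerDyson.
Context {R : realType} {n : nat}.
Local Notation C := R[i].
Local Notation M_ := 'M[C]_n.+1.

Lemma grad_prod (r : seq ((M_ -> C) * (M_ -> M_))) :
  (forall i, (i < size r)%N -> grad (nth (fun=> 0, fun=> 0) r i).1 (nth (fun=> 0, fun=> 0) r i).2) ->
  grad (fun M => \prod_(p <- r) p.1 M)
       (fun M => \sum_(t <- splits r) (\prod_(p <- t.1.1 ++ t.2) p.1 M) *: t.1.2.2 M).
Proof.
elim: r => [|p r IH] h /=.
  by apply: grad_ext (grad_cst 1) => M; rewrite big_nil.
have hp := h 0%N isT; have hr := IH (fun i hi => h i.+1 hi).
apply: grad_ext (gradM hp hr) => M /=; first by rewrite big_cons.
rewrite big_cons /= big_map /=; congr (_ + _).
by rewrite scaler_sumr; apply: eq_bigr => t _; rewrite scalerA big_cons.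
Qed.

Definition bmx (x : M_ + M_) (M : M_) : M_ :=
  match x with inl A => A | inr B => conjU B M end.

Definition bprod (s : seq (M_ + M_)) (M : M_) : M_ := \prod_(x <- s) bmx x M.

Definition israndom (x : M_ + M_) : bool := if x is inr _ then true else false.

Lemma bprod_nil M : bprod [::] M = 1%:M.
Proof. by rewrite /bprod big_nil. Qed.

Lemma bprod_cons x s M : bprod (x :: s) M = bmx x M *m bprod s M.
Proof. by rewrite /bprod big_cons. Qed.

Lemma bprod_cat s1 s2 M : bprod (s1 ++ s2) M = bprod s1 M *m bprod s2 M.
Proof. by rewrite /bprod big_cat. Qed.

Lemma polymx_bmx x : polymx (bmx x).
Proof. by case: x => A; [exact: polymx_cst|exact: polymx_conjU]. Qed.

Lemma polymx_bprod s : polymx (bprod s).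
Proof.
elim: s => [|x s IH].
  by move=> i j; apply: polyf_ext (polyf_cst (1%:M i j)) => M; rewrite /bprod big_nil.
move=> i j; apply: polyf_ext (polymxM (polymx_bmx x) IH i j) => M.
by rewrite bprod_cons.
Qed.

(** In the direction Q a conjugated factor D varies by QD - DQ. Between a prefix p and a suffix q,
    cyclicity turns tr (Z p (QD - DQ) q) into tr (Q (D q Z p - q Z p D)), and this is the matrix
    paired with Q. *)
Definition bterm (Z M : M_) (t : seq (M_ + M_) * (M_ + M_) * seq (M_ + M_)) : M_ :=
  bmx t.1.2 M *m bprod t.2 M *m Z *m bprod t.1.1 M
  - bprod t.2 M *m Z *m bprod t.1.1 M *m bmx t.1.2 M.

Definition bgrad (s : seq (M_ + M_)) (Z M : M_) : M_ :=
  \sum_(t <- splits s | israndom t.1.2) bterm Z M t.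

Lemma grad_sum (I : Type) (r : seq I) (F : I -> M_ -> C) (G : I -> M_ -> M_) :
  (forall i, grad (F i) (G i)) ->
  grad (fun M => \sum_(i <- r) F i M) (fun M => \sum_(i <- r) G i M).
Proof.
move=> h; elim: r => [|i r IH].
  by apply: grad_ext (grad_cst 0) => M; rewrite big_nil.
by apply: grad_ext (gradD (h i) IH) => M; rewrite big_cons.
Qed.

Lemma bterm0 M t : bterm 0 M t = 0.
Proof. by rewrite /bterm !(mulmx0, mul0mx) subrr. Qed.

Lemma btermD Z1 Z2 M t : bterm (Z1 + Z2) M t = bterm Z1 M t + bterm Z2 M t.
Proof.
rewrite /bterm; move: (bprod t.1.1 M) (bprod t.2 M) (bmx t.1.2 M) => A B X.
by rewrite !mulmxDr !mulmxDl opprD addrACA.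
Qed.

Lemma btermZ c Z M t : bterm (c *: Z) M t = c *: bterm Z M t.
Proof.
rewrite /bterm; move: (bprod t.1.1 M) (bprod t.2 M) (bmx t.1.2 M) => A B X.
by rewrite -!(scalemxAr, scalemxAl) scalerBr.
Qed.

Lemma bgrad0 s M : bgrad s 0 M = 0.
Proof. by rewrite /bgrad big1 // => t _; rewrite bterm0. Qed.

Lemma bgradD s Z1 Z2 M : bgrad s (Z1 + Z2) M = bgrad s Z1 M + bgrad s Z2 M.
Proof. by rewrite /bgrad -big_split; apply: eq_bigr => t _; rewrite btermD. Qed.

Lemma bgradZ s c Z M : bgrad s (c *: Z) M = c *: bgrad s Z M.
Proof. by rewrite /bgrad scaler_sumr; apply: eq_bigr => t _; rewrite btermZ. Qed.

Lemma bgrad_sum (I : Type) (r : seq I) s (Z : I -> M_) M :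
  bgrad s (\sum_(i <- r) Z i) M = \sum_(i <- r) bgrad s (Z i) M.
Proof.
exact: (big_morph (fun Z => bgrad s Z M) (fun Z1 Z2 => bgradD s Z1 Z2 M) (bgrad0 s M)).
Qed.

Lemma sum_splits_cons (F : seq (M_ + M_) * (M_ + M_) * seq (M_ + M_) -> M_) x s :
  \sum_(t <- splits (x :: s) | israndom t.1.2) F t =
  (if israndom x then F ([::], x, s) else 0)
  + \sum_(t <- splits s | israndom t.1.2) F (x :: t.1.1, t.1.2, t.2).
Proof. by rewrite /= big_cons big_map /=; case: israndom; rewrite ?add0r. Qed.

Lemma bgrad_cons x s Z M : bgrad (x :: s) Z M =
  (if israndom x then bmx x M *m bprod s M *m Z - bprod s M *m Z *m bmx x M else 0)
  + bgrad s (Z *m bmx x M) M.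
Proof.
have e1 : bterm Z M ([::], x, s) = bmx x M *m bprod s M *m Z - bprod s M *m Z *m bmx x M.
  rewrite /bterm /= bprod_nil; move: (bprod s M) (bmx x M) => X Y.
  by rewrite 2!mulmx1.
have e2 t : bterm Z M (x :: t.1.1, t.1.2, t.2) = bterm (Z *m bmx x M) M t.
  rewrite /bterm /= bprod_cons.
  by move: (bprod t.1.1 M) (bprod t.2 M) (bmx x M) (bmx t.1.2 M) => A B X Y; rewrite !mulmxA.
have e3 : \sum_(t <- splits s | israndom t.1.2) bterm Z M (x :: t.1.1, t.1.2, t.2) =
    bgrad s (Z *m bmx x M) M by apply: eq_bigr => t _; exact: e2.
by apply: etrans (sum_splits_cons _ _ _) _; rewrite e1 -e3.
Qed.

(** A conjugated head is expanded over matrix units, which makes it a sum of scalar entries times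
    traces of the tail; the scalar Leibniz rule and the induction hypothesis then apply, and the
    matrix units are summed back. *)
Lemma bgrad_grad s Z : grad (fun M => \tr (Z *m bprod s M)) (bgrad s Z).
Proof.
elim: s Z => [|x s IH] Z.
  apply: grad_ext (grad_cst (\tr Z)) => M; rewrite /bgrad ?big_nil //.
  by rewrite /bprod big_nil mulmx1.
case: x => [A|B].
  apply: grad_ext (IH (Z *m A)) => M; first by rewrite bprod_cons mulmxA.
  by rewrite bgrad_cons add0r.
pose F (a b : 'I_n.+1) M := conjU B M a b * \tr (Z *m delta_mx a b *m bprod s M).
pose G (a b : 'I_n.+1) M := \tr (Z *m delta_mx a b *m bprod s M) *:
    (conjU B M *m delta_mx b a - delta_mx b a *m conjU B M)
  + conjU B M a b *: bgrad s (Z *m delta_mx a b) M.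
have h : grad (fun M => \sum_(a < n.+1) \sum_(b < n.+1) F a b M)
    (fun M => \sum_(a < n.+1) \sum_(b < n.+1) G a b M).
  by do 2!(apply: grad_sum => ?); apply: gradM; [exact: grad_conjU|exact: IH].
have eS M : \sum_(a < n.+1) \sum_(b < n.+1) conjU B M a b *: delta_mx a b = conjU B M.
  by rewrite [RHS]matrix_sum_delta.
apply: grad_ext h => M.
  rewrite bprod_cons /= -[in RHS](eS M) mulmxA mulmx_sumr mulmx_suml raddf_sum /=.
  apply: eq_bigr => a _; rewrite mulmx_sumr mulmx_suml raddf_sum /=.
  by apply: eq_bigr => b _; rewrite -scalemxAr -scalemxAl mxtraceZ.
rewrite bgrad_cons /=.
under eq_bigr => a _ do rewrite big_split /=.
rewrite big_split /=.
have -> : \sum_(a < n.+1) \sum_(b < n.+1) conjU B M a b *: bgrad s (Z *m delta_mx a b) M =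
    bgrad s (Z *m conjU B M) M.
  rewrite -[X in bgrad s (Z *m X)](eS M) mulmx_sumr bgrad_sum; apply: eq_bigr => a _.
  rewrite mulmx_sumr bgrad_sum; apply: eq_bigr => b _.
  by rewrite -scalemxAr bgradZ.
have -> : \sum_(a < n.+1) \sum_(b < n.+1) \tr (Z *m delta_mx a b *m bprod s M) *:
    (conjU B M *m delta_mx b a - delta_mx b a *m conjU B M) =
    conjU B M *m bprod s M *m Z - bprod s M *m Z *m conjU B M; last by [].
  pose X := bprod s M *m Z.
  have eX : X = \sum_(a < n.+1) \sum_(b < n.+1) \tr (Z *m delta_mx a b *m bprod s M) *: delta_mx b a.
    rewrite [LHS]matrix_sum_delta exchange_big; apply: eq_bigr => a _; apply: eq_bigr => b _.
    by congr (_ *: _); rewrite mxtrace_mulC mulmxA tr_mul_delta.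
symmetry; rewrite -mulmxA -/X eX mulmx_sumr mulmx_suml -sumrB; apply: eq_bigr => a _.
rewrite mulmx_sumr mulmx_suml -sumrB; apply: eq_bigr => b _.
by rewrite -scalemxAr -scalemxAl scalerBr.
Qed.

Definition sesqui (g : M_) (u w : 'cV[C]_n.+1) : C := (adj u *m g *m w) 0 0.

Lemma sesqui_delta g i j : sesqui g (delta_mx i 0) (delta_mx j 0) = g i j.
Proof.
rewrite /sesqui (_ : adj _ = delta_mx 0 i).
  by rewrite -rowE -colE !mxE.
by apply/matrixP => a b; rewrite !mxE andbC; case: (_ && _); rewrite ?rmorph1 ?rmorph0.
Qed.

Lemma sesquiDl g u1 u2 w : sesqui g (u1 + u2) w = sesqui g u1 w + sesqui g u2 w.
Proof. by rewrite /sesqui adjD mulmxDl mulmxDl mxE. Qed.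

Lemma sesquiDr g u w1 w2 : sesqui g u (w1 + w2) = sesqui g u w1 + sesqui g u w2.
Proof. by rewrite /sesqui mulmxDr mxE. Qed.

Lemma sesquiZl g c u w : sesqui g (c *: u) w = conjc c * sesqui g u w.
Proof. by rewrite /sesqui adjZ -scalemxAl -scalemxAl mxE. Qed.

Lemma sesquiZr g c u w : sesqui g u (c *: w) = c * sesqui g u w.
Proof. by rewrite /sesqui -scalemxAr mxE. Qed.

Lemma sesqui_expand (X : M_) i j (a b : C) :
  sesqui X (a *: delta_mx i 0 + b *: delta_mx j 0) (a *: delta_mx i 0 + b *: delta_mx j 0) =
  conjc a * a * X i i + conjc a * b * X i j + (conjc b * a * X j i + conjc b * b * X j j).
Proof. by rewrite sesquiDl !sesquiDr !sesquiZl !sesquiZr !sesqui_delta !mulrA. Qed.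

(** Polarization. Basis vectors give the diagonal entries; the unit vectors (e_i + w e_j) / sqrt 2
    with w = 1 and w = i give two equations that force both off-diagonal entries to vanish. *)
Lemma sesqui_eq0 (g : M_) :
  (forall u : 'cV[C]_n.+1, unit_vec u -> \tr (u *m adj u *m g) = 0) -> g = 0.
Proof.
move=> h; have q u : sesqui 1%:M u u = 1 -> sesqui g u u = 0.
  rewrite /sesqui mulmx1 => /h.
  by rewrite -mulmxA mxtrace_mulC /mxtrace big_ord1.
have one i j : (1%:M : M_) i j = (i == j)%:R by rewrite mxE.
have diag i : g i i = 0.
  have := q (1 *: delta_mx i 0 + 0 *: delta_mx i 0).
  rewrite !sesqui_expand !one eqxx !rmorph0 !rmorph1 !mulr0 !mul0r !mulr1 !mul1r !addr0.
  exact.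
apply/matrixP => i j; rewrite [RHS]mxE.
have [<-|ij] := eqVneq i j; first exact: diag.
pose s : C := (Num.sqrt (2^-1 : R))%:C%C.
have ss : conjc s * s = 2^-1.
  rewrite conjc_real -rmorphM /= -expr2 sqr_sqrtr ?invr_ge0 ?ler0n //.
  by rewrite fmorphV rmorph_nat.
clearbody s.
have two0 : (2 : C) != 0 by rewrite pnatr_eq0.
have off w : conjc w * w = 1 -> w * g i j + conjc w * g j i = 0.
  move=> hw; have := q (s *: delta_mx i 0 + (s * w) *: delta_mx j 0).
  rewrite !sesqui_expand !one !eqxx (negbTE ij) eq_sym (negbTE ij) !diag.
  rewrite rmorphM /= !mulr1 !mulr0 !addr0 add0r => h2.
  have e1 : conjc s * s + conjc s * conjc w * (s * w) = 1.
    by rewrite mulrACA ss hw mulr1 -mulr2n -[_ *+ 2]mulr_natr mulVf.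
  have := h2 e1; rewrite add0r => h3; apply: (mulfI (x := conjc s * s)).
    by rewrite ss invr_eq0.
  by rewrite mulr0 -[RHS]h3; ring.
have e1 := off 1; have e2 := off 'i%C.
have i2 : ('i%C : C) * 'i%C = -1 by rewrite -expr2 sqr_i.
have ci : conjc ('i%C : C) = - 'i%C by apply/eqP; rewrite eq_complex /= oppr0 !eqxx.
have i0 : ('i%C : C) != 0 by apply/eqP => i0; move/eqP: i2; rewrite i0 mul0r eq_sym oppr_eq0 oner_eq0.
move: e1 e2; rewrite conjc1 ci mulNr i2 opprK !mul1r mulNr => /(_ erefl) e1 /(_ erefl) e2.
have e3 : g i j = g j i.
  by apply: (mulfI i0); apply/eqP; rewrite -subr_eq0; apply/eqP.
apply: (mulfI (x := 2)) => //; rewrite mulr0 -[RHS]e1 -e3.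
by rewrite mulr2n mulrDl mul1r.
Qed.

Section Haar.
Context {d : measure_display} {T : measurableType d} {P : probability T R}.
Variable U : T -> M_.
Hypothesis haarU : haar_unitary P U.
Notation E := (@haarE R n d T P U).

(** The rational parametrization z = (1 - t^2 + 2it) / (1 + t^2) is used: for t <= 1 one has |z - 1|
    <= 2t^2 + 2t <= 4t, which explains t = min(1, e/4). *)
Lemma circle_small (e : R) : 0 < e ->
  exists z : C, [/\ z * conjc z = 1, z - 1 != 0 & nc (z - 1) <= e].
Proof.
move=> e0; pose t := Num.min 1 (e / 4).
have t0 : 0 < t by rewrite lt_min ltr01 divr_gt0.
have t1 : t <= 1 by rewrite ge_min lexx.
have te : 4 * t <= e by rewrite mulrC -ler_pdivlMr // ge_min lexx orbT.
have d0 : 0 < 1 + t ^+ 2 by rewrite ltr_pwDl // sqr_ge0.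
exists (((1 - t ^+ 2) / (1 + t ^+ 2)) +i* (2 * t / (1 + t ^+ 2)))%C; split.
- apply/eqP; rewrite eq_complex /=; apply/andP; split; apply/eqP; field; exact: lt0r_neq0.
- rewrite eq_complex /= negb_and subr0; apply/orP; right.
  by rewrite mulf_neq0 ?invr_eq0 ?mulf_neq0 ?pnatr_eq0 // ?lt0r_neq0.
apply: le_trans (nc_le_absReIm _) _ => /=; rewrite subr0; apply: le_trans te.
have -> : (1 - t ^+ 2) / (1 + t ^+ 2) - 1 = - (2 * t ^+ 2 / (1 + t ^+ 2)).
  by field; exact: lt0r_neq0.
have le2 x : 0 <= x -> `|x / (1 + t ^+ 2)| <= x.
  move=> x0; rewrite ger0_norm; last by rewrite divr_ge0 // ltW.
  rewrite ler_pdivrMr // ler_peMr //.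
  by rewrite lerDl sqr_ge0.
have t2 : t ^+ 2 <= t by rewrite expr2 ler_piMr // ltW.
rewrite normrN; apply: (le_trans (lerD (le2 _ _) (le2 _ _))).
- by rewrite mulr_ge0 // sqr_ge0.
- by rewrite mulr_ge0 // ltW.
by lra.
Qed.

(* Invariance makes the first-order term of [E (F (rot u z *m U)) - E (F U)], as [z] tends to 1
   along the unit circle, vanish. *)
Lemma haar_grad F G : grad F G -> forall i j, E (fun M => G M i j) = 0.
Proof.
move=> [pF pG hG].
suff h : (\matrix_(i, j) E (fun M => G M i j)) = 0 :> M_.
  by move=> i j; have /matrixP /(_ i j) := h; rewrite !mxE.
apply: sesqui_eq0 => u hu.
have [K hK] := hG u hu.
have pt : polyf (fun M => \tr (u *m adj u *m G M)).
  by apply: polyf_tr; apply: polymxM => //; exact: polymx_cst.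
have -> : \tr (u *m adj u *m \matrix_(i, j) E (fun M => G M i j)) =
    E (fun M => \tr (u *m adj u *m G M)).
  move: (u *m adj u) => Q; rewrite (@haarE_ext _ _ _ _ _ _ _ (fun M => \sum_i \sum_j Q i j * G M j i)).
    rewrite (haarE_sum haarU _ (F := fun i M => \sum_j Q i j * G M j i)); last first.
      by move=> i; apply: polyf_sum => j; apply: polyfM; [exact: polyf_cst|exact: pG].
    apply: eq_bigr => i _; rewrite (haarE_sum haarU _ (F := fun j M => Q i j * G M j i)).
      by rewrite mxE; apply: eq_bigr => j _; rewrite haarEZ ?mxE //; exact: pG.
    by move=> j; apply: polyfM; [exact: polyf_cst|exact: pG].
  by move=> M; apply: eq_bigr => i _; rewrite mxE.
set a := E _.
(* By invariance the two zeroth-order terms cancel in expectation, so the expected remainder is -(z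
   - 1) a, while it is quadratically small. Dividing by |z - 1| and letting z tend to 1 gives a =
   0. *)
have key z : z * conjc z = 1 -> nc (z - 1) * nc a <= (K + K) * nc (z - 1) ^+ 2.
  move=> hz; have uV := rot_unitary hu hz.
  have [uU _ _] := haarU.
  pose Rm := fun M => F (rot u z *m M) - F M - (z - 1) * \tr (u *m adj u *m G M).
  have pV : forall H, polyf H -> polyf (fun M => H (rot u z *m M)).
    move=> H; elim=> [c|i j|{}H _ IH|F1 F2 _ IH1 _ IH2|F1 F2 _ IH1 _ IH2].
    - exact: polyf_cst.
    - by apply: polymxM; [exact: polymx_cst|exact: polymx_id].
    - exact: polyf_conj.
    - exact: polyfD.
    - exact: polyfM.
  have pxt : polyf (fun M => (z - 1) * \tr (u *m adj u *m G M)).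
    by apply: polyfM => //; exact: polyf_cst.
  have pB (F1 F2 : M_ -> C) : polyf F1 -> polyf F2 -> polyf (fun M => F1 M - F2 M).
    move=> p1 p2; apply: polyf_ext (polyfD p1 (polyfM (polyf_cst (-1)) p2)) => M.
    by rewrite mulN1r.
  have pd := pB _ _ (pV _ pF) pF; have pRm : polyf Rm := pB _ _ pd pxt.
  have eR : E Rm = - ((z - 1) * a).
    rewrite (haarEB haarU pd pxt) (haarEB haarU (pV _ pF) pF).
    by rewrite haarEZ // (haar_invariant haarU pF uV) subrr sub0r.
  rewrite -ncM -ncN -eR [leRHS]mulrDl; apply: (haarE_bound haarU) => // M hM.
  exact: hK.
have aK e : 0 < e -> nc a <= (K + K) * e.
  move=> e0; have [z [hz z1 ze]] := circle_small e0.
  have zp : 0 < nc (z - 1).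
    by rewrite lt_neqAle nc_ge0 andbT eq_sym; apply: contra_neq z1; exact: nc_eq0.
  have := key z hz; rewrite expr2 mulrA (mulrC (nc _)) ler_pM2r // => h.
  apply: le_trans h _; rewrite ler_wpM2l //.
  have K0 : 0 <= (K + K) * nc (z - 1) ^+ 2.
    by apply: le_trans (key z hz); rewrite mulr_ge0 ?nc_ge0.
  by rewrite -(pmulr_lge0 _ (exprn_gt0 2 zp)).
have Kp : 0 <= K + K by have := aK 1 ltr01; rewrite mulr1; apply: le_trans; exact: nc_ge0.
apply: nc_eq0; apply/eqP; rewrite eq_le nc_ge0 andbT.
apply/ler_addgt0Pr => e e0; rewrite add0r.
have e1 : 0 < e / (K + K + 1) by rewrite divr_gt0 // ltr_wpDl.
apply: le_trans (aK _ e1) _.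
rewrite mulrCA ger_pMr // ler_pdivrMr ?mul1r ?lerDl // ltr_wpDl //.
Qed.

End Haar.
End SchwingerDyson.

(** * The Schwinger-Dyson equation *)

Section Equation.
Context {R : realType} {n : nat}.
Local Notation C := R[i].
Local Notation M_ := 'M[C]_n.+1.
Local Notation blocks := (seq (M_ + M_)).
Context {d : measure_display} {T : measurableType d} {P : probability T R}.
Variable U : T -> M_.
Hypothesis haarU : haar_unitary P U.
Notation E := (@haarE R n d T P U).

(* A product of functionals [X |-> tr (Z X)] evaluated at alternating products: [Z = 1/n] gives
   the normalized trace, and [Z = v v*] the vector state. *)
Definition fprod (r : seq (M_ * blocks)) (M : M_) : C :=
  \prod_(f <- r) \tr (f.1 *m bprod f.2 M).

Lemma polyf_fprod r : polyf (fprod r).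
Proof.
apply: polyf_prod => f; apply: polyf_tr; apply: polymxM; first exact: polymx_cst.
exact: polymx_bprod.
Qed.

Lemma grad_fprod r : grad (fprod r)
  (fun M => \sum_(u <- splits r) fprod (u.1.1 ++ u.2) M *: bgrad u.1.2.2 u.1.2.1 M).
Proof.
pose g (f : M_ * blocks) : (M_ -> C) * (M_ -> M_) :=
  (fun M => \tr (f.1 *m bprod f.2 M), bgrad f.2 f.1).
have h : forall i, (i < size (map g r))%N ->
    grad (nth (fun=> 0, fun=> 0) (map g r) i).1 (nth (fun=> 0, fun=> 0) (map g r) i).2.
  move=> i; rewrite size_map => hi; rewrite (nth_map (0, [::])) //; exact: bgrad_grad.
apply: grad_ext (grad_prod h) => M; first by rewrite big_map.
rewrite splits_map big_map; apply: eq_bigr => u _ /=.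
by rewrite -map_cat big_map.
Qed.

(** Summing over the matrix unit decouples what stands on its two sides: this is how one trace
    becomes a product of two. *)
Lemma tr_sum_entries (A B Q : M_) :
  \sum_(a < n.+1) \sum_(b < n.+1) \sum_(j < n.+1) Q b j * (A *m delta_mx b a *m B) j a
  = \tr (Q *m A) * \tr B.
Proof.
rewrite [X in _ * X]/mxtrace big_distrr; apply: eq_bigr => a _ /=.
rewrite /mxtrace big_distrl /=; apply: eq_bigr => b _.
rewrite mxE big_distrl; apply: eq_bigr => j _ /=.
rewrite -mulrA; congr (_ * _).
rewrite mxE (bigD1 a) //= big1 ?addr0 => [|c ca].
  rewrite mxE (bigD1 b) //= big1 ?addr0 => [|c cb]; first by rewrite mxE !eqxx mulr1.
  by rewrite mxE (negbTE cb) mulr0.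
rewrite mxE big1 ?mul0r // => e _; by rewrite mxE (negbTE ca) andbF mulr0.
Qed.

Lemma tr_sum_entries2 (G W Q : M_) :
  \sum_(a < n.+1) \sum_(b < n.+1) \sum_(j < n.+1) Q b j * (W a b * G j a)
  = \tr (Q *m G *m W).
Proof.
rewrite mxtrace_mulC; apply: eq_bigr => a _; rewrite mxE; apply: eq_bigr => b _.
by rewrite mxE big_distrr; apply: eq_bigr => j _ /=; rewrite mulrCA.
Qed.

Definition index3 := ('I_n.+1 * ('I_n.+1 * 'I_n.+1))%type.

Lemma tr_sum_index (A B Q : M_) :
  \sum_(e : index3) Q e.2.1 e.2.2 * (A *m delta_mx e.2.1 e.1 *m B) e.2.2 e.1 = \tr (Q *m A) * \tr B.
Proof.
rewrite -tr_sum_entries.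
under [RHS]eq_bigr => a _ do rewrite (pair_bigA _ (fun b j => Q b j * (A *m delta_mx b a *m B) j a)) /=.
by rewrite (pair_bigA _ (fun a p => Q p.1 p.2 * (A *m delta_mx p.1 a *m B) p.2 a)).
Qed.

Lemma tr_sum_index2 (G W Q : M_) :
  \sum_(e : index3) Q e.2.1 e.2.2 * (W e.1 e.2.1 * G e.2.2 e.1) = \tr (Q *m G *m W).
Proof.
rewrite -tr_sum_entries2.
under [RHS]eq_bigr => a _ do rewrite (pair_bigA _ (fun b j => Q b j * (W a b * G j a))) /=.
by rewrite (pair_bigA _ (fun a p => Q p.1 p.2 * (W a p.1 * G p.2 a))).
Qed.

(** Contribution of one conjugated factor when the distinguished product is itself differentiated:
    the product is broken just before, respectively just after, that factor. *)
Definition split_term (s : blocks) (Q : M_) (t : blocks * (M_ + M_) * blocks) (M : M_) : C :=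
  \tr (bprod t.1.1 M) * \tr (Q *m (bmx t.1.2 M *m bprod t.2 M))
  - \tr (bprod t.1.1 M *m bmx t.1.2 M) * \tr (Q *m bprod t.2 M).

(** Contribution of one conjugated factor of another functional tr (Z ...): its product is inserted
    next to the distinguished one. *)
Definition merge_term (s : blocks) (Q Z : M_) (t : blocks * (M_ + M_) * blocks) (M : M_) : C :=
  \tr (Q *m bterm Z M t *m bprod s M).

Lemma polymx_bterm Z t : polymx (fun M : M_ => bterm Z M t).
Proof.
have p1 := polymx_bprod t.1.1; have p2 := polymx_bprod t.2; have px := polymx_bmx t.1.2.
have pZ : polymx (fun _ : M_ => Z) by exact: polymx_cst.
apply: polymxB; first exact: (polymxM (polymxM (polymxM px p2) pZ) p1).
exact: (polymxM (polymxM (polymxM p2 pZ) p1) px).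
Qed.

Lemma polyf_split_term s Q t : polyf (split_term s Q t).
Proof.
pose A M := bprod t.1.1 M *m bmx t.1.2 M; pose B M := bmx t.1.2 M *m bprod t.2 M.
have pA : polymx A by apply: polymxM; [exact: polymx_bprod|exact: polymx_bmx].
have pB : polymx B by apply: polymxM; [exact: polymx_bmx|exact: polymx_bprod].
apply: polyf_ext (polyfD
  (polyfM (polyf_tr (polymx_bprod t.1.1)) (polyf_tr (polymxM (polymx_cst Q) pB)))
  (polyfM (polyf_cst (-1)) (polyfM (polyf_tr pA)
    (polyf_tr (polymxM (polymx_cst Q) (polymx_bprod t.2)))))) => M.
by rewrite mulN1r.
Qed.

Lemma polyf_merge_term s Q Z t : polyf (merge_term s Q Z t).
Proof.
apply: polyf_tr; apply: polymxM; last exact: polymx_bprod.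
by apply: polymxM; [exact: polymx_cst|exact: polymx_bterm].
Qed.

Lemma split_identity s (Q M : M_) :
  \sum_(e : index3) Q e.2.1 e.2.2 * bgrad s (delta_mx e.2.1 e.1) M e.2.2 e.1 =
  \sum_(t <- splits s | israndom t.1.2) split_term s Q t M.
Proof.
transitivity (\sum_(e : index3) \sum_(t <- splits s | israndom t.1.2)
   Q e.2.1 e.2.2 * bterm (delta_mx e.2.1 e.1) M t e.2.2 e.1).
  by apply: eq_bigr => e _; rewrite /bgrad summxE big_distrr.
rewrite exchange_big /=; apply: eq_bigr => t _; rewrite /split_term /bterm.
move: (bprod t.1.1 M) (bprod t.2 M) (bmx t.1.2 M) => A B X.
rewrite mulrC -tr_sum_index mulrC -tr_sum_index -sumrB; apply: eq_bigr => e _.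
move: (delta_mx _ _) => Z; rewrite -(mulmxA _ A X).
move: (_ *m Z *m A) (_ *m Z *m (A *m X)) => Y1 Y2.
by rewrite -mulrBr; congr (_ * _); rewrite [LHS]mxE [X in _ + X = _]mxE.
Qed.

Lemma merge_identity s (Q : M_) r (M : M_) :
  \tr (Q *m (\sum_(u <- splits r) fprod (u.1.1 ++ u.2) M *: bgrad u.1.2.2 u.1.2.1 M) *m bprod s M)
  = \sum_(u <- splits r) \sum_(t <- splits u.1.2.2 | israndom t.1.2)
     merge_term s Q u.1.2.1 t M * fprod (u.1.1 ++ u.2) M.
Proof.
rewrite mulmx_sumr mulmx_suml raddf_sum /=; apply: eq_bigr => u _.
rewrite -scalemxAr -scalemxAl mxtraceZ /bgrad mulmx_sumr mulmx_suml raddf_sum /= mulrC.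
by rewrite big_distrl.
Qed.

(** The vanishing expectation of the gradient is applied to every entry of [bprod s] times
    [fprod r]; the resulting entries are contracted against [Q]. Differentiating [s] gives the first
    sum, differentiating a factor of [fprod r] the second. *)
Theorem schwinger_dyson (s : blocks) (Q : M_) (r : seq (M_ * blocks)) :
  \sum_(t <- splits s | israndom t.1.2) E (fun M => split_term s Q t M * fprod r M)
  + \sum_(u <- splits r) \sum_(t <- splits u.1.2.2 | israndom t.1.2)
      E (fun M => merge_term s Q u.1.2.1 t M * fprod (u.1.1 ++ u.2) M) = 0.
Proof.
pose D M := \sum_(u <- splits r) fprod (u.1.1 ++ u.2) M *: bgrad u.1.2.2 u.1.2.1 M.
(* For e = (a, (b, j)) this is the gradient of the entry (a, b) of [bprod s] times [fprod r]; its
   entry (j, a) will be weighted by the entry (b, j) of [Q]. *)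
pose H (e : index3) M :=
  fprod r M *: bgrad s (delta_mx e.2.1 e.1) M + bprod s M e.1 e.2.1 *: D M.
have gH e : grad (fun M => bprod s M e.1 e.2.1 * fprod r M) (H e).
  have h := gradM (bgrad_grad s (delta_mx e.2.1 e.1)) (grad_fprod r).
  apply: grad_ext h => M; first by rewrite mxtrace_mulC tr_mul_delta.
  by rewrite mxtrace_mulC tr_mul_delta.
have pH e j : polyf (fun M => H e M j e.1) by have [_ h _] := gH e; apply: h.
have H0 e j : E (fun M => H e M j e.1) = 0 by exact: (haar_grad haarU (gH e)).
have pL t : polyf (fun M => split_term s Q t M * fprod r M).
  by apply: polyfM; [exact: polyf_split_term|exact: polyf_fprod].
have pR u t : polyf (fun M => merge_term s Q u.1.2.1 t M * fprod (u.1.1 ++ u.2) M).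
  by apply: polyfM; [exact: polyf_merge_term|exact: polyf_fprod].
have total : E (fun M => \sum_(e : index3) Q e.2.1 e.2.2 * H e M e.2.2 e.1) = 0.
  rewrite (haarE_sum haarU _ (F := fun e M => Q e.2.1 e.2.2 * H e M e.2.2 e.1)); last first.
    by move=> e; apply: polyfM; [exact: polyf_cst|exact: pH].
  by rewrite big1 // => e _; rewrite haarEZ ?H0 ?mulr0 //; exact: pH.
pose L M := \sum_(t <- [seq t <- splits s | israndom t.1.2]) split_term s Q t M * fprod r M.
pose K u M := \sum_(t <- [seq t <- splits u.1.2.2 | israndom t.1.2])
   merge_term s Q u.1.2.1 t M * fprod (u.1.1 ++ u.2) M.
have pK u : polyf (K u) by apply: polyf_sum => t; exact: pR.
have eL : \sum_(t <- splits s | israndom t.1.2) E (fun M => split_term s Q t M * fprod r M) = E L.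
  by rewrite -big_filter -(haarE_sum haarU _ (F := fun t M => split_term s Q t M * fprod r M)).
have eK u : \sum_(t <- splits u.1.2.2 | israndom t.1.2)
    E (fun M => merge_term s Q u.1.2.1 t M * fprod (u.1.1 ++ u.2) M) = E (K u).
  by rewrite -big_filter -(haarE_sum haarU _ (F := fun t M => merge_term s Q u.1.2.1 t M * fprod (u.1.1 ++ u.2) M)) //.
have pLs : polyf L by apply: polyf_sum => t; exact: pL.
rewrite eL (eq_bigr _ (fun u _ => eK u)) -haarE_sum // -haarED //; last exact: polyf_sum.
apply: etrans total; apply: haarE_ext => M.
transitivity (\sum_(e : index3) (fprod r M * (Q e.2.1 e.2.2 * bgrad s (delta_mx e.2.1 e.1) M e.2.2 e.1)
   + Q e.2.1 e.2.2 * (bprod s M e.1 e.2.1 * D M e.2.2 e.1))); last first.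
  apply: eq_bigr => e _; rewrite /H; move: (bgrad _ _ _) (D M) => X Y.
  by rewrite mxE [(_ *: X) _ _]mxE [(_ *: Y) _ _]mxE mulrDr mulrCA.
have eLM : fprod r M * \sum_(t <- splits s | israndom t.1.2) split_term s Q t M = L M.
  by rewrite /L big_filter -big_distrl mulrC.
have eKM : \tr (Q *m D M *m bprod s M) = \sum_(u <- splits r) K u M.
  by rewrite merge_identity; apply: eq_bigr => u _; rewrite /K big_filter.
apply: esym; apply: etrans (big_split _ _ _ _ _) _ => /=.
by rewrite -mulr_sumr split_identity tr_sum_index2 eLM eKM.
Qed.

End Equation.

(** * Alternating blocks, their centering, and configurations of functionals *)

Section Words.
Context {k l : nat}.
Local Notation wd := (word k l).

Definition blockp (u : wd) : bool := (u != [::]) && (pureX u || pureY u).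
Definition good (bs : seq wd) : bool := all blockp bs.
Definition alt (bs : seq wd) : bool := good bs && sorted (fun a b => pureX a != pureX b) bs.

End Words.

Section Configurations.
Context {R : realType} {k l n : nat}.
Local Notation C := R[i].
Local Notation M_ := 'M[C]_n.+1.
Local Notation wd := (word k l).
Variables (A : 'I_k -> M_) (B : 'I_l -> M_) (v : 'cV[C]_n.+1).
Hypothesis unitv : unit_vec v.
Context {d : measure_display} {T : measurableType d} (P : probability T R).
Variable U : T -> M_.
Hypothesis haarU : haar_unitary P U.

Lemma haarE_extU (F1 F2 : M_ -> C) :
  (forall M, unitary M -> F1 M = F2 M) -> @haarE _ _ _ _ P U F1 = @haarE _ _ _ _ P U F2.
Proof.
have [uU _ _] := haarU; move=> h; rewrite /haarE; congr Ec.
by apply/funext => w; apply: h.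
Qed.

Definition twd (u : wd) : C := trn (evalw (mxs A B) u).

(** Centering uses the trace at the current size, not its limit, so the trace of a block vanishes
    exactly. The constructor records whether the block is deterministic or will be conjugated by the
    unitary. *)
Definition blk (u : wd) : M_ + M_ :=
  let X := evalw (mxs A B) u - (twd u)%:M in if pureX u then inl X else inr X.

Definition cev (bs : seq wd) (M : M_) : M_ := bprod (map blk bs) M.

Definition kmx (b : bool) : M_ := if b then (n.+1%:R^-1)%:M else v *m adj v.

Definition fval (b : bool) (bs : seq wd) (M : M_) : C := \tr (kmx b *m cev bs M).

Definition fcfg (c : seq (bool * seq wd)) : seq (M_ * seq (M_ + M_)) :=
  [seq (kmx p.1, map blk p.2) | p <- c].

(* The moment of a configuration: each entry [(b, bs)] contributes the normalized trace
   ([b = true]) or the vector state ([b = false]) of the product of the centered blocks [bs]. *)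
Definition Ecf (c : seq (bool * seq wd)) : C := @haarE _ _ _ _ P U (fprod (fcfg c)).

Lemma fprod_cons b bs c M : fprod (fcfg ((b, bs) :: c)) M = fval b bs M * fprod (fcfg c) M.
Proof. by rewrite /fprod /= big_cons. Qed.

Lemma cev_cat b1 b2 M : cev (b1 ++ b2) M = cev b1 M *m cev b2 M.
Proof. by rewrite /cev map_cat bprod_cat. Qed.

Lemma cev_cons u bs M : cev (u :: bs) M = bmx (blk u) M *m cev bs M.
Proof. by rewrite /cev /= bprod_cons. Qed.

Lemma cev_nil M : cev [::] M = 1%:M.
Proof. by rewrite /cev bprod_nil. Qed.

Lemma cev1 u M : cev [:: u] M = bmx (blk u) M.
Proof. by rewrite cev_cons cev_nil mulmx1. Qed.

Lemma polymx_cev bs : polymx (cev bs).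
Proof. exact: polymx_bprod. Qed.

Lemma polyf_fval b bs : polyf (fval b bs).
Proof. by apply: polyf_tr; apply: polymxM; [exact: polymx_cst|exact: polymx_cev]. Qed.

Lemma fval_true bs M : fval true bs M = trn (cev bs M).
Proof. by rewrite /fval /kmx mul_scalar_mx mxtraceZ mulrC. Qed.

Lemma mx11_tr (X : 'M[C]_1) : \tr X = X 0 0.
Proof. by rewrite /mxtrace big_ord1. Qed.

Lemma fval_false bs M : fval false bs M = vstate v (cev bs M).
Proof. by rewrite /fval /kmx -mulmxA mxtrace_mulC mx11_tr. Qed.

Lemma fval_nil b M : fval b [::] M = 1.
Proof.
case: b; last by rewrite fval_false cev_nil /vstate mulmx1.
by rewrite fval_true cev_nil /trn mxtrace1 divff // pnatr_eq0.
Qed.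

Lemma fval_rot p q M : fval true (p ++ q) M = fval true (q ++ p) M.
Proof. by rewrite !fval_true !cev_cat /trn mxtrace_mulC. Qed.

Lemma evalw_cat (m : letter k l -> M_) (u1 u2 : wd) :
  evalw m (u1 ++ u2) = evalw m u1 *m evalw m u2.
Proof. by rewrite /evalw big_cat. Qed.

Lemma blk_tr u M : unitary M -> \tr (bmx (blk u) M) = 0.
Proof.
have t0 : \tr (evalw (mxs A B) u - (twd u)%:M) = 0.
  by rewrite raddfB /= mxtrace_scalar -[twd u *+ _]mulr_natr /twd /trn divfK ?subrr // pnatr_eq0.
move=> hM; rewrite /blk; move: (_ - _) t0 => X t0; case: ifP => _ //=.
by rewrite /conjU mxtrace_mulC mulmxA unitaryC // mul1mx.
Qed.

Lemma pureX_cat (u1 u2 : wd) : pureX (u1 ++ u2) = pureX u1 && pureX u2.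
Proof. by rewrite /pureX all_cat. Qed.

Lemma pureY_cat (u1 u2 : wd) : pureY (u1 ++ u2) = pureY u1 && pureY u2.
Proof. by rewrite /pureY all_cat. Qed.

Lemma blockp_pureXN (u : wd) : blockp u -> pureX u = false -> pureY u.
Proof. by rewrite /blockp => /andP[_ /orP[->|]]. Qed.

Lemma block_notXY (u : wd) : blockp u -> pureY u = ~~ pureX u.
Proof. by rewrite /blockp /pureX /pureY; case: u => [//|[i|j] u] /=; rewrite ?orbF => ->. Qed.

Lemma blockp_cat (u1 u2 : wd) : blockp u1 -> blockp u2 -> pureX u1 = pureX u2 -> blockp (u1 ++ u2).
Proof.
move=> b1 b2 e; have y1 := block_notXY b1; have y2 := block_notXY b2.
rewrite /blockp pureX_cat pureY_cat y1 y2 e; move: b1 => /andP[+ _].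
by case: u1 {e y1} => //= x u1 _; case: (pureX u2).
Qed.

(** This is (a - s)(b - t) = (ab - r) - t (a - s) - s (b - t) + (r - st), with all centerings
    restored: a product of two blocks of one kind is a single block plus terms with fewer
    letters. *)
Lemma blk_mul (u1 u2 : wd) M : unitary M -> blockp u1 -> blockp u2 -> pureX u1 = pureX u2 ->
  bmx (blk u1) M *m bmx (blk u2) M = bmx (blk (u1 ++ u2)) M - twd u2 *: bmx (blk u1) M
    - twd u1 *: bmx (blk u2) M + (twd (u1 ++ u2) - twd u1 * twd u2)%:M.
Proof.
move=> hM b1 b2 e12; set t1 := twd u1; set t2 := twd u2; set t12 := twd (u1 ++ u2).
have base : (evalw (mxs A B) u1 - t1%:M) *m (evalw (mxs A B) u2 - t2%:M) =
   (evalw (mxs A B) (u1 ++ u2) - t12%:M) - t2 *: (evalw (mxs A B) u1 - t1%:M)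
   - t1 *: (evalw (mxs A B) u2 - t2%:M) + (t12 - t1 * t2)%:M.
  rewrite evalw_cat; move: (evalw _ u1) (evalw _ u2) => X Y.
  rewrite mulmxBl !mulmxBr !mul_scalar_mx mul_mx_scalar.
  apply/matrixP => i j; move: (X *m Y) => Z.
  rewrite !(mxE, mulr_natr, mulrBr, mulrnBl, mulrnAr, mulrnAl).
  by rewrite -/t1 -/t2; move: (Z i j) (X i j) (Y i j) => z x y; ring.
rewrite /blk pureX_cat e12 andbb; case: ifP => _ /=; first exact: base.
have expand X Y : conjU X M *m conjU Y M = conjU (X *m Y) M.
  by rewrite /conjU -(mulmxA _ (adj M)) (mulmxA (adj M)) (mulmxA (adj M)) unitaryC // mul1mx !mulmxA.
have cadd X Y : conjU (X + Y) M = conjU X M + conjU Y M.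
  by rewrite /conjU mulmxDr mulmxDl.
have copp X : conjU (- X) M = - conjU X M by rewrite /conjU mulmxN mulNmx.
have csc c X : conjU (c *: X) M = c *: conjU X M by rewrite /conjU -scalemxAr -scalemxAl.
have cone c : conjU c%:M M = c%:M.
  by rewrite -scalemx1 csc /conjU mulmx1 hM.
rewrite expand base; move: (_ - t12%:M) (_ - t1%:M) (_ - t2%:M) => Z X Y.
by rewrite !cadd !copp !csc cone.
Qed.

End Configurations.

Lemma tr_mul_combination (K : comNzRingType) m (Z X Y Q a1 a2 a3 : 'M[K]_m) (t1 t2 t3 : K) :
  Q = a3 - t2 *: a1 - t1 *: a2 + t3%:M ->
  \tr (Z *m (X *m (Q *m Y))) = \tr (Z *m (X *m (a3 *m Y))) + ((- t2) * \tr (Z *m (X *m (a1 *m Y)))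
    + ((- t1) * \tr (Z *m (X *m (a2 *m Y))) + t3 * \tr (Z *m (X *m Y)))).
Proof.
move=> ->; rewrite !mulmxDl !mulmxDr !mxtraceD !mulNmx !mulmxN -!scalemxAl -!scalemxAr.
by rewrite mul_scalar_mx -!scalemxAr -!scaleNr !mxtraceZ -!addrA.
Qed.

(** * Trace identities for merging two functionals *)

Section RankOne.
Variables (K : comNzRingType) (m : nat) (q : K) (u : 'cV[K]_m) (u' : 'rV[K]_m).
Implicit Types X Y : 'M[K]_m.

Lemma tr_rank1 X : \tr (u *m u' *m X) = (u' *m X *m u) 0 0.
Proof. by rewrite -mulmxA mxtrace_mulC /mxtrace big_ord1. Qed.

Lemma tr_rank1M X Y : \tr (u *m u' *m X *m (u *m u') *m Y) =
  \tr (u *m u' *m X) * \tr (u *m u' *m Y).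
Proof.
rewrite !tr_rank1 -!(mulmxA u) mxtrace_mulC.
have -> : u' *m X *m (u *m u') *m Y *m u = (u' *m X *m u) *m (u' *m Y *m u) by rewrite !mulmxA.
by rewrite /mxtrace big_ord1 mxE big_ord1.
Qed.

Lemma tr_merge_tt (c w2 w1 s : 'M[K]_m) :
  q * \tr (q%:M *m 1%:M *m (c *m w2 *m q%:M *m w1 - w2 *m q%:M *m w1 *m c) *m s) =
  q ^+ 2 * (\tr (q%:M *m (c *m (w2 *m (w1 *m s)))) - \tr (q%:M *m (w2 *m (w1 *m (c *m s))))).
Proof.
rewrite mulmx1 !mul_scalar_mx !mul_mx_scalar -!(scalemxAl, scalemxAr) -scalerBr.
rewrite -!(scalemxAl, scalemxAr) !mxtraceZ mulmxBl raddfB /= !mulmxA; ring.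
Qed.

Lemma tr_merge_tf (c w2 w1 s : 'M[K]_m) :
  q * \tr (q%:M *m 1%:M *m (c *m w2 *m (u *m u') *m w1 - w2 *m (u *m u') *m w1 *m c) *m s) =
  q ^+ 2 * (\tr (u *m u' *m (w1 *m (s *m (c *m w2)))) - \tr (u *m u' *m (w1 *m (c *m (s *m w2))))).
Proof.
rewrite mulmx1 mul_scalar_mx -scalemxAl mxtraceZ mulmxBl raddfB /= mulrA -expr2.
congr (_ * (_ - _)).
  by rewrite -!mulmxA mulmxA mxtrace_mulC !mulmxA.
by rewrite -!mulmxA mxtrace_mulC !mulmxA.
Qed.

Lemma tr_merge_ft (a c w2 w1 s : 'M[K]_m) :
  q * \tr (u *m u' *m a *m (c *m w2 *m q%:M *m w1 - w2 *m q%:M *m w1 *m c) *m s) =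
  q ^+ 2 * (\tr (u *m u' *m (a *m (c *m (w2 *m (w1 *m s)))))
    - \tr (u *m u' *m (a *m (w2 *m (w1 *m (c *m s)))))).
Proof.
rewrite !mul_mx_scalar -!(scalemxAl, scalemxAr) -scalerBr -!(scalemxAl, scalemxAr) mxtraceZ.
rewrite mulmxBr mulmxBl raddfB /= !mulmxA; ring.
Qed.

(** A rank-one matrix inside a trace cuts it in two, so merging two vector states yields two vector
    states again, and only one factor [q] is gained. *)
Lemma tr_merge_ff (a c w2 w1 s : 'M[K]_m) :
  q * \tr (u *m u' *m a *m (c *m w2 *m (u *m u') *m w1 - w2 *m (u *m u') *m w1 *m c) *m s) =
  q * (\tr (u *m u' *m (a *m (c *m w2))) * \tr (u *m u' *m (w1 *m s))
    - \tr (u *m u' *m (a *m w2)) * \tr (u *m u' *m (w1 *m (c *m s)))).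
Proof. by rewrite -!tr_rank1M mulmxBr mulmxBl raddfB /= !mulmxA. Qed.

End RankOne.

(** * The Schwinger-Dyson equation for centered moments *)

Section ConfigurationMoments.
Context {R : realType} {k l n : nat}.
Local Notation C := R[i].
Local Notation M_ := 'M[C]_n.+1.
Local Notation wd := (word k l).
Variables (A : 'I_k -> M_) (B : 'I_l -> M_) (v : 'cV[C]_n.+1).
Hypothesis unitv : unit_vec v.
Context {d : measure_display} {T : measurableType d} (P : probability T R).
Variable U : T -> M_.
Hypothesis haarU : haar_unitary P U.
Local Notation Ecf := (@Ecf R k l n A B v d T P U).
Local Notation cev := (cev A B).
Local Notation blk := (blk A B).
Local Notation twd := (twd A B).
Local Notation fval := (fval A B v).
Local Notation fcfg := (fcfg A B v).
Local Notation kmx := (kmx v).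
Local Notation E := (@haarE R n d T P U).
Implicit Types (c r : seq (bool * seq wd)) (bs : seq wd).

Lemma Ecf_perm c1 c2 : perm_eq c1 c2 -> Ecf c1 = Ecf c2.
Proof.
move=> h; apply: haarE_ext => M; rewrite /fprod !big_map.
by apply: perm_big.
Qed.

Lemma Ecf_ext b bs b' bs' r :
  (forall M, unitary M -> fval b bs M = fval b' bs' M) ->
  Ecf ((b, bs) :: r) = Ecf ((b', bs') :: r).
Proof.
move=> h; apply: (haarE_extU haarU) => M hM.
by rewrite !fprod_cons h.
Qed.

Lemma Ecf_nil b r : Ecf ((b, [::]) :: r) = Ecf r.
Proof.
by apply: haarE_ext => M; rewrite fprod_cons fval_nil // mul1r.
Qed.

Lemma Ecf_empty : Ecf [::] = 1.
Proof.
rewrite -[RHS](@haarE_cst R n d T P U _); apply: haarE_ext => M.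
by rewrite /fprod big_nil.
Qed.

Lemma Ecf_rot p q r : Ecf ((true, p ++ q) :: r) = Ecf ((true, q ++ p) :: r).
Proof. by apply: Ecf_ext => M _; exact: fval_rot. Qed.

Lemma Ecf_cons_eq b bs r (F : M_ -> C) :
  (forall M, unitary M -> fval b bs M = F M) ->
  Ecf ((b, bs) :: r) = E (fun M => F M * fprod (fcfg r) M).
Proof. by move=> h; apply: (haarE_extU haarU) => M hM; rewrite fprod_cons h. Qed.

Lemma polyf_fprodc r : polyf (fprod (fcfg r)).
Proof. exact: polyf_fprod. Qed.

Lemma Ecf_tr1 u r : Ecf ((true, [:: u]) :: r) = 0.
Proof.
rewrite (@Ecf_cons_eq _ _ _ (fun=> 0)) => [|M hM].
  by rewrite -[RHS](@haarE_cst R n d T P U _); apply: haarE_ext => M; rewrite mul0r.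
by rewrite fval_true cev1 /trn blk_tr // mul0r.
Qed.

Lemma Ecf_pureX u r : pureX u ->
  Ecf ((false, [:: u]) :: r) = (vstate v (evalw (mxs A B) u) - twd u) * Ecf r.
Proof.
move=> hu; rewrite -(haarEZ haarU _ (polyf_fprodc r)); apply: Ecf_cons_eq => M hM.
rewrite fval_false cev1 /blk hu /= /vstate mulmxBr mulmxBl mul_mx_scalar -scalemxAl.
have hv : (adj v *m v) 0 0 = 1 := unitv.
move: hv; move: (adj v *m _ *m v) (adj v *m v) => X Y hv.
by rewrite !mxE hv mulr1.
Qed.

Lemma Ecf_merge b p u1 u2 q r : blockp u1 -> blockp u2 -> pureX u1 = pureX u2 ->
  Ecf ((b, p ++ u1 :: u2 :: q) :: r) = Ecf ((b, p ++ (u1 ++ u2) :: q) :: r)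
    - twd u2 * Ecf ((b, p ++ u1 :: q) :: r) - twd u1 * Ecf ((b, p ++ u2 :: q) :: r)
    + (twd (u1 ++ u2) - twd u1 * twd u2) * Ecf ((b, p ++ q) :: r).
Proof.
move=> b1 b2 e12; set t1 := twd u1; set t2 := twd u2; set t3 := twd (u1 ++ u2) - _.
have pf bs : polyf (fprod (fcfg ((b, bs) :: r))) by exact: polyf_fprodc.
have pz (a : C) bs : polyf (fun M => a * fprod (fcfg ((b, bs) :: r)) M).
  by apply: polyfM; [exact: polyf_cst|exact: pf].
rewrite (@Ecf_cons_eq _ _ _ (fun M => fval b (p ++ (u1 ++ u2) :: q) M
   + ((- t2) * fval b (p ++ u1 :: q) M + ((- t1) * fval b (p ++ u2 :: q) M
   + t3 * fval b (p ++ q) M)))); last first.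
  move=> M hM; rewrite /fval !cev_cat !cev_cons.
  have := blk_mul A B hM b1 b2 e12; rewrite -/t1 -/t2 -/t3.
  move: (cev p M) (cev q M) (bmx (blk u1) M) (bmx (blk u2) M) (bmx (blk (u1 ++ u2)) M) (kmx b).
  move=> X Y a1 a2 a3 Z e; rewrite (mulmxA a1).
  exact: tr_mul_combination e.
transitivity (E (fun M => fprod (fcfg ((b, p ++ (u1 ++ u2) :: q) :: r)) M
   + ((- t2) * fprod (fcfg ((b, p ++ u1 :: q) :: r)) M
   + ((- t1) * fprod (fcfg ((b, p ++ u2 :: q) :: r)) M
   + t3 * fprod (fcfg ((b, p ++ q) :: r)) M)))).
  by apply: haarE_ext => M; rewrite !fprod_cons !mulrDl !mulrA.
rewrite (haarED haarU (pf _)); last by apply: polyfD => //; apply: polyfD.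
rewrite (haarED haarU (pz _ _)); last by apply: polyfD.
rewrite (haarED haarU (pz _ _) (pz _ _)) !(haarEZ haarU _ (pf _)) /Ecf.
by rewrite !mulNr !addrA.
Qed.

(** A merge involving a trace fuses two functionals into one and gains n^-2; two vector states are
    only recombined into two others, with gain n^-1. *)
Definition merge_moment (b : bool) (a0 s : seq wd) (b' : bool)
    (t : seq wd * wd * seq wd) r : C :=
  match b, b' with
  | true, true => n.+1%:R ^- 2 * (Ecf ((true, t.1.2 :: t.2 ++ t.1.1 ++ s) :: r)
                               - Ecf ((true, t.2 ++ t.1.1 ++ t.1.2 :: s) :: r))
  | true, false => n.+1%:R ^- 2 * (Ecf ((false, t.1.1 ++ s ++ t.1.2 :: t.2) :: r)
                               - Ecf ((false, t.1.1 ++ t.1.2 :: s ++ t.2) :: r))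
  | false, true => n.+1%:R ^- 2 * (Ecf ((false, a0 ++ t.1.2 :: t.2 ++ t.1.1 ++ s) :: r)
                               - Ecf ((false, a0 ++ t.2 ++ t.1.1 ++ t.1.2 :: s) :: r))
  | false, false => n.+1%:R ^- 1 *
      (Ecf ((false, a0 ++ t.1.2 :: t.2) :: (false, t.1.1 ++ s) :: r)
       - Ecf ((false, a0 ++ t.2) :: (false, t.1.1 ++ t.1.2 :: s) :: r))
  end.

Definition split_moment (b : bool) (a0 : seq wd) (t : seq wd * wd * seq wd) r : C :=
  Ecf ((true, t.1.1) :: (b, a0 ++ t.1.2 :: t.2) :: r)
  - Ecf ((true, rcons t.1.1 t.1.2) :: (b, a0 ++ t.2) :: r).

Lemma israndom_blk u : israndom (blk u) = ~~ pureX u.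
Proof. by rewrite /blk; case: (pureX u). Qed.

Lemma cev_const a0 M M' : all (@pureX k l) a0 -> cev a0 M = cev a0 M'.
Proof.
elim: a0 => [|u a0 IH] /=; first by rewrite !cev_nil.
by move=> /andP[hu /IH e]; rewrite !cev_cons e /blk hu.
Qed.

Local Notation n' := (n.+1%:R : C).

Lemma n'_neq0 : n' != 0.
Proof. by rewrite pnatr_eq0. Qed.

Definition lift_split (t : seq wd * wd * seq wd) :=
  (map blk t.1.1, blk t.1.2, map blk t.2).

Lemma split_termE (b : bool) a0 s t (M : M_) : all (@pureX k l) a0 -> (b -> a0 = [::]) ->
  n'^-1 * split_term (map blk s) (kmx b *m cev a0 1%:M) (lift_split t) M =
  fval true t.1.1 M * fval b (a0 ++ t.1.2 :: t.2) M
  - fval true (rcons t.1.1 t.1.2) M * fval b (a0 ++ t.2) M.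
Proof.
move=> ha hb; rewrite /split_term /lift_split /= !fval_true /trn /fval.
rewrite -cats1 !cev_cat cev1 cev_cons (cev_const 1%:M M ha) /cev.
move: (bprod _ M) (bprod _ M) (bprod _ M) (bmx _ M) (kmx b) => X Y W c Z.
rewrite !mulmxA; move: (\tr _) (\tr _) (\tr _) (\tr _) (n'^-1) => x1 x2 x3 x4 m; ring.
Qed.

Definition merge_value (b : bool) (a0 s : seq wd) (b' : bool)
    (t : seq wd * wd * seq wd) (M : M_) : C :=
  match b, b' with
  | true, true => n'^-1 ^+ 2 * (fval true (t.1.2 :: t.2 ++ t.1.1 ++ s) M
                               - fval true (t.2 ++ t.1.1 ++ t.1.2 :: s) M)
  | true, false => n'^-1 ^+ 2 * (fval false (t.1.1 ++ s ++ t.1.2 :: t.2) M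
                               - fval false (t.1.1 ++ t.1.2 :: s ++ t.2) M)
  | false, true => n'^-1 ^+ 2 * (fval false (a0 ++ t.1.2 :: t.2 ++ t.1.1 ++ s) M
                               - fval false (a0 ++ t.2 ++ t.1.1 ++ t.1.2 :: s) M)
  | false, false => n'^-1 *
      (fval false (a0 ++ t.1.2 :: t.2) M * fval false (t.1.1 ++ s) M
       - fval false (a0 ++ t.2) M * fval false (t.1.1 ++ t.1.2 :: s) M)
  end.

Lemma merge_termE (b : bool) a0 s (b' : bool) t (M : M_) : all (@pureX k l) a0 -> (b -> a0 = [::]) ->
  n'^-1 * merge_term (map blk s) (kmx b *m cev a0 1%:M) (kmx b') (lift_split t) M =
  merge_value b a0 s b' t M.
Proof.
move=> ha hb; rewrite /merge_value /merge_term /bterm /lift_split /= /fval.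
rewrite -!/(cev _ _) (cev_const 1%:M M ha).
case: b hb => [/(_ erefl) ->|_]; case: b'; rewrite ?cev_cat ?cev_cons ?cev_cat ?cev_cons ?cev_nil
  ?cev_cat ?cev_cons ?cev_cat ?cev_cons;
  move: (cev t.2 M) (cev t.1.1 M) (cev s M) (cev a0 M) (bmx _ M) => w2 w1 s' a c.
- exact: tr_merge_tt.
- exact: tr_merge_tf.
- exact: tr_merge_ft.
- exact: tr_merge_ff.
Qed.

Lemma merge_valueE (b : bool) a0 s b' t r :
  E (fun M => merge_value b a0 s b' t M * fprod (fcfg r) M) = merge_moment b a0 s b' t r.
Proof.
have pf r0 : polyf (fprod (fcfg r0)) by exact: polyf_fprodc.
have two x q1 q2 : E (fun M => x * (fprod (fcfg q1) M - fprod (fcfg q2) M)) =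
    x * (Ecf q1 - Ecf q2).
  have pd : polyf (fun M => fprod (fcfg q1) M - fprod (fcfg q2) M).
    apply: polyf_ext (polyfD (pf q1) (polyfM (polyf_cst (-1)) (pf q2))) => M.
    by rewrite mulN1r.
  by rewrite (haarEZ haarU _ pd) (haarEB haarU (pf _) (pf _)).
rewrite /merge_moment /merge_value; case: b; case: b'; rewrite ?exprVn -two;
  apply: haarE_ext => M; rewrite !fprod_cons; move: (fprod _ M) => f.
- by rewrite -mulrA mulrBl.
- by rewrite -mulrA mulrBl.
- by rewrite -mulrA mulrBl.
- by rewrite -mulrA mulrBl expr1 !mulrA.
Qed.

Lemma split_valueE b a0 t r :
  E (fun M => (fval true t.1.1 M * fval b (a0 ++ t.1.2 :: t.2) M
    - fval true (rcons t.1.1 t.1.2) M * fval b (a0 ++ t.2) M) * fprod (fcfg r) M)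
  = split_moment b a0 t r.
Proof.
rewrite /split_moment -(haarEB haarU (polyf_fprodc _) (polyf_fprodc _)).
by apply: haarE_ext => M; rewrite !fprod_cons mulrBl !mulrA.
Qed.

Lemma splits_fcfg r : splits (fcfg r) =
  [seq (fcfg u.1.1, (kmx u.1.2.1, map blk u.1.2.2), fcfg u.2) | u <- splits r].
Proof. by rewrite /fcfg splits_map. Qed.

(** The deterministic prefix [a0] is absorbed in the test matrix [Q], so the distinguished product
    starts with the random block [c1]. Splitting at [c1] itself produces the moment on the left, and
    the equation is solved for it. *)
Theorem Ecf_schwinger_dyson (b : bool) (a0 : seq wd) (c1 : wd) (s : seq wd) r : all (@pureX k l) a0 -> (b -> a0 = [::]) -> ~~ pureX c1 ->
  Ecf ((b, a0 ++ c1 :: s) :: r) =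
  - (\sum_(t <- splits s | ~~ pureX t.1.2) split_moment b a0 (c1 :: t.1.1, t.1.2, t.2) r)
  - \sum_(u <- splits r) \sum_(t <- splits u.1.2.2 | ~~ pureX t.1.2)
      merge_moment b a0 (c1 :: s) u.1.2.1 t (u.1.1 ++ u.2).
Proof.
move=> ha hb hc.
(* Since [a0] has no random block, evaluating it at the identity gives its value at every
   unitary. *)
have := schwinger_dyson haarU (map blk (c1 :: s)) (kmx b *m cev a0 1%:M) (fcfg r).
move/(congr1 (fun x => n'^-1 * x)); rewrite mulr0 mulrDr.
rewrite (splits_map blk) big_map big_distrr /=.
under eq_bigl => t do rewrite israndom_blk.
have -> : \sum_(t <- splits (c1 :: s) | ~~ pureX t.1.2)
    n'^-1 * E (fun M => split_term (map blk (c1 :: s)) (kmx b *m cev a0 1%:M) (lift_split t) M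
       * fprod (fcfg r) M) =
    \sum_(t <- splits (c1 :: s) | ~~ pureX t.1.2) split_moment b a0 t r.
  apply: eq_bigr => t _; rewrite -split_valueE -haarEZ //; last first.
    by apply: polyfM; [exact: polyf_split_term|exact: polyf_fprodc].
  by apply: haarE_ext => M; rewrite mulrA split_termE.
rewrite splits_fcfg big_map big_distrr /=.
have -> : \sum_(u <- splits r) n'^-1 * \sum_(t <- splits (map blk u.1.2.2) | israndom t.1.2)
      E (fun M => merge_term (map blk (c1 :: s)) (kmx b *m cev a0 1%:M) (kmx u.1.2.1) t M
        * fprod (fcfg u.1.1 ++ fcfg u.2) M) =
   \sum_(u <- splits r) \sum_(t <- splits u.1.2.2 | ~~ pureX t.1.2)
      merge_moment b a0 (c1 :: s) u.1.2.1 t (u.1.1 ++ u.2).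
  apply: eq_bigr => u _; rewrite (splits_map blk) big_map big_distrr /=.
  under eq_bigl => t do rewrite israndom_blk.
  apply: eq_bigr => t _; rewrite -merge_valueE -haarEZ //; last first.
    by apply: polyfM; [exact: polyf_merge_term|exact: polyf_fprod].
  by apply: haarE_ext => M; rewrite mulrA /fcfg map_cat -merge_termE.
(* In the split at [c1] one term has the empty trace, equal to 1, and the other has the trace of the
   single centered block [c1], equal to 0. *)
rewrite /= big_cons hc big_map /= {1}/split_moment /= Ecf_nil Ecf_tr1 subr0.
by move=> /eqP; rewrite -addrA addr_eq0 => /eqP ->; rewrite opprD.
Qed.

End ConfigurationMoments.

(** * Letter counts and expected orders of magnitude *)

Section BlockLists.
Context {k l : nat}.
Local Notation wd := (word k l).
Implicit Types (bs p q : seq wd) (c r : seq (bool * seq wd)).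

Definition wt bs := size (flatten bs).
Definition cwt c := (\sum_(x <- c) wt x.2)%N.
(** Expected order of an entry in powers of n^(-1/2): fluctuations of a trace have size 1/n, those
    of a vector state 1/sqrt n, and a deterministic vector state is of order 1. Reading it off the
    flattened word makes it insensitive to regrouping blocks. *)
Definition ex (x : bool * seq wd) : nat :=
  if x.1 then (if flatten x.2 == [::] then 0 else 2)%N else (~~ pureX (flatten x.2) : nat).
Definition cex c := (\sum_(x <- c) ex x)%N.
Definition valid c := all (fun x : bool * seq wd => alt x.2) c.

Lemma wt_cat p q : wt (p ++ q) = (wt p + wt q)%N.
Proof. by rewrite /wt flatten_cat size_cat. Qed.

Lemma wt_cons u q : wt (u :: q) = (size u + wt q)%N.
Proof. by rewrite /wt /= size_cat. Qed.

Lemma cwt_cons x c : cwt (x :: c) = (wt x.2 + cwt c)%N.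
Proof. by rewrite /cwt big_cons. Qed.

Lemma cwt_cat c r : cwt (c ++ r) = (cwt c + cwt r)%N.
Proof. by rewrite /cwt big_cat. Qed.

Lemma cex_cons x c : cex (x :: c) = (ex x + cex c)%N.
Proof. by rewrite /cex big_cons. Qed.

Lemma cex_cat c r : cex (c ++ r) = (cex c + cex r)%N.
Proof. by rewrite /cex big_cat. Qed.

Lemma blockp_size (u : wd) : blockp u -> (0 < size u)%N.
Proof. by case: u. Qed.

Lemma good_size bs : good bs -> (size bs <= wt bs)%N.
Proof.
elim: bs => //= u bs IH /andP[/blockp_size hu /IH h]; rewrite wt_cons.
by rewrite -add1n leq_add.
Qed.

Lemma good_cat p q : good (p ++ q) = good p && good q.
Proof. exact: all_cat. Qed.

Lemma good_cons u q : good (u :: q) = blockp u && good q.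
Proof. by []. Qed.

Lemma alt_good bs : alt bs -> good bs.
Proof. by case/andP. Qed.

Lemma alt_cat p q : alt (p ++ q) -> alt p /\ alt q.
Proof.
by rewrite /alt good_cat => /andP[/andP[-> ->] /cat_sorted2[-> ->]].
Qed.

Lemma alt_cons2 u w bs : alt (u :: w :: bs) = [&& blockp u, pureX u != pureX w & alt (w :: bs)].
Proof.
by rewrite /alt /=; case: (blockp u); case: (_ != _); rewrite ?andbF.
Qed.

Lemma alt1 (u : wd) : alt [:: u] = blockp u.
Proof. by rewrite /alt /= !andbT. Qed.

Lemma not_altP bs : good bs -> ~~ alt bs ->
  exists p u1 u2 q, bs = p ++ u1 :: u2 :: q /\ pureX u1 = pureX u2.
Proof.
elim: bs => [|u [|w bs] IH] //; first by rewrite alt1 /= andbT => ->.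
rewrite good_cons => /andP[hu hg]; rewrite alt_cons2 hu /= negb_and negbK => /orP[/eqP e|].
  by exists [::], u, w, bs.
by move=> /(IH hg)[p [u1 [u2 [q [-> e]]]]]; exists (u :: p), u1, u2, q.
Qed.

Lemma ex_true p u q : blockp u -> ex (true, p ++ u :: q) = 2%N.
Proof.
move=> /blockp_size hu; rewrite /ex /= -size_eq0 flatten_cat /= !size_cat.
by rewrite !addn_eq0 (eqn0Ngt (size u)) hu /= andbF.
Qed.

Lemma ex_false p u q : ~~ pureX u -> ex (false, p ++ u :: q) = 1%N.
Proof.
move=> /negbTE hu; rewrite /ex /= flatten_cat /= /pureX !all_cat -!/(pureX _).
by rewrite hu andbF.
Qed.

Lemma ex_flatten b p q : flatten p = flatten q -> ex (b, p) = ex (b, q).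
Proof. by rewrite /ex /= => ->. Qed.

Lemma valid_cat c r : valid (c ++ r) = valid c && valid r.
Proof. exact: all_cat. Qed.

Lemma valid_cons b bs r : valid ((b, bs) :: r) = alt bs && valid r.
Proof. by []. Qed.

End BlockLists.

Lemma split_weight_bounds a b c e D : (a + (b + (c + e)) <= D)%N ->
  [/\ (b <= D)%N, (c <= D)%N & (b + c <= D)%N].
Proof. by move=> h; split; lia. Qed.

Lemma split_weight_drops a b c e : (0 < b)%N -> (0 < c)%N ->
  [/\ (a + (b + e) < a + (b + (c + e)))%N, (a + (c + e) < a + (b + (c + e)))%N
    & (a + e < a + (b + (c + e)))%N].
Proof. by move=> h1 h2; split; lia. Qed.

Section SumBound.
Context {R : realType}.

Lemma nc_sum_bound (I : eqType) (s : seq I) (Q : pred I) (F : I -> R[i]) (b : R) : 0 <= b ->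
  (forall t, t \in s -> Q t -> nc (F t) <= b) ->
  nc (\sum_(t <- s | Q t) F t) <= (size s)%:R * b.
Proof.
move=> b0 h; elim: s h => [|t s IH] h; first by rewrite big_nil nc0 mul0r.
have hs : nc (\sum_(t0 <- s | Q t0) F t0) <= (size s)%:R * b.
  by apply: IH => t' ht'; apply: h; rewrite inE ht' orbT.
rewrite big_cons /= -natr1 mulrDl mul1r; case: ifP => Qt.
  rewrite addrC; apply: le_trans (ncD _ _) _; apply: lerD => //.
  by apply: h => //; rewrite mem_head.
by apply: le_trans hs _; rewrite lerDl.
Qed.

End SumBound.

(** * Reduction of arbitrary block lists to alternating ones *)

Section Step.
Context {R : realType} {k l n : nat}.
Local Notation C := R[i].
Local Notation M_ := 'M[C]_n.+1.
Local Notation wd := (word k l).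
Variables (A : 'I_k -> M_) (B : 'I_l -> M_) (v : 'cV[C]_n.+1).
Hypothesis unitv : unit_vec v.
Context {d : measure_display} {T : measurableType d} (P : probability T R).
Variable U : T -> M_.
Hypothesis haarU : haar_unitary P U.
Local Notation Ecf := (@Ecf R k l n A B v d T P U).
Local Notation twd := (twd A B).
Implicit Types (c r : seq (bool * seq wd)) (bs p q : seq wd).

Variables (D : nat) (Mb : R).
Hypothesis Mb1 : 1 <= Mb.
Hypothesis Mb_twd : forall u : wd, blockp u -> (size u <= D)%N -> nc (twd u) <= Mb.
Hypothesis Mb_vst : forall u : wd, pureX u -> (size u <= D)%N ->
  nc (vstate v (evalw (mxs A B) u)) <= Mb.

(** One merge creates three shorter lists with coefficients at most Mb, Mb and Mb + Mb^2, in total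
    at most 4 Mb^2. Each is bounded by bl + L^s bl <= 2 L^s bl, so L^s grows to at most (1 + 8 Mb^2)
    L^s. *)
Definition joinL : R := 1 + 8 * Mb ^+ 2.

Lemma joinL1 : 1 <= joinL.
Proof. by rewrite /joinL lerDl mulr_ge0 // sqr_ge0. Qed.

Lemma joinLn m : 1 <= joinL ^+ m.
Proof. exact: exprn_ege1 joinL1. Qed.

(* Merging adjacent blocks of the same kind expresses a product of blocks as the alternating
   product with the same letters, plus boundedly many shorter alternating products. *)
Lemma join_bound (f : seq wd -> C) (bt bl : R) (s : nat) bs :
  (forall p u1 u2 q, blockp u1 -> blockp u2 -> pureX u1 = pureX u2 ->
    f (p ++ u1 :: u2 :: q) = f (p ++ (u1 ++ u2) :: q) - twd u2 * f (p ++ u1 :: q)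
    - twd u1 * f (p ++ u2 :: q) + (twd (u1 ++ u2) - twd u1 * twd u2) * f (p ++ q)) ->
  0 <= bl -> good bs -> (wt bs <= D)%N -> (size bs <= s)%N ->
  (forall a, alt a -> flatten a = flatten bs -> nc (f a) <= bt) ->
  (forall a, alt a -> (wt a < wt bs)%N -> nc (f a) <= bl) ->
  nc (f bs) <= bt + joinL ^+ s * bl.
Proof.
move=> hf bl0; elim: s bt bs => [|s IH] bt bs gbs wbs sbs ht hl.
  case: bs gbs wbs sbs ht hl => // _ _ _ ht _; apply: le_trans (ht [::] _ _) _ => //.
  by rewrite lerDl expr0 mul1r.
have [abs|nabs] := boolP (alt bs).
  apply: le_trans (ht _ abs _) _ => //; rewrite lerDl mulr_ge0 //.
  exact: le_trans ler01 (joinLn _).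
have [p [u1 [u2 [q [ebs e12]]]]] := not_altP gbs nabs.
move: gbs; rewrite ebs good_cat !good_cons => /and4P[gp b1 b2 gq].
have s1 := blockp_size b1; have s2 := blockp_size b2.
have w0 : wt bs = (wt p + (size u1 + (size u2 + wt q)))%N by rewrite ebs wt_cat !wt_cons.
have [x1 x2 x3] := split_weight_drops (wt p) (wt q) s1 s2.
have z0 : (size p + (size q).+1 <= s)%N by move: sbs; rewrite ebs size_cat /= addnS ltnS.
have b12 := blockp_cat b1 b2 e12.
rewrite hf //.
(* For a list with fewer letters even the leading alternating term falls under the bound [bl]. *)
have lower a : good a -> (wt a < wt bs)%N -> (size a <= s)%N ->
    nc (f a) <= bl + joinL ^+ s * bl.
  move=> ga wa sa; apply: IH => //; first exact: leq_trans (ltnW wa) wbs.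
    by move=> a' aa' ea'; apply: hl => //; rewrite /wt ea'.
  by move=> a' aa' wa'; apply: hl => //; exact: leq_trans wa' (ltnW wa).
have top : nc (f (p ++ (u1 ++ u2) :: q)) <= bt + joinL ^+ s * bl.
  have wtop : wt (p ++ (u1 ++ u2) :: q) = wt bs.
    by rewrite w0 wt_cat wt_cons size_cat !addnA.
  apply: IH.
  - by rewrite good_cat good_cons gp b12 gq.
  - by rewrite wtop.
  - by rewrite size_cat.
  - by move=> a aa ea; apply: ht => //; rewrite ea ebs !flatten_cat /= -catA.
  - by move=> a aa wa; apply: hl => //; rewrite -wtop.
have l1 : nc (f (p ++ u1 :: q)) <= bl + joinL ^+ s * bl.
  apply: lower; rewrite ?good_cat ?good_cons ?gp ?b1 ?gq //.
    by rewrite wt_cat wt_cons w0.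
  by rewrite size_cat.
have l2 : nc (f (p ++ u2 :: q)) <= bl + joinL ^+ s * bl.
  apply: lower; rewrite ?good_cat ?good_cons ?gp ?b2 ?gq //.
    by rewrite wt_cat wt_cons w0.
  by rewrite size_cat.
have l3 : nc (f (p ++ q)) <= bl + joinL ^+ s * bl.
  apply: lower; rewrite ?good_cat ?gp ?gq //.
    by rewrite wt_cat w0.
  by rewrite size_cat; apply: leq_trans z0; rewrite addnS.
have [y1 y2 y3] : [/\ (size u1 <= D)%N, (size u2 <= D)%N & (size u1 + size u2 <= D)%N].
  by apply: (@split_weight_bounds (wt p) _ _ (wt q)); rewrite -w0.
have t1 : nc (twd u1) <= Mb by exact: Mb_twd.
have t2 : nc (twd u2) <= Mb by exact: Mb_twd.
have t12 : nc (twd (u1 ++ u2)) <= Mb by apply: Mb_twd => //; rewrite size_cat.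
set Lb := joinL ^+ s * bl in top l1 l2 l3 *.
have Lb0 : bl <= Lb by rewrite /Lb ler_peMl // joinLn.
have M0 : 0 <= Mb by apply: le_trans Mb1.
have t3 : nc (twd (u1 ++ u2) - twd u1 * twd u2) <= Mb + Mb * Mb.
  by apply: le_trans (ncB _ _) _; rewrite ncM lerD // ler_pM ?nc_ge0.
have n1 : nc (twd u2 * f (p ++ u1 :: q)) <= Mb * (bl + Lb) by rewrite ncM ler_pM ?nc_ge0.
have n2 : nc (twd u1 * f (p ++ u2 :: q)) <= Mb * (bl + Lb) by rewrite ncM ler_pM ?nc_ge0.
have n3 : nc ((twd (u1 ++ u2) - twd u1 * twd u2) * f (p ++ q)) <= (Mb + Mb * Mb) * (bl + Lb).
  by rewrite ncM ler_pM ?nc_ge0.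
apply: le_trans (ncD _ _) _.
apply: le_trans (lerD (le_trans (ncB _ _) (lerD (le_trans (ncB _ _) (lerD top n1)) n2)) n3) _.
rewrite exprS -mulrA -/Lb /joinL.
have LbM : (Mb + Mb + (Mb + Mb * Mb)) * (bl + Lb) <= (4 * Mb ^+ 2) * (Lb + Lb).
  have e0 : Mb <= Mb * Mb by rewrite ler_peMl.
  have e1 : Mb + Mb + (Mb + Mb * Mb) <= 4 * Mb ^+ 2 by rewrite expr2; lra.
  have e2 : 0 <= Mb + Mb + (Mb + Mb * Mb) by rewrite !addr_ge0 // mulr_ge0.
  by apply: ler_pM => //; lra.
lra.
Qed.

End Step.

Arguments Ecf : simpl never.
Arguments ComplexField.Normc.normc : simpl never.
Arguments merge_moment : simpl never.
Arguments split_moment : simpl never.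

(** * Estimating the terms of the Schwinger-Dyson equation *)

Section FrontBound.
Context {R : realType} {k l n : nat}.
Local Notation C := R[i].
Local Notation M_ := 'M[C]_n.+1.
Local Notation wd := (word k l).
Variables (A : 'I_k -> M_) (B : 'I_l -> M_) (v : 'cV[C]_n.+1).
Hypothesis unitv : unit_vec v.
Context {d : measure_display} {T : measurableType d} (P : probability T R).
Variable U : T -> M_.
Hypothesis haarU : haar_unitary P U.
Local Notation Ecf := (@Ecf R k l n A B v d T P U).
Local Notation twd := (twd A B).
Implicit Types (c r : seq (bool * seq wd)) (bs p q : seq wd).

Variables (D : nat) (Mb : R).
Hypothesis Mb1 : 1 <= Mb.
Hypothesis Mb_twd : forall u : wd, blockp u -> (size u <= D)%N -> nc (twd u) <= Mb.
Hypothesis Mb_vst : forall u : wd, pureX u -> (size u <= D)%N ->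
  nc (vstate v (evalw (mxs A B) u)) <= Mb.

Definition hpar (m : nat) : R := Num.sqrt (m.+1%:R^-1).
Local Notation h := (hpar n).

Lemma hpar_gt0 m : 0 < hpar m.
Proof. by rewrite sqrtr_gt0 invr_gt0 ltr0n. Qed.

Lemma hpar_le1 m : hpar m <= 1.
Proof. by rewrite -sqrtr1 ler_wsqrtr // invf_le1 ?ltr0n // ler1n. Qed.

Lemma hpar2 m : hpar m ^+ 2 = m.+1%:R^-1.
Proof. by rewrite sqr_sqrtr // invr_ge0 ler0n. Qed.

Lemma hparX a b : (a <= b)%N -> h ^+ b <= h ^+ a.
Proof. by move=> ab; apply: ler_wiXn2l => //; [exact: ltW (hpar_gt0 n)|exact: hpar_le1]. Qed.

Lemma hpar_ge0 a : 0 <= h ^+ a.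
Proof. by apply: exprn_ge0; exact: ltW (hpar_gt0 n). Qed.

Lemma nc_invn (j : nat) : nc ((n.+1%:R : C) ^- j) = h ^+ (2 * j).
Proof. by rewrite ncV ncX nc_nat exprM hpar2 exprVn. Qed.

Lemma Ecf_swap x y r : Ecf (x :: y :: r) = Ecf (y :: x :: r).
Proof. by apply: Ecf_perm; apply/permP => a; rewrite /= addnCA. Qed.

Variables (Bd K : R).
Hypotheses (Bd0 : 0 <= Bd) (K0 : 0 <= K).
Hypothesis HB : forall c, valid c -> (cwt c <= D)%N -> nc (Ecf c) <= Bd * h ^+ cex c.
Hypothesis HK : forall c, valid c -> (cwt c < D)%N -> nc (Ecf c) <= K * h ^+ cex c.

Definition joinC : R := joinL Mb ^+ D.
Local Notation CJ := joinC.

Lemma joinC1 : 1 <= CJ.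
Proof. exact: joinLn. Qed.

(** The alternating list with all the letters keeps the exponent of [(b, bs)]. The shorter ones may
    lose that exponent, but they are controlled by the constant [K] of the previous level. *)
Lemma join_moment b bs r (be : R) m : (m <= D)%N -> 0 <= be ->
  (forall c, valid c -> (cwt c <= m)%N -> nc (Ecf c) <= be * h ^+ cex c) ->
  good bs -> valid r -> (wt bs + cwt r <= m)%N ->
  nc (Ecf ((b, bs) :: r)) <= be * h ^+ (ex (b, bs) + cex r) + CJ * (K * h ^+ cex r).
Proof.
move=> mD be0 hbe gbs vr wm.
have wD : (wt bs <= D)%N by apply: leq_trans mD; apply: leq_trans wm; exact: leq_addr.
apply: (join_bound Mb1 Mb_twd (f := fun x => Ecf ((b, x) :: r)) (s := D)) => //.
- by move=> p u1 u2 q b1 b2 e12; exact: Ecf_merge.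
- by rewrite mulr_ge0 // hpar_ge0.
- exact: leq_trans (good_size gbs) wD.
- move=> a aa ea; rewrite -(ex_flatten b ea) -cex_cons; apply: hbe.
    by rewrite valid_cons aa.
  by rewrite cwt_cons /= /wt ea.
- move=> a aa wa; apply: le_trans (HK _ _) _.
  + by rewrite valid_cons aa.
  + by rewrite cwt_cons /=; apply: leq_trans mD; apply: leq_trans wm; rewrite ltn_add2r.
  + by rewrite ler_wpM2l // hparX // cex_cons leq_addl.
Qed.

(** Both lists are made alternating, one after the other. The exponent of the first is given up,
    since the merge of two vector states only requires that of the second. *)
Lemma join_moment2 bs1 bs2 r : good bs1 -> good bs2 -> valid r ->
  (wt bs1 + (wt bs2 + cwt r) <= D)%N ->
  nc (Ecf ((false, bs1) :: (false, bs2) :: r)) <=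
    Bd * h ^+ (ex (false, bs2) + cex r) + 3 * CJ ^+ 2 * (K * h ^+ cex r).
Proof.
move=> g1 g2 vr wD.
have Kh0 : 0 <= K * h ^+ cex r by rewrite mulr_ge0 // hpar_ge0.
have C0 : 0 <= CJ by apply: le_trans joinC1; exact: ler01.
have step : nc (Ecf ((false, bs1) :: (false, bs2) :: r)) <=
    (Bd * h ^+ (ex (false, bs2) + cex r) + CJ * (K * h ^+ cex r))
    + CJ * ((1 + CJ) * (K * h ^+ cex r)).
  apply: (join_bound Mb1 Mb_twd (f := fun x => Ecf ((false, x) :: (false, bs2) :: r)) (s := D)) => //.
  - by move=> p u1 u2 q b1 b2 e12; exact: Ecf_merge.
  - by rewrite mulr_ge0 // addr_ge0.
  - by apply: leq_trans wD; exact: leq_addr.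
  - by apply: leq_trans (good_size g1) _; apply: leq_trans wD; exact: leq_addr.
  - move=> a aa ea.
    rewrite Ecf_swap.
    apply: le_trans (join_moment (be := Bd) (m := D) _ _ _ _ g2 _ _) _ => //.
    + by rewrite valid_cons aa.
    + by rewrite cwt_cons /= addnCA /wt ea.
    + apply: lerD; first by rewrite ler_wpM2l // hparX // cex_cons leq_add2l leq_addl.
      by rewrite ler_wpM2l // ler_wpM2l // hparX // cex_cons leq_addl.
  - move=> a aa wa.
    rewrite Ecf_swap.
    have wl : (wt bs2 + cwt ((false, a) :: r) < D)%N.
      by rewrite cwt_cons /= addnCA; apply: leq_trans wD; rewrite ltn_add2r.
    apply: le_trans (join_moment (be := K) (m := (wt bs2 + cwt ((false, a) :: r))%N)
      _ _ _ _ g2 _ _) _ => //.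
    + exact: ltnW.
    + by move=> c vc wc; apply: HK => //; exact: leq_ltn_trans wc wl.
    + by rewrite valid_cons aa.
    + rewrite mulrDl mul1r; apply: lerD.
        by rewrite ler_wpM2l // hparX // cex_cons addnCA addnA leq_addl.
      by rewrite ler_wpM2l // ler_wpM2l // hparX // cex_cons leq_addl.
apply: le_trans step _; rewrite -addrA lerD2l; move: Kh0; move: (K * _) => y y0.
have := joinC1; move: CJ => x x1.
have e0 : x <= x * x by rewrite ler_peMl // (le_trans ler01).
have -> : x * y + x * ((1 + x) * y) = (x + x + x * x) * y by ring.
by apply: ler_wpM2r => //; rewrite expr2; lra.
Qed.

(** Common bound for a term on the right of the equation: moments with all the letters come with
    [Bd] and an additional h, shorter ones with [K] alone. *)
Definition termB (e : nat) : R := 3 * CJ ^+ 2 * (K + h * Bd) * h ^+ e.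

Lemma KhB0 : 0 <= K + h * Bd.
Proof. by rewrite addr_ge0 // mulr_ge0 // ltW // hpar_gt0. Qed.

Lemma CJ0 : 0 <= CJ.
Proof. exact: le_trans ler01 joinC1. Qed.

Lemma CJ3 : CJ <= 3 * CJ ^+ 2 /\ 1 <= 3 * CJ ^+ 2.
Proof.
have := joinC1; move: CJ => x x1.
have e0 : x <= x * x by rewrite ler_peMl // (le_trans ler01).
by rewrite expr2; split; lra.
Qed.

Lemma termB0 e : 0 <= termB e.
Proof. by rewrite /termB !mulr_ge0 ?hpar_ge0 ?KhB0 ?CJ0 // ler0n. Qed.

(** Here [j] is the power of h supplied by the prefactor. Terms with all the letters must beat the
    target exponent [e] by one; shorter terms need only reach it. *)
Lemma termB_gain (j a b e : nat) (x : C) (q : R) : q <= 3 * CJ ^+ 2 -> 0 <= q ->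
  (e.+1 <= j + a)%N -> (e <= j + b)%N ->
  nc x <= Bd * h ^+ a + q * (K * h ^+ b) -> h ^+ j * nc x <= termB e.
Proof.
move=> hq q0 ha hb hx.
apply: le_trans (_ : h ^+ j * (Bd * h ^+ a + q * (K * h ^+ b)) <= _).
  by rewrite ler_wpM2l // hpar_ge0.
have -> : h ^+ j * (Bd * h ^+ a + q * (K * h ^+ b)) = Bd * h ^+ (j + a) + q * K * h ^+ (j + b).
  by rewrite !exprD; ring.
apply: le_trans (_ : Bd * h ^+ e.+1 + q * K * h ^+ e <= _).
  by apply: lerD; apply: ler_wpM2l; rewrite ?mulr_ge0 // hparX.
rewrite /termB exprS mulrA -mulrDl ler_wpM2r ?hpar_ge0 // addrC mulrDr.
have hB0 : 0 <= h * Bd by rewrite mulr_ge0 // ltW // hpar_gt0.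
apply: lerD; first by rewrite ler_wpM2r.
by rewrite (mulrC Bd) ler_peMl //; case: CJ3.
Qed.

Lemma gain_pair (j e : nat) (x y : C) :
  h ^+ j * nc x <= termB e -> h ^+ j * nc y <= termB e ->
  h ^+ j * nc (x - y) <= 2 * termB e.
Proof.
move=> hx hy; apply: le_trans (_ : h ^+ j * (nc x + nc y) <= _).
  by rewrite ler_wpM2l ?hpar_ge0 // ncB.
by rewrite mulrDr mulr_natl mulr2n lerD.
Qed.

Lemma moment_gain c (j e : nat) : valid c -> (cwt c <= D)%N -> (e.+1 <= j + cex c)%N ->
  h ^+ j * nc (Ecf c) <= termB e.
Proof.
move=> vc wc he; apply: (@termB_gain j (cex c) e e _ 0) => //.
- by apply: le_trans (proj2 CJ3); exact: ler01.
- exact: leq_addl.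
- by rewrite mul0r addr0; exact: HB.
Qed.

Lemma join_gain b bs r (j e : nat) : good bs -> valid r -> (wt bs + cwt r <= D)%N ->
  (e.+1 <= j + (ex (b, bs) + cex r))%N -> (e <= j + cex r)%N ->
  h ^+ j * nc (Ecf ((b, bs) :: r)) <= termB e.
Proof.
move=> g vr w h1 h2; apply: (termB_gain (proj1 CJ3) CJ0 h1 h2).
exact: (join_moment b (leqnn D) Bd0 HB g vr w).
Qed.

Lemma join_gain2 bs1 bs2 r (j e : nat) : good bs1 -> good bs2 -> valid r ->
  (wt bs1 + (wt bs2 + cwt r) <= D)%N ->
  (e.+1 <= j + (ex (false, bs2) + cex r))%N -> (e <= j + cex r)%N ->
  h ^+ j * nc (Ecf ((false, bs1) :: (false, bs2) :: r)) <= termB e.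
Proof.
move=> g1 g2 vr w h1 h2; apply: (termB_gain (lexx _) _ h1 h2).
  by apply: le_trans (proj2 CJ3); exact: ler01.
exact: join_moment2.
Qed.

(** An alternating list of X blocks has at most one element, and that one may be followed by the Y
    block [c]. *)
Lemma alt_drop_middle (a0 w1 : seq wd) (c : wd) (w2 : seq wd) : all (@pureX k l) a0 -> ~~ pureX c ->
  alt (a0 ++ w1 ++ c :: w2) -> alt (a0 ++ c :: w2).
Proof.
move=> ha hc hal; case: a0 ha hal => [|x [|y a0]] /=.
- by move=> _ /alt_cat[].
- rewrite andbT => hx /(@alt_cat _ _ [:: x])[+ /alt_cat[_ h2]].
  by rewrite alt1 => hb; rewrite alt_cons2 hb h2 andbT hx (negbTE hc).
- by case/and3P => hx hy _; rewrite alt_cons2 hx hy andbF.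
Qed.

(** A split creates a nontrivial trace, of order h^2. If the original functional is a trace, what
    remains must be nontrivial as well; for a vector state, of order h, the new trace alone is
    enough. *)
Lemma front_split (b : bool) (a0 : seq wd) (c1 : wd) (s : seq wd) r t : alt (a0 ++ c1 :: s) -> all (@pureX k l) a0 ->
  (b -> a0 = [::]) -> ~~ pureX c1 -> (b -> pureX (last c1 s)) -> valid r ->
  (wt (a0 ++ c1 :: s) + cwt r <= D)%N -> t \in splits s -> ~~ pureX t.1.2 ->
  nc (split_moment A B v P U b a0 (c1 :: t.1.1, t.1.2, t.2) r)
    <= 2 * termB (ex (b, a0 ++ c1 :: s) + cex r).
Proof.
move=> hal ha hb hc hlast vr hw /splitsP; case: t => [[w1 c] w2] /= es hcY.
have hal' : alt (a0 ++ (c1 :: w1) ++ c :: w2) by move: hal; rewrite es.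
have [_ hal1] := alt_cat hal'; have [alw1 alcw2] := alt_cat hal1.
have alw1c : alt (c1 :: rcons w1 c).
  by move: hal1; rewrite -cat_rcons => /alt_cat[].
have alacw := alt_drop_middle ha hcY hal'.
have bc1 : blockp c1 by case/andP: (alt_good alw1).
have bc : blockp c by case/andP: (alt_good alcw2).
have [_ alw2] : alt [:: c] /\ alt w2 by apply: alt_cat.
have hw1 : (wt (c1 :: w1) + (wt (a0 ++ c :: w2) + cwt r) <= D)%N.
  by move: hw; rewrite es -cat_cons !wt_cat -!addnA (addnCA (wt a0)).
have hw2 : (wt (c1 :: rcons w1 c) + (wt (a0 ++ w2) + cwt r) <= D)%N.
  move: hw1; rewrite -cats1 -cat_cons !wt_cat !wt_cons /= addn0 -!addnA.
  by rewrite (addnCA (wt a0)).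
have e0 : ex (b, a0 ++ c1 :: s) = if b then 2%N else 1%N.
  by case: b {hb hlast}; [exact: ex_true|exact: ex_false].
have e1 bs : ex (true, c1 :: bs) = 2%N by exact: (@ex_true _ _ [::]).
have e2 : ex (b, a0 ++ c :: w2) = if b then 2%N else 1%N.
  by case: b {hb hlast e0}; [exact: ex_true|exact: ex_false].
rewrite /split_moment /= -[leLHS]mul1r -[X in X * _ <= _](expr0 h); apply: gain_pair.
  apply: moment_gain; first by rewrite !valid_cons alw1 alacw.
    by rewrite !cwt_cons.
  by rewrite !cex_cons e1 e2 e0 add0n addSn ltnS leq_addl.
case: b hb hlast e0 {e2} => hb hlast e0.
  have a00 := hb isT; rewrite a00 /= in hw2 *.
  (* The remainder is nonempty because the last block is an X block and [c] is not. *)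
  case: w2 es alw2 hw2 {hal' hal1 alcw2 alacw hw1} => [|x w2] es alw2 hw2.
    by move: (hlast isT); rewrite es last_cat /= (negbTE hcY).
  apply: moment_gain; first by rewrite !valid_cons alw1c alw2.
    by rewrite !cwt_cons.
  have bx : blockp x by case/andP: (alt_good alw2).
  by rewrite !cex_cons e1 (@ex_true _ _ [::]) //= (@ex_true _ _ [::]) //.
(* In [a0 ++ w2] two X blocks may become adjacent, so this list has to be merged before it can be
   estimated. *)
rewrite Ecf_swap; apply: join_gain.
- rewrite good_cat (alt_good alw2) andbT.
  by move: (alt_good hal); rewrite good_cat => /andP[].
- by rewrite valid_cons alw1c.
- by rewrite cwt_cons addnCA.
- by rewrite cex_cons e1 e0 add0n; apply: leq_trans (leq_addl _ _).
- by rewrite cex_cons e1 e0 add0n leq_add2r.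
Qed.

Lemma front_merge (b : bool) (a0 : seq wd) (c1 : wd) (s : seq wd) r
    (u : seq (bool * seq wd) * (bool * seq wd) * seq (bool * seq wd)) (t : seq wd * wd * seq wd) :
  alt (a0 ++ c1 :: s) -> (b -> a0 = [::]) -> ~~ pureX c1 -> valid r ->
  (wt (a0 ++ c1 :: s) + cwt r <= D)%N -> u \in splits r -> t \in splits u.1.2.2 ->
  ~~ pureX t.1.2 ->
  nc (merge_moment A B v P U b a0 (c1 :: s) u.1.2.1 t (u.1.1 ++ u.2))
    <= 2 * termB (ex (b, a0 ++ c1 :: s) + cex r).
Proof.
move=> hal hb hc1 vr hw /splitsP er /splitsP es hc.
case: u er es => [[r1 [b' s']] r2] /= er es.
case: t es hc => [[w1 c] w2] /= es hc.
move: hal; rewrite /alt good_cat => /andP[/andP[ga0 gs0] _].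
have [vr12 gs'] : valid (r1 ++ r2) /\ good s'.
  move: vr; rewrite er !valid_cat valid_cons => /and3P[v1 as' v2].
  by rewrite v1 v2; split=> //; exact: alt_good.
move: gs'; rewrite es good_cat good_cons => /and3P[gw1 bc gw2].
have bc1 : blockp c1 by case/andP: gs0.
have e0 : ex (b, a0 ++ c1 :: s) = if b then 2%N else 1%N.
  by case: b {hb}; [exact: ex_true|exact: ex_false].
have e1 : ex (b', s') = if b' then 2%N else 1%N.
  by rewrite es; case: b' {er}; [exact: ex_true|exact: ex_false].
have er12 : cex r = (ex (b', s') + cex (r1 ++ r2))%N.
  by rewrite er !cex_cat cex_cons addnCA.
have hw' : (wt a0 + wt (c1 :: s) + (wt w1 + (size c + wt w2) + cwt (r1 ++ r2)) <= D)%N.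
  move: hw; rewrite er wt_cat !cwt_cat cwt_cons /= es !wt_cat !wt_cons.
  by clear; lia.
move: er12 e0 hw'; rewrite e1 => -> ->; clear hw er e1 es vr s'.
move: (r1 ++ r2) vr12 => r12 vr12 hw.
have gs : blockp c1 /\ good s by case/andP: gs0.
(* When a trace takes part, the prefactor n^-2 is h^4, at least the orders of both original entries
   together; the random block [c] surviving in the fused list gives a strict gain. *)
have jA (b0 : bool) p q : good (p ++ c :: q) -> (wt (p ++ c :: q) + cwt r12 <= D)%N ->
    h ^+ 4 * nc (Ecf ((b0, p ++ c :: q) :: r12)) <= termB (if b0 then 4 + cex r12 else 3 + cex r12).
  move=> g w; apply: join_gain => //; case: b0.
  - by rewrite (ex_true _ _ bc) addnA ltn_add2r.
  - by rewrite (ex_false _ _ hc) addnA ltn_add2r.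
  - by [].
  - by rewrite leq_add2r.
have wt0 : wt ([::] : seq wd) = 0%N by [].
rewrite /merge_moment; case: b hb => hb; case: b' => /=; rewrite ncM nc_invn.
- rewrite (_ : (2 + (2 + cex r12) = 4 + cex r12)%N) //.
  apply: gain_pair; [apply: (jA true [::])|rewrite catA; apply: (jA true)];
    rewrite ?good_cat ?good_cons ?good_cat ?gw1 ?gw2 ?bc ?(proj1 gs) ?(proj2 gs) //;
    move: hw; rewrite ?wt_cat ?wt_cons ?wt_cat ?wt_cons ?wt0; clear; lia.
- rewrite (_ : (2 + (1 + cex r12) = 3 + cex r12)%N) //.
  apply: gain_pair; [rewrite -cat_cons catA; apply: (jA false)|apply: (jA false)];
    rewrite ?good_cat ?good_cons ?good_cat ?gw1 ?gw2 ?bc ?(proj1 gs) ?(proj2 gs) //;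
    move: hw; rewrite ?wt_cat ?wt_cons ?wt_cat ?wt_cons ?wt0; clear; lia.
- rewrite (_ : (1 + (2 + cex r12) = 3 + cex r12)%N) //.
  apply: gain_pair; [apply: (jA false)|rewrite !(catA a0) (catA _ w1); apply: (jA false)];
    rewrite ?good_cat ?good_cons ?good_cat ?ga0 ?gw1 ?gw2 ?bc ?(proj1 gs) ?(proj2 gs) //;
    move: hw; rewrite ?wt_cat ?wt_cons ?wt_cat ?wt_cons ?wt0; clear; lia.
(* Two vector states have order h^2 together, equal to the prefactor n^-1; the extra h comes from
   the random block [c1] or [c] in the second list. *)
- apply: gain_pair; apply: join_gain2 => //;
    rewrite ?good_cat ?good_cons ?ga0 ?gw1 ?gw2 ?bc ?(proj1 gs) ?(proj2 gs) //.
  + by move: hw; rewrite ?wt_cat ?wt_cons; clear; lia.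
  + by rewrite (ex_false _ _ hc1).
  + by move: hw; rewrite ?wt_cat ?wt_cons; clear; lia.
  + by rewrite (ex_false _ _ hc).
Qed.

Lemma splits_count (r : seq (bool * seq wd)) : valid r ->
  (\sum_(u <- splits r) size u.1.2.2 <= cwt r)%N.
Proof.
elim: r => [|x r IH]; first by rewrite big_nil.
rewrite /valid /= => /andP[ax /IH h]; rewrite big_cons big_map cwt_cons /=.
by apply: leq_add => //; apply: good_size; exact: alt_good.
Qed.

(** Splits are counted by the blocks of [s] and merges by the blocks of [r], so there are at most D
    terms, each a difference of two moments bounded by [termB]. *)
Lemma front_bound (b : bool) (a0 : seq wd) (c1 : wd) (s : seq wd) r :
  alt (a0 ++ c1 :: s) -> all (@pureX k l) a0 -> (b -> a0 = [::]) -> ~~ pureX c1 ->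
  (b -> pureX (last c1 s)) -> valid r -> (wt (a0 ++ c1 :: s) + cwt r <= D)%N ->
  nc (Ecf ((b, a0 ++ c1 :: s) :: r)) <= D%:R * (2 * termB (ex (b, a0 ++ c1 :: s) + cex r)).
Proof.
move=> hal ha hb hc hl vr hw; set tb := 2 * termB _.
have tb0 : 0 <= tb by rewrite mulr_ge0 // termB0.
rewrite (Ecf_schwinger_dyson A B unitv haarU s r ha hb hc) -opprD ncN.
apply: le_trans (ncD _ _) _.
have h1 : nc (\sum_(t <- splits s | ~~ pureX t.1.2)
    split_moment A B v P U b a0 (c1 :: t.1.1, t.1.2, t.2) r) <= (size s)%:R * tb.
  rewrite -(size_splits s); apply: nc_sum_bound => // t ts tX; exact: front_split.
have h2 : nc (\sum_(u <- splits r) \sum_(t <- splits u.1.2.2 | ~~ pureX t.1.2)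
    merge_moment A B v P U b a0 (c1 :: s) u.1.2.1 t (u.1.1 ++ u.2)) <= (cwt r)%:R * tb.
  apply: le_trans (nc_sum _ _ _) _.
  apply: le_trans (_ : \sum_(u <- splits r) (size u.1.2.2)%:R * tb <= _).
    rewrite big_seq [leRHS]big_seq; apply: ler_sum => u hu.
    rewrite -(size_splits u.1.2.2); apply: nc_sum_bound => // t ts tX; exact: front_merge.
  by rewrite -mulr_suml ler_wpM2r // -natr_sum ler_nat splits_count.
apply: le_trans (lerD h1 h2) _; rewrite -mulrDl ler_wpM2r // -natrD ler_nat.
apply: leq_trans hw; rewrite leq_add2r; apply: leq_trans (good_size (alt_good hal)).
by rewrite size_cat /= addnS -addSn leq_addl.
Qed.

End FrontBound.

(** * The self-improving inequality at a fixed number of letters *)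

Section MoreBlockLists.
Context {k l : nat}.
Local Notation wd := (word k l).

Lemma first_random (s : seq wd) : ~~ pureX (flatten s) ->
  exists a0 c1 s1, [/\ s = a0 ++ c1 :: s1, all (@pureX k l) a0 & ~~ pureX c1].
Proof.
elim: s => //= u s IH; rewrite pureX_cat negb_and.
have [hu /= /IH[a0 [c1 [s1 [-> h1 h2]]]]|hu _] := boolP (pureX u).
  by exists (u :: a0), c1, s1; rewrite /= hu.
by exists [::], u, s.
Qed.

Lemma alt_pureX (s : seq wd) : alt s -> pureX (flatten s) -> s != [::] -> exists2 u, s = [:: u] & pureX u.
Proof.
case: s => [|u [|w s]] // ha; rewrite /= ?cats0 => hp _; first by exists u.
move: ha hp; rewrite alt_cons2 !pureX_cat => /and3P[_ h _] /and3P[hu hw _].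
by rewrite hu hw in h.
Qed.

Lemma flatten_nil (s : seq wd) : good s -> (flatten s == [::]) = (s == [::]).
Proof. by case: s => // -[|x u] s. Qed.

Lemma cwt_perm (c1 c2 : seq (bool * seq wd)) : perm_eq c1 c2 -> cwt c1 = cwt c2.
Proof. by move=> h; apply: perm_big. Qed.

Lemma cex_perm (c1 c2 : seq (bool * seq wd)) : perm_eq c1 c2 -> cex c1 = cex c2.
Proof. by move=> h; apply: perm_big. Qed.

Lemma valid_perm (c1 c2 : seq (bool * seq wd)) : perm_eq c1 c2 -> valid c1 = valid c2.
Proof. exact: perm_all. Qed.

End MoreBlockLists.

Section StepBound.
Context {R : realType} {k l n : nat}.
Local Notation C := R[i].
Local Notation M_ := 'M[C]_n.+1.
Local Notation wd := (word k l).
Variables (A : 'I_k -> M_) (B : 'I_l -> M_) (v : 'cV[C]_n.+1).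
Hypothesis unitv : unit_vec v.
Context {d : measure_display} {T : measurableType d} (P : probability T R).
Variable U : T -> M_.
Hypothesis haarU : haar_unitary P U.
Local Notation Ecf := (@Ecf R k l n A B v d T P U).
Local Notation twd := (twd A B).
Local Notation h := (hpar n : R).
Implicit Types (c r : seq (bool * seq wd)) (bs p q : seq wd).

Variables (D : nat) (Mb : R).
Hypothesis Mb1 : 1 <= Mb.
Hypothesis Mb_twd : forall u : wd, blockp u -> (size u <= D)%N -> nc (twd u) <= Mb.
Hypothesis Mb_vst : forall u : wd, pureX u -> (size u <= D)%N ->
  nc (vstate v (evalw (mxs A B) u)) <= Mb.
Variables (Bd K : R).
Hypotheses (Bd0 : 0 <= Bd) (K1 : 1 <= K).
Hypothesis HB : forall c, valid c -> (cwt c <= D)%N -> nc (Ecf c) <= Bd * h ^+ cex c.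
Hypothesis HK : forall c, valid c -> (cwt c < D)%N -> nc (Ecf c) <= K * h ^+ cex c.

(** The first summand pays for the Schwinger-Dyson terms, the second for the shorter lists from one
    merge, the last for moments already covered at the previous level. *)
Definition stepC : R := D%:R * (2 * (3 * joinC D Mb ^+ 2)) + 4 * Mb ^+ 2 + 1.

Let K0 : 0 <= K. Proof. exact: le_trans ler01 K1. Qed.
Let M0 : 0 <= Mb. Proof. exact: le_trans ler01 Mb1. Qed.
Let KB0 : 0 <= K + h * Bd. Proof. exact: KhB0. Qed.
Let KKB : K <= K + h * Bd.
Proof. by rewrite lerDl mulr_ge0 // ltW // hpar_gt0. Qed.

Let F0 : 0 <= D%:R * (2 * (3 * joinC D Mb ^+ 2)) :> R.
Proof. by rewrite mulr_ge0 ?ler0n // mulr_ge0 // mulr_ge0 // sqr_ge0. Qed.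

Lemma stepC1 : 1 <= stepC.
Proof. by rewrite /stepC lerDr addr_ge0 // mulr_ge0 // sqr_ge0. Qed.

Lemma lower_step (x : C) (q : R) e : q <= 4 * Mb ^+ 2 + 1 -> 0 <= q ->
  nc x <= q * (K * h ^+ e) -> nc x <= stepC * (K + h * Bd) * h ^+ e.
Proof.
move=> hq q0 hx; apply: le_trans hx _; rewrite mulrA ler_wpM2r ?hpar_ge0 //.
apply: ler_pM => //; apply: le_trans hq _.
by rewrite /stepC -addrA lerDr.
Qed.

(** By cyclicity the list may be rotated so that it starts with a Y block and ends with an X block,
    as [front_bound] requires of a trace. *)
Lemma trace_diff (u : wd) (s : seq wd) r : alt (u :: s) -> pureX u != pureX (last u s) ->
  valid r -> (wt (u :: s) + cwt r <= D)%N ->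
  nc (Ecf ((true, u :: s) :: r)) <= D%:R * (2 * @termB R n D Mb Bd K (2 + cex r)).
Proof.
move=> ha hd vr hw; have [hu|hu] := boolP (pureX u); last first.
  have hs : pureX (last u s) by move: hd; rewrite (negbTE hu); case: (pureX _).
  have bu : blockp u by case/andP: (alt_good ha).
  have fb : nc (Ecf ((true, [::] ++ u :: s) :: r)) <=
      D%:R * (2 * @termB R n D Mb Bd K (ex (true, [::] ++ u :: s) + cex r)).
    by apply: (front_bound unitv haarU Mb1 Mb_twd Bd0 K0 HB HK).
  by rewrite (ex_true [::] s bu) in fb.
case: (lastP s) ha hd hw => [|m y]; first by rewrite /= eqxx.
rewrite last_rcons hu => ha hy hw.
have {}hy : ~~ pureX y by move: hy; case: (pureX y).
move: ha; rewrite /alt /= /good /= all_rcons rcons_path => /andP[/and3P[bu by_ gm] /andP[pm lm]].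
have hl : pureX (last u m) by move: lm; rewrite (negbTE hy); case: (pureX _).
have aym : alt (y :: u :: m).
  by rewrite alt_cons2 by_ hu (negbTE hy) /alt /good /= bu gm pm.
have -> : Ecf ((true, u :: rcons m y) :: r) = Ecf ((true, y :: u :: m) :: r).
  by rewrite -cats1; apply: (Ecf_rot _ _ _ haarU (u :: m) [:: y]).
have fb : nc (Ecf ((true, [::] ++ y :: u :: m) :: r)) <=
    D%:R * (2 * @termB R n D Mb Bd K (ex (true, [::] ++ y :: u :: m) + cex r)); last first.
  by rewrite (ex_true [::] (u :: m) by_) in fb.
apply: (front_bound unitv haarU Mb1 Mb_twd Bd0 K0 HB HK) => //.
suff e : wt ([::] ++ y :: u :: m) = wt (u :: rcons m y) by rewrite e.
by rewrite -cats1 !wt_cons wt_cat wt_cons addn0 addnCA (addnC (size y)).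
Qed.

(** If both end blocks have the same kind, the trace is zero for a single block. Otherwise the two
    ends are cyclically adjacent and are merged: the leading term has ends of different kinds, and
    the others are shorter. *)
Lemma trace_bound (s : seq wd) r : alt s -> s != [::] -> valid r -> (wt s + cwt r <= D)%N ->
  nc (Ecf ((true, s) :: r)) <= stepC * (K + h * Bd) * h ^+ (ex (true, s) + cex r).
Proof.
case: s => // u s ha _ vr hw.
have bu : blockp u by case/andP: (alt_good ha).
rewrite (@ex_true _ _ [::] u s) //.
have hF : D%:R * (2 * @termB R n D Mb Bd K (2 + cex r)) =
    D%:R * (2 * (3 * joinC D Mb ^+ 2)) * (K + h * Bd) * h ^+ (2 + cex r).
  by rewrite /termB !mulrA.
have [e|hd] := boolP (pureX u == pureX (last u s)); last first.
  apply: le_trans (trace_diff ha hd vr hw) _.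
  rewrite hF ler_wpM2r ?hpar_ge0 // ler_wpM2r // /stepC -addrA lerDl addr_ge0 //.
  by rewrite mulr_ge0 // sqr_ge0.
case: (lastP s) ha e hw => [|m y].
  move=> _ _ _; rewrite (Ecf_tr1 A B v haarU u r) nc0 mulr_ge0 ?hpar_ge0 // mulr_ge0 //.
  exact: le_trans ler01 stepC1.
rewrite last_rcons => ha /eqP e hw.
move: ha; rewrite /alt /= /good /= all_rcons rcons_path => /andP[/and3P[_ by_ gm] /andP[pm lm]].
case: m gm pm lm hw => [|x m] gm pm lm hw; first by rewrite /= e eqxx in lm.
move: gm pm => /andP[bx gm] /andP[ux pm].
have axm : alt (x :: m).
  by apply/andP; split; [apply/andP; split; [exact: bx|exact: gm]|exact: pm].
have bz := blockp_cat by_ bu (esym e).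
have pz : pureX (y ++ u) = pureX u by rewrite pureX_cat e andbb.
have auxm : alt (u :: x :: m) by rewrite alt_cons2 bu ux.
have ayxm : alt (y :: x :: m) by rewrite alt_cons2 by_ -e ux.
have azxm : alt ((y ++ u) :: x :: m) by rewrite alt_cons2 bz pz ux.
have hw' : (size u + (wt (x :: m) + size y) + cwt r <= D)%N.
  by move: hw; rewrite -cats1 wt_cons wt_cat (wt_cons y) addn0.
have [su sy] := (blockp_size bu, blockp_size by_).
have [w1 w2 w3 w4] : [/\ (size (y ++ u) + wt (x :: m) + cwt r <= D)%N,
    (size y + wt (x :: m) + cwt r < D)%N, (size u + wt (x :: m) + cwt r < D)%N &
    (wt (x :: m) + cwt r < D)%N].
  move: hw' su sy; rewrite size_cat; move: (size u) (size y) (wt _) (cwt r).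
  by clear; move=> a b c e; split; lia.
have [z1 z2 z3] : [/\ (size u <= D)%N, (size y <= D)%N & (size (y ++ u) <= D)%N].
  move: hw'; rewrite size_cat; move: (size u) (size y) (wt _) (cwt r).
  by clear; move=> a b c e; split; lia.
have -> : Ecf ((true, u :: rcons (x :: m) y) :: r) = Ecf ((true, [::] ++ y :: u :: x :: m) :: r).
  by rewrite -cats1; apply: (Ecf_rot _ _ _ haarU (u :: x :: m) [:: y]).
rewrite (Ecf_merge A B v haarU true [::] (x :: m) r by_ bu (esym e)).
have low s' : alt s' -> s' != [::] -> (wt s' + cwt r < D)%N ->
    nc (Ecf ((true, s') :: r)) <= K * h ^+ (2 + cex r).
  move=> a' n' w'; apply: le_trans (HK _ _) _; first by rewrite valid_cons a'.
    by rewrite cwt_cons.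
  by rewrite cex_cons /ex /= (flatten_nil (alt_good a')) (negbTE n').
have n1 := trace_diff azxm _ vr _.
rewrite wt_cons /= pz in n1; have {}n1 := n1 _ w1.
have {}n1 := n1 _.
have lxy : pureX u != pureX (last x m) by rewrite e eq_sym.
have {}n1 := n1 lxy; rewrite hF in n1.
have l1 := low _ ayxm isT; rewrite wt_cons in l1; have {}l1 := l1 w2.
have l2 := low _ auxm isT; rewrite wt_cons in l2; have {}l2 := l2 w3.
have l3 := low _ axm isT w4.
have t1 := Mb_twd bu z1; have t2 := Mb_twd by_ z2; have t3 := Mb_twd bz z3.
set y0 := K * h ^+ (2 + cex r) in l1 l2 l3.
have t4 : nc (twd (y ++ u) - twd y * twd u) <= Mb + Mb * Mb.
  by apply: le_trans (ncB _ _) _; rewrite ncM lerD // ler_pM ?nc_ge0.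
have m1 : nc (twd u * Ecf ((true, y :: x :: m) :: r)) <= Mb * y0 by rewrite ncM ler_pM ?nc_ge0.
have m2 : nc (twd y * Ecf ((true, u :: x :: m) :: r)) <= Mb * y0 by rewrite ncM ler_pM ?nc_ge0.
have m3 : nc ((twd (y ++ u) - twd y * twd u) * Ecf ((true, x :: m) :: r)) <= (Mb + Mb * Mb) * y0.
  by rewrite ncM ler_pM ?nc_ge0.
apply: le_trans (ncD _ _) _.
apply: le_trans (lerD (le_trans (ncB _ _) (lerD (le_trans (ncB _ _) (lerD n1 m1)) m2)) m3) _.
have e0 : Mb <= Mb * Mb by rewrite ler_peMl.
have y00 : 0 <= y0 by apply: mulr_ge0 => //; exact: hpar_ge0.
have e1 : (Mb + Mb + (Mb + Mb * Mb)) * y0 <= (4 * Mb ^+ 2 + 1) * ((K + h * Bd) * h ^+ (2 + cex r)).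
  apply: ler_pM => //.
  - by rewrite !addr_ge0 // mulr_ge0.
  - by rewrite expr2; lra.
  - by rewrite ler_wpM2r // hpar_ge0.
rewrite /stepC; move: e1; move: (D%:R * _) (h ^+ _) (K + _) y0 {n1 m1 m2 m3 l1 l2 l3 low y00 hF}.
move=> a b c y1; rewrite expr2; lra.
Qed.

(** A suitable entry is moved to the front: a nonempty trace if there is one, else a vector state
    with a random block, else a deterministic vector state. *)
Lemma step_bound c : valid c -> (cwt c <= D)%N ->
  nc (Ecf c) <= stepC * (K + h * Bd) * h ^+ cex c.
Proof.
move=> vc wc.
have four : 1 <= 4 * Mb ^+ 2 + 1 by rewrite lerDr mulr_ge0 // sqr_ge0.
have [lt|ge] := ltnP (cwt c) D.
  by apply: (lower_step four ler01); rewrite mul1r; exact: HK.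
have [/hasP[[b s] hs /andP[/= hb hn]]|hT] := boolP (has (fun x => x.1 && (x.2 != [::])) c).
  have hp := perm_to_rem hs; move: hs hp; rewrite hb => hs hp.
  rewrite (Ecf_perm _ _ _ _ _ hp) (cex_perm hp).
  move: vc wc; rewrite (valid_perm hp) (cwt_perm hp) valid_cons cwt_cons => /andP[as_ vr] wr.
  by rewrite cex_cons; exact: trace_bound.
have [/hasP[[b s] hs /= hn]|hV] := boolP (has (fun x => ~~ pureX (flatten x.2)) c).
  have hb : b = false.
    apply/negP => hb; move/hasP: hT; apply; exists (b, s) => //=; rewrite hb /=.
    by apply: contraNneq hn => ->.
  have hp := perm_to_rem hs; move: hs hp; rewrite hb => hs hp.
  rewrite (Ecf_perm _ _ _ _ _ hp) (cex_perm hp).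
  move: vc wc; rewrite (valid_perm hp) (cwt_perm hp) valid_cons cwt_cons => /andP[as_ vr] wr.
  have [a0 [c1 [s1 [es ha hc]]]] := first_random hn.
  rewrite cex_cons; move: as_ wr vr; rewrite es => as_ wr vr.
  have fb : nc (Ecf ((false, a0 ++ c1 :: s1) :: rem (false, a0 ++ c1 :: s1) c)) <=
      D%:R * (2 * @termB R n D Mb Bd K (ex (false, a0 ++ c1 :: s1)
        + cex (rem (false, a0 ++ c1 :: s1) c))).
    by apply: (front_bound unitv haarU Mb1 Mb_twd Bd0 K0 HB HK) => //; rewrite -es.
  apply: le_trans fb _.
  rewrite /termB !mulrA ler_wpM2r ?hpar_ge0 // ler_wpM2r // /stepC -!mulrA -addrA lerDl.
  by rewrite addr_ge0 // mulr_ge0 // sqr_ge0.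
(* Only deterministic vector states remain. Alternation leaves one X block, whose value is a scalar
   of modulus at most 2 Mb; factoring it out lowers the letter count. *)
have [/hasP[[b s] hs /= hn]|hE] := boolP (has (fun x => x.2 != [::]) c).
  have hb : b = false.
    apply/negP => hb; move/hasP: hT; apply; exists (b, s) => //=.
    by rewrite hb.
  have hX : pureX (flatten s).
    by apply/negPn/negP => hX; move/hasP: hV; apply; exists (b, s).
  have hp := perm_to_rem hs; move: hs hp; rewrite hb => hs hp.
  rewrite (Ecf_perm _ _ _ _ _ hp) (cex_perm hp).
  move: vc wc; rewrite (valid_perm hp) (cwt_perm hp) valid_cons cwt_cons => /andP[as_ vr] wr.
  have [u es hu] := alt_pureX as_ hX hn; rewrite es in as_ wr vr *.
  have bu : blockp u by rewrite -alt1.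
  have su := blockp_size bu; rewrite /= wt_cons addn0 in wr.
  rewrite (Ecf_pureX A B unitv haarU _ hu) cex_cons {1}/ex /= cats0 hu add0n.
  have suD : (size u <= D)%N by apply: leq_trans wr; exact: leq_addr.
  have lowr : nc (Ecf (rem (false, [:: u]) c)) <= K * h ^+ cex (rem (false, [:: u]) c).
    apply: HK => //; apply: leq_trans wr; rewrite -add1n leq_add2r //.
  apply: (lower_step (q := Mb + Mb)).
  - have e0 : Mb <= Mb * Mb by rewrite ler_peMl.
    by rewrite expr2; lra.
  - by rewrite addr_ge0.
  - rewrite ncM; apply: ler_pM; rewrite ?nc_ge0 //.
    by apply: le_trans (ncB _ _) _; rewrite lerD ?Mb_vst ?Mb_twd.
have [e1 e2] : Ecf c = 1 /\ cex c = 0%N.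
  elim: c hE {vc wc ge hT hV} => [|[b s] c IH] /=; first by rewrite Ecf_empty /cex big_nil.
  rewrite negb_or negbK => /andP[/eqP -> /IH[e1 e2]].
  by rewrite Ecf_nil // e1 cex_cons e2; split=> //; case: b.
rewrite e1 e2 expr0 mulr1 nc1 -[leLHS]mulr1; apply: ler_pM => //; first exact: stepC1.
exact: le_trans K1 KKB.
Qed.

End StepBound.

(** * A priori bounds and closing of the inequality *)

Lemma words_bound {R : realType} {k l : nat} (Q : word k l -> R -> Prop) (D : nat) :
  (forall u, exists K, Q u K) -> (forall u K K', K <= K' -> Q u K -> Q u K') ->
  exists2 K : R, 1 <= K & forall u, (size u <= D)%N -> Q u K.
Proof.
elim: D Q => [|D IH] Q hQ mQ.
  have [K hK] := hQ [::]; exists (1 + `|K|); first by rewrite lerDl.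
  by case=> // _; apply: mQ hK; rewrite ler_wpDl // ler_norm.
have [K0 hK0] := hQ [::].
have h x : exists K, 1 <= K /\ forall u, (size u <= D)%N -> Q (x :: u) K.
  have [|u K K' KK'|K K1 hK] := IH (fun u K => Q (x :: u) K); [by move=> u; apply: hQ|exact: mQ|].
  by exists K.
have [f hf] := choice h.
have f0 x : 0 <= f x by apply: le_trans (proj1 (hf x)); exact: ler01.
exists (1 + `|K0| + \sum_x f x); first by rewrite -addrA lerDl addr_ge0 // sumr_ge0.
case=> [_|x u /= su].
  by apply: mQ hK0; apply: le_trans (ler_norm _) _; rewrite -addrA addrCA lerDl addr_ge0 // sumr_ge0.
apply: mQ (proj2 (hf x) u su); rewrite (bigD1 x) //= addrCA lerDl.
by rewrite !addr_ge0 // sumr_ge0.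
Qed.

(** The supremum is finite by the bound [L] and satisfies sup <= c + sup / 2; the value of [L] does
    not survive in the conclusion. *)
Lemma contraction_bound {R : realType} (I : Type) (Q : I -> Prop) (f : I -> R) (c L : R) :
  (forall i, Q i -> 0 <= f i <= L) ->
  (forall b, 0 <= b -> (forall i, Q i -> f i <= b) -> forall i, Q i -> f i <= c + b / 2) ->
  forall i, Q i -> f i <= 2 * c.
Proof.
move=> hL hc i Qi; pose S := [set f j | j in [set j | Q j]].
have ub : has_sup S.
  split; first by exists (f i), i.
  by exists L => _ [j /= Qj <-]; case/andP: (hL j Qj).
have fS j : Q j -> f j <= sup S by move=> Qj; apply: sup_upper_bound => //; exists j.
have s0 : 0 <= sup S by apply: le_trans (fS i Qi); case/andP: (hL i Qi).
have sle : sup S <= c + sup S / 2.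
  by apply: ge_sup; [exists (f i), i|move=> _ [j /= Qj <-]; exact: hc].
by apply: le_trans (fS i Qi) _; lra.
Qed.

Section CrudeBound.
Context {R : realType} {k l n : nat}.
Local Notation C := R[i].
Local Notation M_ := 'M[C]_n.+1.
Local Notation wd := (word k l).
Variables (A : 'I_k -> M_) (B : 'I_l -> M_) (v : 'cV[C]_n.+1).
Hypothesis unitv : unit_vec v.
Context {d : measure_display} {T : measurableType d} (P : probability T R).
Variable U : T -> M_.
Hypothesis haarU : haar_unitary P U.
Local Notation Ecf := (@Ecf R k l n A B v d T P U).
Local Notation h := (hpar n : R).

(** The bound is exponential in the number of letters so that it multiplies along a configuration
    and empty entries cost nothing; there are infinitely many configurations with at most [D]
    letters. The constant depends on n. *)
Lemma cev_entry_bound D : exists2 L : R, 1 <= L &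
  forall bs M i j, unitary M -> good bs -> (wt bs <= D)%N -> nc (cev A B bs M i j) <= L ^+ wt bs.
Proof.
have hQ (u : wd) : exists K : R, forall M i j, unitary M -> nc (bmx (blk A B u) M i j) <= K.
  have h (ij : 'I_n.+1 * 'I_n.+1) :
      exists K : R, forall M, unitary M -> nc (bmx (blk A B u) M ij.1 ij.2) <= K.
    exact: polyf_bounded (polymx_bmx _ ij.1 ij.2).
  have [f hf] := choice h; exists (\sum_ij `|f ij|) => M i j hM.
  apply: le_trans (hf (i, j) M hM) _; rewrite (bigD1 (i, j)) //=.
  by apply: le_trans (ler_norm _) _; rewrite lerDl sumr_ge0.
have [||L0 L01 hL0] := @words_bound R k l (fun u K => forall M i j, unitary M ->
  nc (bmx (blk A B u) M i j) <= K) D; first exact: hQ.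
  by move=> u K K' KK' hK M i j hM; apply: le_trans (hK M i j hM) KK'.
have L00 : 0 <= L0 by apply: le_trans L01; exact: ler01.
have n1 : 1 <= n.+1%:R :> R by rewrite ler1n.
have L1 : 1 <= n.+1%:R * L0 by rewrite -[leLHS]mulr1 ler_pM.
exists (n.+1%:R * L0) => // bs M i j hM; elim: bs i j => [|u bs IH] i j.
  by move=> _ _; rewrite cev_nil expr0 mxE; case: eqP => _; rewrite ?nc1 ?nc0 // ler01.
rewrite good_cons => /andP[bu gbs]; rewrite wt_cons => hD.
have hu : (size u <= D)%N by apply: leq_trans hD; exact: leq_addr.
have hbs : (wt bs <= D)%N by apply: leq_trans hD; exact: leq_addl.
rewrite cev_cons mxE; apply: le_trans (nc_sum _ _ _) _.
apply: le_trans (_ : \sum_(a < n.+1) L0 * (n.+1%:R * L0) ^+ wt bs <= _).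
  by apply: ler_sum => a _; rewrite ncM ler_pM ?nc_ge0 ?IH ?hL0.
rewrite sumr_const card_ord -(mulr_natl (L0 * _)) mulrA exprD ler_wpM2r ?exprn_ge0 //.
  exact: le_trans ler01 L1.
by rewrite -[leLHS]expr1 ler_weXn2l // blockp_size.
Qed.

Lemma fval_bound D : exists2 L : R, 1 <= L &
  forall b bs M, unitary M -> good bs -> (wt bs <= D)%N -> nc (fval A B v b bs M) <= L ^+ wt bs.
Proof.
have [L L1 hL] := cev_entry_bound D.
pose z : R := 1 + \sum_(b : bool) \sum_(i < n.+1) \sum_(j < n.+1) nc (kmx v b i j).
have s0 b : 0 <= \sum_(i < n.+1) \sum_(j < n.+1) nc (kmx v b i j).
  by apply: sumr_ge0 => i _; apply: sumr_ge0 => j _; exact: nc_ge0.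
have z1 : 1 <= z by rewrite /z lerDl sumr_ge0.
have zb b : \sum_(i < n.+1) \sum_(j < n.+1) nc (kmx v b i j) <= z.
  rewrite /z (bigD1 b) //= addrCA lerDl addr_ge0 // sumr_ge0 //.
have zL : 1 <= z * L by rewrite -[leLHS]mulr1 ler_pM.
have L0 : 0 <= L by apply: le_trans L1; exact: ler01.
exists (z * L) => // b bs M hM gbs hD.
case: bs gbs hD => [|u bs] gbs hD.
  by rewrite fval_nil // nc1 /wt expr0.
have w1 : (0 < wt (u :: bs))%N.
  by rewrite wt_cons addn_gt0 blockp_size //; case/andP: gbs.
rewrite exprMn; apply: le_trans (_ : z * L ^+ wt (u :: bs) <= _); last first.
  by rewrite ler_wpM2r ?exprn_ge0 // -[leLHS]expr1 ler_weXn2l.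
apply: le_trans (_ : (\sum_(i < n.+1) \sum_(j < n.+1) nc (kmx v b i j)) * L ^+ wt (u :: bs) <= _); last first.
  by rewrite ler_wpM2r ?exprn_ge0.
rewrite /fval /mxtrace; apply: le_trans (nc_sum _ _ _) _; rewrite mulr_suml.
apply: ler_sum => i _; rewrite mxE; apply: le_trans (nc_sum _ _ _) _; rewrite mulr_suml.
by apply: ler_sum => j _; rewrite ncM ler_wpM2l ?nc_ge0 // hL.
Qed.

Lemma Ecf_crude D : exists L : R, forall c, valid c -> (cwt c <= D)%N -> nc (Ecf c) <= L.
Proof.
have [L L1 hL] := fval_bound D; exists (L ^+ D + L ^+ D) => c vc wc.
have L0 : 0 <= L by apply: le_trans L1; exact: ler01.
apply: (haarE_bound haarU) => [|M hM]; first exact: polyf_fprod.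
apply: le_trans (_ : L ^+ cwt c <= _); last by apply: ler_weXn2l.
elim: c vc wc => [|[b bs] c IH]; first by rewrite /fprod big_nil nc1 /cwt big_nil expr0.
rewrite valid_cons cwt_cons => /andP[ab vc] wc; rewrite fprod_cons ncM exprD.
apply: ler_pM; rewrite ?nc_ge0 //.
  by apply: hL => //; [exact: alt_good|apply: leq_trans wc; exact: leq_addr].
by apply: IH => //; apply: leq_trans wc; exact: leq_addl.
Qed.

(** The contraction argument is applied to the moments divided by their expected order; the
    smallness of h makes the coefficient of the unknown constant at most 1/2. *)
Lemma step_closed D (Mb K : R) : 1 <= Mb -> 1 <= K ->
  (forall u : wd, blockp u -> (size u <= D)%N -> nc (twd A B u) <= Mb) ->
  (forall u : wd, pureX u -> (size u <= D)%N -> nc (vstate v (evalw (mxs A B) u)) <= Mb) ->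
  (forall c, valid c -> (cwt c < D)%N -> nc (Ecf c) <= K * h ^+ cex c) ->
  stepC D Mb * h <= 2^-1 ->
  forall c, valid c -> (cwt c <= D)%N -> nc (Ecf c) <= 2 * (stepC D Mb * K) * h ^+ cex c.
Proof.
move=> Mb1 K1 ht hv HK hsmall c0 vc0 wc0.
have hp e : 0 < h ^+ e by rewrite exprn_gt0 // hpar_gt0.
have [L hL] := Ecf_crude D.
pose f c := nc (Ecf c) / h ^+ cex c.
have fE c : nc (Ecf c) = f c * h ^+ cex c by rewrite /f divfK // lt0r_neq0.
rewrite fE ler_wpM2r ?(ltW (hp _)) //.
pose Q (c : seq (bool * seq wd)) := valid c /\ (cwt c <= D)%N.
(* Bounds the exponent on configurations with at most D letters, so the rescaled moments remain
   bounded. *)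
have exD (c : seq (bool * seq wd)) : valid c -> (cex c <= 2 * cwt c)%N.
  elim: c => [|[b bs] c IH]; first by rewrite /cex big_nil.
  rewrite valid_cons => /andP[ab /IH h]; rewrite cex_cons cwt_cons mulnDr leq_add //.
  rewrite /ex /=; case: b; last first.
    by rewrite /wt; case: (flatten bs) => // x s; case: (pureX _).
  by rewrite -size_eq0 /wt; case: (size _) => // m; rewrite mulnS leq_addr.
apply: (@contraction_bound R _ Q f _ (L / h ^+ (2 * D)) _ _ c0); last by split.
  move=> c [vc wc].
  rewrite /f divr_ge0 ?nc_ge0 ?(ltW (hp _)) //=.
  apply: ler_pM; rewrite ?nc_ge0 ?invr_ge0 ?(ltW (hp _)) ?hL //.
  rewrite lef_pV2 ?posrE ?hp //.
  by apply: hparX; apply: leq_trans (exD c vc) _; rewrite leq_mul2l wc orbT.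
move=> b b0 hb c [vc wc].
have HB c' : valid c' -> (cwt c' <= D)%N -> nc (Ecf c') <= b * h ^+ cex c'.
  by move=> v' w'; rewrite fE ler_wpM2r ?(ltW (hp _)) //; apply: hb.
have := step_bound unitv haarU Mb1 ht hv b0 K1 HB HK vc wc.
rewrite /f ler_pdivrMr // => h1; apply: le_trans h1 _; rewrite ler_wpM2r ?(ltW (hp _)) //.
by rewrite mulrDr lerD2l mulrA [leRHS]mulrC ler_wpM2r.
Qed.

End CrudeBound.

(** * Uniform moment bounds as the size grows *)

Section Asymptotics.
Context {R : realType} {k l : nat}.
Local Notation C := R[i].
Local Notation wd := (word k l).
Variables (A : forall N : nat, 'I_k -> 'M[C]_N.+1) (B : forall N : nat, 'I_l -> 'M[C]_N.+1).
Variable v : forall N : nat, 'cV[C]_N.+1.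
Hypothesis unitv : forall N, unit_vec (v N).
Context {d : measure_display} {T : measurableType d} (P : probability T R).
Variable U : forall N : nat, T -> 'M[C]_N.+1.
Hypothesis haarU : forall N, haar_unitary P (U N).
Local Notation Ec_ N := (@Ecf R k l N (A N) (B N) (v N) d T P (U N)).

Hypothesis bound_twd : forall u : wd, blockp u ->
  exists K : R, forall N, nc (twd (A N) (B N) u) <= K.
Hypothesis bound_vst : forall u : wd, pureX u ->
  exists K : R, forall N, nc (vstate (v N) (evalw (mxs (A N) (B N)) u)) <= K.

Lemma hpar_cvg : (fun N => hpar N : R) @ \oo --> (0 : R).
Proof.
rewrite -[X in _ --> X]sqrtr0.
apply: (cvg_comp (fun N : nat => N.+1%:R^-1) Num.sqrt); first exact: cvg_harmonic.
exact: sqrt_continuous.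
Qed.

Lemma uniform_word_bound D : exists2 Mb : R, 1 <= Mb & forall u : wd, (size u <= D)%N ->
    (blockp u -> forall N, nc (twd (A N) (B N) u) <= Mb) /\
    (pureX u -> forall N, nc (vstate (v N) (evalw (mxs (A N) (B N)) u)) <= Mb).
Proof.
apply: (@words_bound R k l (fun u K => (blockp u -> forall N, nc (twd (A N) (B N) u) <= K) /\
  (pureX u -> forall N, nc (vstate (v N) (evalw (mxs (A N) (B N)) u)) <= K))).
  move=> u; have [K1 h1] : exists K, blockp u -> forall N, nc (twd (A N) (B N) u) <= K.
    by case: (boolP (blockp u)) => [/bound_twd[K hK]|_]; [exists K|exists 0].
  have [K2 h2] : exists K, pureX u -> forall N, nc (vstate (v N) (evalw (mxs (A N) (B N)) u)) <= K.
    by case: (boolP (pureX u)) => [/bound_vst[K hK]|_]; [exists K|exists 0].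
  exists (Num.max K1 K2); split=> hu N; rewrite le_max; first by rewrite h1.
  by rewrite h2 // orbT.
by move=> u K K' KK' [h1 h2]; split=> hu N; apply: le_trans KK'; [exact: h1|exact: h2].
Qed.

Lemma hpar_small (c : R) : exists N0, forall N, (N0 <= N)%N -> c * hpar N <= 2^-1.
Proof.
have h : (fun N => c * hpar N) @ \oo --> (0 : R).
  by rewrite -[X in _ --> X](mulr0 c); apply: cvgMr; exact: hpar_cvg.
have half : (0 : R) < 2^-1 by rewrite invr_gt0.
by move/cvgr_le : h => /(_ _ half)[N0 _ hN0]; exists N0 => N hN; apply: hN0.
Qed.

(** The constant [stepC D Mb] is independent of N, so the smallness condition on h holds from some
    rank on. *)
Lemma moment_step D (K : R) N0 : 1 <= K ->
  (forall N, (N0 <= N)%N -> forall c, valid c -> (cwt c < D)%N -> nc (Ec_ N c) <= K * hpar N ^+ cex c) ->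
  exists K' : R, exists N1 : nat, 1 <= K' /\
  forall N, (N1 <= N)%N -> forall c, valid c -> (cwt c <= D)%N -> nc (Ec_ N c) <= K' * hpar N ^+ cex c.
Proof.
move=> K1 hK; have [Mb Mb1 hMb] := uniform_word_bound D.
have [N1 hN1] := hpar_small (stepC D Mb).
exists (2 * (stepC D Mb * K)), (maxn N0 N1); split.
  have s1 := stepC1 D Mb.
  rewrite -[leLHS]mulr1; apply: ler_pM; rewrite ?ler1n //.
  by rewrite -[leLHS]mulr1; apply: ler_pM.
move=> N; rewrite geq_max => /andP[n0 n1].
apply: (step_closed (unitv N) (haarU N) Mb1 K1).
- by move=> u bu su; apply: (proj1 (hMb u su)).
- by move=> u bu su; apply: (proj2 (hMb u su)).
- exact: hK.
- exact: hN1.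
Qed.

Lemma moment_bounds D : exists K : R, exists N0 : nat, 1 <= K /\
  forall N, (N0 <= N)%N -> forall c, valid c -> (cwt c <= D)%N ->
    nc (Ec_ N c) <= K * hpar N ^+ cex c.
Proof.
elim: D => [|D [K [N0 [K1 hK]]]]; first by apply: (@moment_step 0 1 0).
by apply: (@moment_step D.+1 K N0).
Qed.

Lemma moment_cvg0 c : valid c -> (0 < cex c)%N -> cvgC (fun N => Ec_ N c) 0.
Proof.
move=> vc ec; have [K [N0 [K1 hK]]] := moment_bounds (cwt c).
apply: (@cvgC_squeeze_near _ _ _ (fun N => K * hpar N) N0) => [N hN|].
  rewrite subr0; apply: le_trans (hK N hN c vc (leqnn _)) _.
  rewrite ler_wpM2l ?(le_trans ler01) // -[leRHS]expr1; exact: hparX.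
by rewrite -[X in _ --> X](mulr0 K); apply: cvgMr; exact: hpar_cvg.
Qed.

End Asymptotics.

(** * Recovering all words from centered alternating products *)

Section CenteredFunctionals.
Context {R : realType} {k l : nat}.
Local Notation C := R[i].
Local Notation wd := (word k l).
Implicit Types (f g : wd -> C) (t : wd -> C) (bl : seq wd).

(* The value of the linear functional [f] at the product of the [u - t u], [u] in [bl]. *)
Fixpoint cent f t bl : C :=
  if bl is u :: bl' then cent (fun w => f (u ++ w) - t u * f w) t bl' else f [::].

Lemma alt_blocks (w : wd) : exists2 bl, alt bl & flatten bl = w.
Proof.
elim: w => [|x w [bl abl ebl]]; first by exists [::].
have b1 : blockp [:: x] by case: x.
have pX : pureX [:: x] = isX x by rewrite /pureX /= andbT.
case: bl abl ebl => [|u bl] abl ebl.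
  by exists [:: [:: x]]; rewrite ?alt1 // /= -ebl.
have bu : blockp u by case/andP: (alt_good abl).
have [e|ne] := boolP (pureX [:: x] == pureX u); last first.
  by exists ([:: x] :: u :: bl); rewrite ?alt_cons2 ?b1 ?ne ?abl //= -ebl.
exists (([:: x] ++ u) :: bl); last by rewrite /= -ebl.
have bxu := blockp_cat b1 bu (eqP e).
case: bl abl {ebl} => [|w' bl]; first by rewrite !alt1.
rewrite !alt_cons2 => /and3P[_ h1 h2].
by rewrite bxu h2 andbT pureX_cat (eqP e) andbb.
Qed.

Section Limits.
Variables (fN tN : nat -> wd -> C) (t : wd -> C).
Hypothesis t_cvg : forall u, blockp u -> cvgC (tN^~ u) (t u).

Lemma cent_cvg (F : nat -> wd -> C) (f : wd -> C) m bl : good bl -> (wt bl <= m)%N ->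
  (forall w : wd, (size w <= m)%N -> cvgC (F^~ w) (f w)) ->
  cvgC (fun N => cent (F N) (tN N) bl) (cent f t bl).
Proof.
elim: bl F f m => [|u bl IH] F f m; first by move=> _ _ h; apply: h.
rewrite good_cons wt_cons => /andP[bu gbl] hm h /=.
apply: (IH _ _ (wt bl)) => // w sw; apply: cvgCB.
  by apply: h; rewrite size_cat; apply: leq_trans hm; rewrite leq_add2l.
apply: cvgCM; first exact: t_cvg.
by apply: h; apply: leq_trans sw _; apply: leq_trans hm; exact: leq_addl.
Qed.

(** Expanding the centered product, the only term with all the letters is the word itself; the
    difference involves shorter words only, which drives the induction on length. *)
Lemma cent_top_cvg (F : nat -> wd -> C) (f : wd -> C) bl : good bl ->
  (forall w : wd, (size w < wt bl)%N -> cvgC (F^~ w) (f w)) ->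
  cvgC (fun N => cent (F N) (tN N) bl - F N (flatten bl)) (cent f t bl - f (flatten bl)).
Proof.
elim: bl F f => [|u bl IH] F f.
  by move=> _ _ /=; apply: cvgC_ext (cvgC_cst _) => N; rewrite !subrr.
rewrite good_cons wt_cons => /andP[bu gbl] h /=.
have h1 := IH (fun N w => F N (u ++ w) - tN N u * F N w) (fun w => f (u ++ w) - t u * f w) gbl.
have h2 : cvgC (fun N => tN N u * F N (flatten bl)) (t u * f (flatten bl)).
  apply: cvgCM; first exact: t_cvg.
  by apply: h; rewrite -/(wt bl) -add1n leq_add2r blockp_size.
have {}h1 := h1 _; have {h1 h2} := cvgCB (h1 _) h2.
set X := cent _ t bl; set Y := f (u ++ _); set Z := t u * _.
rewrite (_ : X - (Y - Z) - Z = X - Y); last by ring.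
move=> h3; apply: cvgC_ext (h3 _) => [N|w sw]; first by ring.
apply: cvgCB; first by apply: h; rewrite size_cat ltn_add2l.
apply: cvgCM; first exact: t_cvg.
by apply: h; apply: leq_trans sw _; exact: leq_addl.
Qed.

(** The version with a prescribed limit, used for each outcome so that the almost sure limit is the
    limit of the expectations. *)
Lemma functional_cvg (f : wd -> C) (g : seq wd -> C) :
  (forall bl, alt bl -> cvgC (fun N => cent (fN N) (tN N) bl) (g bl)) ->
  (forall bl, alt bl -> cent f t bl = g bl) ->
  forall w, cvgC (fN^~ w) (f w).
Proof.
move=> hN hf w; move: {2}(size w) (leqnn (size w)) => m; elim: m w => [|m IH] w sw.
  case: w sw => // _; rewrite -[f _]/(cent f t [::]) hf //; exact: (hN [::]).
have [bl abl ebl] := alt_blocks w.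
have hlt (w' : wd) : (size w' < wt bl)%N -> cvgC (fN^~ w') (f w').
  by move=> h; apply: IH; rewrite -ltnS; apply: leq_trans h _; rewrite /wt ebl.
have := cvgCB (hN bl abl) (cent_top_cvg (alt_good abl) hlt).
rewrite ebl hf // (_ : g bl - (g bl - f w) = f w); last by ring.
by apply: cvgC_ext => N; ring.
Qed.

Lemma functional_limit (g : seq wd -> C) :
  (forall bl, alt bl -> cvgC (fun N => cent (fN N) (tN N) bl) (g bl)) ->
  exists f, (forall w, cvgC (fN^~ w) (f w)) /\ forall bl, alt bl -> cent f t bl = g bl.
Proof.
move=> hN.
have ex_lim w : exists a, cvgC (fN^~ w) a.
  move: {2}(size w) (leqnn (size w)) => m; elim: m w => [|m IH] w sw.
    by case: w sw => // _; exists (g [::]); exact: (hN [::]).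
  have [f hf] : exists f : wd -> C, forall w', (size w' <= m)%N -> cvgC (fN^~ w') (f w').
    have : forall w' : wd, exists a, (size w' <= m)%N -> cvgC (fN^~ w') a.
      move=> w'; have [h|h] := boolP (size w' <= m)%N; last by exists 0.
      by have [a ha] := IH w' h; exists a.
    by move=> /choice[f hf]; exists f.
  have [bl abl ebl] := alt_blocks w.
  have hlt (w' : wd) : (size w' < wt bl)%N -> cvgC (fN^~ w') (f w').
    by move=> h; apply: hf; rewrite -ltnS; apply: leq_trans h _; rewrite /wt ebl.
  have := cvgCB (hN bl abl) (cent_top_cvg (alt_good abl) hlt).
  rewrite ebl; set a := (X in cvgC _ X) => h; exists a.
  by apply: cvgC_ext h => N; ring.
have [f hf] := choice ex_lim; exists f; split=> // bl abl.
apply: cvgC_unique (hN bl abl); apply: (@cent_cvg _ _ (wt bl)) => //.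
exact: alt_good.
Qed.

End Limits.

Lemma cent_zero t bl : cent (fun=> 0) t bl = 0.
Proof.
elim: bl => //= u bl IH; rewrite -[RHS]IH; congr cent.
by apply/funext => w; rewrite mulr0 subrr.
Qed.

(** The centering of the unit is zero, which takes care of the constant terms of polynomials. *)
Lemma cent_nil_block f t bl : t [::] = 1 -> [::] \in bl -> cent f t bl = 0.
Proof.
move=> t1; elim: bl f => // u bl IH f; rewrite inE => /orP[/eqP <-|h] /=; last exact: IH.
rewrite (_ : (fun w => _) = fun=> 0); first exact: cent_zero.
by apply/funext => w; rewrite t1 mul1r subrr.
Qed.

Lemma lin_ncmul f (p q : ncpoly R k l) :
  lin f (ncmul p q) = \sum_(a <- p) a.1 * lin (fun w => f (a.2 ++ w)) q.
Proof.
rewrite /lin /ncmul big_allpairs_dep /=; apply: eq_bigr => a _.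
by rewrite big_distrr; apply: eq_bigr => b _ /=; rewrite mulrA.
Qed.

(* Since each factor is centered for [t], each of its words [u] may be replaced by [u - t u]. *)
Lemma lin_ncprod_centered f t (s : seq (ncpoly R k l)) :
  all (fun p => lin t p == 0) s ->
  (forall us, all2 (fun u p => u \in map snd p) us s -> cent f t us = 0) ->
  lin f (ncprod s) = 0.
Proof.
elim: s f => [|p s IH] f /=.
  move=> _ h; have := h [::] isT; rewrite /lin /= big_cons big_nil /= addr0 mul1r.
  exact.
move=> /andP[/eqP hp hs] h; rewrite lin_ncmul.
have e : \sum_(a <- p) a.1 * lin (fun w => f (a.2 ++ w) - t a.2 * f w) (ncprod s) = 0.
  rewrite big_seq big1 // => a ap; rewrite IH ?mulr0 // => us hus.
  apply: (h (a.2 :: us)); rewrite /= hus andbT.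
  by apply/mapP; exists a.
rewrite -[RHS]e; apply/eqP; rewrite -subr_eq0 -sumrB; apply/eqP.
transitivity (\sum_(a <- p) (a.1 * t a.2) * lin f (ncprod s)).
  apply: eq_bigr => a _; rewrite -mulrBr -mulrA; congr (_ * _).
  rewrite /lin -sumrB big_distrr; apply: eq_bigr => b _ /=; ring.
by rewrite -mulr_suml -/(lin t p) hp mul0r.
Qed.

End CenteredFunctionals.

(** * Almost sure convergence from summable moments *)

Lemma sum_invsqr_le {R : realType} n : \sum_(0 <= i < n) (i.+1%:R ^- 2 : R) <= 2.
Proof.
suff h : \sum_(0 <= i < n.+1) (i.+1%:R ^- 2 : R) <= 2 - n.+1%:R^-1.
  apply: (@le_trans _ _ (\sum_(0 <= i < n.+1) (i.+1%:R ^- 2 : R))).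
    by rewrite big_nat_recr //= lerDl invr_ge0 exprn_ge0.
  by apply: le_trans h _; rewrite lerBlDr lerDl invr_ge0.
elim: n => [|n IH].
  by rewrite big_nat1 invr1 expr1n invr1; lra.
rewrite big_nat_recr //=; apply: le_trans (lerD IH (lexx _)) _.
have p1 : 0 < n.+1%:R :> R by rewrite ltr0n.
have -> : (n.+2%:R : R) = n.+1%:R + 1 by rewrite natr1.
move: (n.+1%:R) p1 => x x0.
have e : x^-1 - (x + 1)^-1 - (x + 1) ^- 2 = (x * (x + 1) ^+ 2)^-1.
  by field; apply/andP; split; apply: lt0r_neq0 => //; lra.
have : 0 <= x^-1 - (x + 1)^-1 - (x + 1) ^- 2.
  by rewrite e invr_ge0 mulr_ge0 ?ltW // exprn_gt0 //; lra.
lra.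
Qed.

Section AlmostSure.
Context {R : realType} {d : measure_display} {T : measurableType d}.
Variable P : probability T R.

(** The sum of the shifted sequence has finite integral by monotone convergence, so it is finite
    almost everywhere and its terms tend to 0. *)
Lemma ae_cvg0 (X : nat -> T -> R) (K : R) N0 : 0 <= K ->
  (forall N, measurable_fun setT (X N)) -> (forall N w, 0 <= X N w) ->
  (forall N, (N0 <= N)%N -> (\int[P]_w (X N w)%:E <= (K * N.+1%:R ^- 2)%:E)%E) ->
  {ae P, forall w, X^~ w @ \oo --> (0 : R)}.
Proof.
move=> K0 mX X0 hX; pose f N w := (X (N + N0)%N w)%:E.
have f0 N w : (0 <= f N w)%E by rewrite lee_fin.
have mf N : measurable_fun setT (f N) by apply/measurable_EFinP; exact: mX.
pose S w := (\sum_(0 <= N <oo) f N w)%E.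
have S0 w : (0 <= S w)%E by apply: nneseries_ge0.
have mS : measurable_fun setT S by apply: ge0_emeasurable_sum.
have intS : (\int[P]_w S w < +oo)%E.
  rewrite integral_nneseries //.
  apply: (@le_lt_trans _ _ (K * 2)%:E); last exact: ltry.
  apply: lime_le; first by apply: is_cvg_nneseries => N _ _; exact: integral_ge0.
  apply: nearW => n.
  apply: (@le_trans _ _ (\sum_(0 <= i < n) (K * i.+1%:R ^- 2)%:E)%E).
    apply: lee_sum => i _; apply: le_trans (hX _ (leq_addl _ _)) _.
    rewrite lee_fin ler_wpM2l // lef_pV2 ?posrE ?exprn_gt0 //.
    by rewrite lerXn2r ?nnegrE // ler_nat ltnS leq_addr.
  by rewrite sumEFin lee_fin -mulr_sumr ler_wpM2l // sum_invsqr_le.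
have iS : P.-integrable setT S.
  apply/integrableP; split=> //; apply: le_lt_trans intS.
  by under eq_integral => w _ do rewrite gee0_abs //.
have := integrable_ae measurableT iS; apply: filterS => w /(_ I) fS.
rewrite -(cvg_shiftn N0); apply: cvg_series_cvg_0.
apply: nondecreasing_is_cvgn.
  by apply/nondecreasing_seqP => n; rewrite /series /= big_nat_recr //= lerDl.
exists (fine (S w)) => _ [n _ <-]; rewrite -lee_fin fineK // /series /= -sumEFin.
by apply: nneseries_lim_ge => N _ _; exact: f0.
Qed.

End AlmostSure.

Section Adjoints.
Context {R : realType} {k l n : nat}.
Local Notation C := R[i].
Local Notation M_ := 'M[C]_n.+1.
Local Notation wd := (word k l).
Variables (A : 'I_k -> M_) (B : 'I_l -> M_) (v : 'cV[C]_n.+1).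
Hypotheses (sA : forall i, selfadj (A i)) (sB : forall j, selfadj (B j)).

Lemma adj_evalw u : adj (evalw (mxs A B) u) = evalw (mxs A B) (rev u).
Proof.
elim: u => [|x u IH]; first by rewrite /evalw !big_nil; exact: adj1.
rewrite /evalw rev_cons -cats1 big_cat big_seq1 big_cons adjM -!/(evalw _ _) IH.
by case: x => i /=; rewrite ?sA ?sB.
Qed.

Lemma tr_adj m (X : 'M[C]_m) : \tr (adj X) = conjc (\tr X).
Proof. by rewrite /mxtrace rmorph_sum; apply: eq_bigr => i _; rewrite adjE. Qed.

Lemma conjc_natV m : conjc ((m%:R : C)^-1) = m%:R^-1.
Proof. by rewrite fmorphV rmorph_nat. Qed.

Lemma twd_rev (u : wd) : twd A B (rev u) = conjc (twd A B u).
Proof. by rewrite /twd /trn -adj_evalw tr_adj rmorphM /= conjc_natV. Qed.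

Lemma adj_scalar m (a : C) : adj (a%:M : 'M[C]_m) = (conjc a)%:M.
Proof. by rewrite -scalemx1 adjZ adj1 scalemx1. Qed.

Lemma adjB m p (X Y : 'M[C]_(m, p)) : adj (X - Y) = adj X - adj Y.
Proof. by rewrite adjD -scaleN1r adjZ rmorphN1 scaleN1r. Qed.

Lemma blk_rev (u : wd) M : bmx (blk A B (rev u)) M = adj (bmx (blk A B u) M).
Proof.
have e : evalw (mxs A B) (rev u) - (twd A B (rev u))%:M = adj (evalw (mxs A B) u - (twd A B u)%:M).
  by rewrite adjB adj_scalar adj_evalw twd_rev.
rewrite /blk e /pureX all_rev; case: ifP => _ //=.
by rewrite /conjU !adjM adjK mulmxA.
Qed.

Definition rev_blocks (bl : seq wd) : seq wd := rev (map rev bl).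

Lemma cev_rev bl M : cev A B (rev_blocks bl) M = adj (cev A B bl M).
Proof.
elim: bl => [|u bl IH]; first by rewrite !cev_nil adj1.
by rewrite /rev_blocks /= rev_cons -cats1 cev_cat cev1 cev_cons adjM blk_rev IH.
Qed.

(** Reversing a word is taking adjoints when the matrices are self-adjoint. Thus absolute moments
    are again moments of configurations, to which the general bounds apply. *)
Lemma fval_rev b bl M : fval A B v b (rev_blocks bl) M = conjc (fval A B v b bl M).
Proof.
have kk : adj (kmx v b) = kmx v b.
  by case: b; rewrite /kmx; [rewrite adj_scalar conjc_natV|exact: adj_rank1].
by rewrite /fval cev_rev -tr_adj adjM kk mxtrace_mulC.
Qed.

Lemma alt_rev (bl : seq wd) : alt (rev_blocks bl) = alt bl.
Proof.
have br (u : wd) : blockp (rev u) = blockp u.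
  by rewrite /blockp /pureX /pureY !all_rev -!size_eq0 size_rev.
rewrite /alt /good /rev_blocks all_rev all_map rev_sorted sorted_map; congr (_ && _).
  exact: eq_all.
apply: eq_sorted => x y; rewrite /= /pureX !all_rev eq_sym //.
Qed.

Lemma wt_rev (bl : seq wd) : wt (rev_blocks bl) = wt bl.
Proof.
elim: bl => //= u bl IH.
by rewrite /rev_blocks /= rev_cons -cats1 wt_cat !wt_cons size_rev addn0 addnC -IH.
Qed.

Lemma pureX_rev (bl : seq wd) : pureX (flatten (rev_blocks bl)) = pureX (flatten bl).
Proof.
elim: bl => //= u bl IH.
rewrite /rev_blocks /= rev_cons -cats1 flatten_cat /= cats0 !pureX_cat.
by rewrite -/(rev_blocks bl) IH andbC /pureX all_rev.
Qed.

End Adjoints.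

Section AlmostSureMoments.
Context {R : realType} {k l : nat}.
Local Notation C := R[i].
Local Notation wd := (word k l).
Variables (A : forall N : nat, 'I_k -> 'M[C]_N.+1) (B : forall N : nat, 'I_l -> 'M[C]_N.+1).
Variable v : forall N : nat, 'cV[C]_N.+1.
Hypothesis unitv : forall N, unit_vec (v N).
Context {d : measure_display} {T : measurableType d} (P : probability T R).
Variable U : forall N : nat, T -> 'M[C]_N.+1.
Hypothesis haarU : forall N, haar_unitary P (U N).
Hypothesis bound_twd : forall u : wd, blockp u ->
  exists K : R, forall N, nc (twd (A N) (B N) u) <= K.
Hypothesis bound_vst : forall u : wd, pureX u ->
  exists K : R, forall N, nc (vstate (v N) (evalw (mxs (A N) (B N)) u)) <= K.
Hypotheses (sA : forall N i, selfadj (A N i)) (sB : forall N j, selfadj (B N j)).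

Lemma cvg_root (u : nat -> R) (p : nat) : (0 < p)%N -> (forall N, 0 <= u N) ->
  (fun N => u N ^+ p) @ \oo --> (0 : R) -> u @ \oo --> (0 : R).
Proof.
move=> p0 u0 /cvgrPdist_lt h; apply/cvgrPdist_lt => e e0.
have [N0 _ hN0] := h (e ^+ p) (exprn_gt0 p e0); exists N0 => // N hN.
have := hN0 N hN; rewrite /= !sub0r !normrN !ger0_norm ?exprn_ge0 //.
by rewrite ltr_pXn2r ?nnegrE ?u0 ?(ltW e0).
Qed.

(* The trace fluctuates at scale [1/n] and the vector state at scale [1/sqrt n], so a second,
   respectively a fourth moment is summable. *)
Lemma ae_fval (b : bool) (bl : seq wd) : alt bl -> (if b then bl != [::] else ~~ pureX (flatten bl)) ->
  {ae P, forall w, cvgC (fun N => fval (A N) (B N) (v N) b bl (U N w)) 0}.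
Proof.
move=> abl hb; pose m := if b then 1%N else 2%N.
have m0 : (0 < 2 * m)%N by rewrite /m; case: b {hb m}.
(* This configuration represents the absolute moment of order 2m. Its exponent is 4 in both cases,
   two traces or four vector states, so its expectation is O(N^-2). *)
pose c := nseq m (b, bl) ++ nseq m (b, rev_blocks bl).
have vc : valid c by rewrite /c valid_cat /valid !all_nseq /= alt_rev abl !orbT.
have ec : cex c = 4%N.
  have e x j : cex (nseq j x : seq (bool * seq wd)) = (j * ex x)%N.
    elim: j => [|j IH]; first by rewrite /cex big_nil.
    by rewrite /= cex_cons IH mulSn.
  rewrite /c cex_cat !e /ex /= -!size_eq0 -!/(wt _) wt_rev pureX_rev /m.
  by case: b hb {m m0 c vc} => h; rewrite /wt ?size_eq0 ?(flatten_nil (alt_good abl)) ?(negbTE h) ?h.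
pose X N w := nc (fval (A N) (B N) (v N) b bl (U N w)) ^+ (2 * m).
have eX N M : fprod (fcfg (A N) (B N) (v N) c) M =
    (nc (fval (A N) (B N) (v N) b bl M) ^+ (2 * m))%:C%C.
  have e j bs : fprod (fcfg (A N) (B N) (v N) (nseq j (b, bs))) M = fval (A N) (B N) (v N) b bs M ^+ j.
    elim: j => [|j IH]; first by rewrite /fprod big_nil.
    by rewrite /= fprod_cons IH exprS.
  have ecat c1 c2 : fprod (fcfg (A N) (B N) (v N) (c1 ++ c2)) M =
      fprod (fcfg (A N) (B N) (v N) c1) M * fprod (fcfg (A N) (B N) (v N) c2) M.
    by rewrite /fprod /fcfg map_cat big_cat.
  rewrite ecat !e fval_rev //.
  by rewrite -exprMn -sqr_nc exprM !rmorphXn.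
have bX N : bmeas (fun w => (X N w)%:C%C).
  have := polyf_bmeas (haarU N) (polyf_fprod (fcfg (A N) (B N) (v N) c)).
  by under eq_fun => w do rewrite eX.
have mX N : measurable_fun setT (X N) by have [] := bX N.
have X0 N w : 0 <= X N w by rewrite exprn_ge0 // nc_ge0.
have [K [N0 [K1 hK]]] := moment_bounds unitv haarU bound_twd bound_vst (cwt c).
have h : {ae P, forall w, X^~ w @ \oo --> (0 : R)}.
  apply: (@ae_cvg0 _ _ _ P X K N0) => // [|N hN]; first exact: le_trans ler01 K1.
  have iX : P.-integrable setT (EFin \o X N) := bmeas_Re P (bX N).
  have fX : (\int[P]_w (X N w)%:E)%E \is a fin_num by exact: integrable_fin_num iX.
  rewrite -(fineK fX) lee_fin.
  have := hK N hN c vc (leqnn _); rewrite ec.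
  have -> : @Ecf R k l N (A N) (B N) (v N) d T P (U N) c = Ec P (fun w => (X N w)%:C%C).
    by rewrite /Ecf /haarE; congr Ec; apply/funext => w; rewrite eX.
  have -> : (N.+1%:R ^- 2 : R) = hpar N ^+ 4 by rewrite (exprM _ 2 2) hpar2 exprVn.
  apply: le_trans; apply: le_trans (ler_absRe_nc _); rewrite EcE /=.
  exact: ler_norm.
apply: filterS h => w hw; rewrite /cvgC; apply: (cvg_root m0).
  by move=> N; exact: nc_ge0.
by under eq_fun => N do rewrite subr0.
Qed.

(** Block lists are countable, so one null set serves all of them; this is needed because one word
    involves many block lists. *)
Lemma ae_fval_all : {ae P, forall w, forall (b : bool) (bl : seq wd), alt bl ->
  (if b then bl != [::] else ~~ pureX (flatten bl)) ->
  cvgC (fun N => fval (A N) (B N) (v N) b bl (U N w)) 0}.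
Proof.
pose Q (x : bool * seq wd) w := alt x.2 -> (if x.1 then x.2 != [::] else ~~ pureX (flatten x.2)) ->
  cvgC (fun N => fval (A N) (B N) (v N) x.1 x.2 (U N w)) 0.
have hQ x : {ae P, forall w, Q x w}.
  case: x => b bl; have [h1|h1] := boolP (alt bl); last first.
    by apply: aeW => w; rewrite /Q /= (negbTE h1).
  have [h2|h2] := boolP (if b then bl != [::] else ~~ pureX (flatten bl)).
    by apply: filterS (ae_fval h1 h2) => w hw _ _.
  by apply: aeW => w; rewrite /Q /= (negbTE h2).
have h : {ae P, forall w, forall m, if unpickle m is Some x then Q x w else True}.
  apply: ae_foralln => m; case: (unpickle m) => [x|]; first exact: hQ.
  by apply: aeW.
by apply: filterS h => w hw b bl; have := hw (pickle (b, bl)); rewrite pickleK.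
Qed.

End AlmostSureMoments.

(** * From words in the actual matrices to centered moments *)

Section Evaluation.
Context {R : realType} {k l n : nat}.
Local Notation C := R[i].
Local Notation M_ := 'M[C]_n.+1.
Local Notation wd := (word k l).
Variables (A : 'I_k -> M_) (B : 'I_l -> M_) (v : 'cV[C]_n.+1).

Definition wval (b : bool) (w : wd) (M : M_) : C :=
  \tr (kmx v b *m evalw (mxs A (conjB M B)) w).

Lemma kmx_trn X : \tr (kmx v true *m X) = trn X.
Proof. by rewrite /kmx mul_scalar_mx mxtraceZ mulrC. Qed.

Lemma kmx_vstate X : \tr (kmx v false *m X) = vstate v X.
Proof. exact: tr_rank1. Qed.

Lemma polymx_evalw (w : wd) : polymx (fun M => evalw (mxs A (conjB M B)) w).
Proof.
elim: w => [|x w IH].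
  have p1 : polymx (fun _ : M_ => 1%:M : M_) by exact: polymx_cst.
  by move=> i j; apply: polyf_ext (p1 i j) => M; rewrite /evalw big_nil.
have px : polymx (fun M => mxs A (conjB M B) x).
  by case: x => i; [exact: polymx_cst|exact: polymx_conjU].
by move=> i j; apply: polyf_ext (polymxM px IH i j) => M; rewrite /evalw big_cons.
Qed.

Lemma polyf_wval b w : polyf (wval b w).
Proof. by apply: polyf_tr; apply: polymxM; [exact: polymx_cst|exact: polymx_evalw]. Qed.

Lemma evalw_pureX (w : wd) M : pureX w -> evalw (mxs A (conjB M B)) w = evalw (mxs A B) w.
Proof.
move=> /allP hw; rewrite /evalw big_seq [RHS]big_seq; apply: eq_bigr => x /hw.
by case: x.
Qed.

Lemma evalw_pureY (w : wd) M : unitary M -> pureY w ->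
  evalw (mxs A (conjB M B)) w = conjU (evalw (mxs A B) w) M.
Proof.
move=> hM; elim: w => [|x w IH].
  by move=> _; rewrite /evalw !big_nil /conjU mulmx1 hM.
case: x => // j /= /IH e; rewrite /evalw !big_cons -!/(evalw _ _) e /= /conjB /conjU.
move: (evalw _ _) (B j) => X Y.
by rewrite -[LHS]/(M *m Y *m adj M *m (M *m X *m adj M)) !mulmxA -(mulmxA (M *m Y)) unitaryC // mulmx1.
Qed.

Lemma blk_evalw (u : wd) M : unitary M -> blockp u ->
  bmx (blk A B u) M = evalw (mxs A (conjB M B)) u - (twd A B u)%:M.
Proof.
move=> hM bu; rewrite /blk; case: ifP => hu /=; first by rewrite evalw_pureX.
rewrite evalw_pureY //; last by rewrite block_notXY // hu.
rewrite /conjU mulmxBr mulmxBl -scalemx1 -scalemxAr -scalemxAl mulmx1 hM //.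
Qed.

(** Conjugation by a unitary commutes with centering, so formal centering of words agrees with the
    product of centered matrices. The induction generalizes [kmx v b] to an arbitrary matrix, which
    absorbs the blocks already read. *)
Lemma cent_wval b bl M : unitary M -> good bl ->
  cent (fun w => wval b w M) (twd A B) bl = fval A B v b bl M.
Proof.
move=> hM; rewrite /wval /fval; elim: bl (kmx v b) => [|u bl IH] Z.
  by move=> _ /=; rewrite cev_nil /evalw big_nil.
rewrite good_cons => /andP[bu gbl] /=; rewrite cev_cons mulmxA -IH //; congr cent.
apply/funext => w; rewrite blk_evalw // evalw_cat.
move: (evalw _ u) (evalw _ w) => X Y.
by rewrite mulmxBr mulmxBl raddfB /= !mulmxA mul_mx_scalar -scalemxAl mxtraceZ.
Qed.

Lemma fval_pureX (u : wd) M : unit_vec v -> pureX u ->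
  fval A B v false [:: u] M = vstate v (evalw (mxs A B) u) - twd A B u.
Proof.
move=> uv hu; rewrite fval_false cev1 /blk hu /= /vstate mulmxBr mulmxBl mul_mx_scalar -scalemxAl.
have hv : (adj v *m v) 0 0 = 1 := uv.
move: hv; move: (adj v *m _ *m v) (adj v *m v) => X Y hv.
by rewrite !mxE hv mulr1.
Qed.

Lemma evalp_lin (b : bool) (M : M_) (Q : ncpoly R k l) :
  \tr (kmx v b *m evalp (mxs A (conjB M B)) Q) = lin (fun w => wval b w M) Q.
Proof.
rewrite /evalp /lin mulmx_sumr raddf_sum /=; apply: eq_bigr => cw _.
by rewrite -scalemxAr mxtraceZ.
Qed.

Section Haar.
Context {d : measure_display} {T : measurableType d} (P : probability T R).
Variable U : T -> M_.
Hypothesis haarU : haar_unitary P U.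
Local Notation E := (@haarE R n d T P U).

Lemma cent_haarE (F : wd -> M_ -> C) (t : wd -> C) bl : (forall w, polyf (F w)) ->
  cent (fun w => E (F w)) t bl = E (fun M => cent (fun w => F w M) t bl).
Proof.
elim: bl F => //= u bl IH F pF.
have pt w : polyf (fun M => t u * F w M) by apply: polyfM; [exact: polyf_cst|exact: pF].
rewrite -(IH (fun w M => F (u ++ w) M - t u * F w M)).
  by congr cent; apply/funext => w; rewrite (haarEB haarU (pF _) (pt _)) haarEZ.
move=> w; apply: polyf_ext (polyfD (pF (u ++ w)) (polyfM (polyf_cst (-1)) (pt w))) => M.
by rewrite mulN1r.
Qed.

Lemma cent_moment b bl : good bl ->
  cent (fun w => E (wval b w)) (twd A B) bl = @Ecf R k l n A B v d T P U [:: (b, bl)].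
Proof.
move=> gbl; rewrite cent_haarE; last by move=> w; exact: polyf_wval.
apply: (haarE_extU haarU) => M hM; rewrite fprod_cons /fprod big_nil mulr1.
exact: cent_wval.
Qed.

Lemma haarE_lin b (Q : ncpoly R k l) :
  E (fun M => lin (fun w => wval b w M) Q) = lin (fun w => E (wval b w)) Q.
Proof.
rewrite /lin (haarE_sum haarU _ (F := fun cw M => cw.1 * wval b cw.2 M)).
  by apply: eq_bigr => cw _; rewrite haarEZ //; exact: polyf_wval.
by move=> cw; apply: polyfM; [exact: polyf_cst|exact: polyf_wval].
Qed.

End Haar.
End Evaluation.

(** * Conditional freeness from vanishing centered products *)

Section ConditionalFreeness.
Context {R : realType} {k l : nat}.
Local Notation C := R[i].
Local Notation wd := (word k l).

Lemma cvgC_lin (F : nat -> wd -> C) (f : wd -> C) (Q : ncpoly R k l) :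
  (forall w, cvgC (F^~ w) (f w)) -> cvgC (fun N => lin (F N) Q) (lin f Q).
Proof. by move=> h; apply: cvgC_sum => cw; apply: cvgCM; [exact: cvgC_cst|exact: h]. Qed.

(** A nonempty monomial determines its algebra, so monomials chosen from factors of alternating type
    form an alternating block list. *)
Lemma alt_of_types (s : seq (bool * ncpoly R k l)) (us : seq wd) :
  all2 (fun u p => u \in map snd p) us (map snd s) ->
  all (fun p => if p.1 then inA1 p.2 else inA2 p.2) s ->
  sorted (fun a b => a.1 != b.1) s -> [::] \notin us -> alt us.
Proof.
have type1 (u : wd) (p : bool * ncpoly R k l) : u \in map snd p.2 ->
    (if p.1 then inA1 p.2 else inA2 p.2) -> u != [::] -> blockp u /\ pureX u = p.1.
  move=> /mapP[cw hcw ->]; case: p hcw => [[] p] /= hcw /allP /(_ cw hcw) /= hu u0.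
    by rewrite /blockp u0 hu.
  have bu : blockp cw.2 by rewrite /blockp u0 hu orbT.
  by split=> //; apply/negbTE; rewrite -(block_notXY bu).
elim: s us => [|p s IH] [|u us] //= /andP[hu hus] /andP[hp hs] hsort.
rewrite inE negb_or eq_sym => /andP[u0 us0].
have [bu pu] := type1 u p hu hp u0.
have aus : alt us by apply: IH => //; exact: path_sorted hsort.
case: us s hus us0 aus {IH} hs hsort => [|w us] [|q s] //=; first by rewrite alt1.
move=> /andP[hw _] us0 aus /andP[hq _] /andP[pq _].
have w0 : w != [::] by move: us0; rewrite inE negb_or eq_sym => /andP[].
have [bw pw] := type1 w q hw hq w0.
by rewrite alt_cons2 bu pu pw pq.
Qed.

Lemma lin_eq_on (f g : wd -> C) (p : ncpoly R k l) (Q : pred wd) :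
  all (fun cw => Q cw.2) p -> (forall w, Q w -> f w = g w) -> lin f p = lin g p.
Proof.
move=> /allP hp h; rewrite /lin big_seq [RHS]big_seq; apply: eq_bigr => cw /hp hc.
by rewrite (h _ hc).
Qed.

Lemma cond_free_of_cent (tau0 tau phi : wd -> C) :
  tau0 [::] = 1 ->
  (forall w, pureX w || pureY w -> tau w = tau0 w) ->
  (forall w, pureY w -> phi w = tau w) ->
  (forall bl, alt bl -> (1 < size bl)%N -> cent tau tau0 bl = 0) ->
  (forall bl, alt bl -> (1 < size bl)%N -> cent phi tau0 bl = 0) ->
  cond_free tau phi.
Proof.
move=> t1 htau hphi ctau cphi s s1 hs hsort hc.
have lin0 p : p \in s -> lin tau p.2 = lin tau0 p.2.
  move=> ps; have := allP hs p ps; case: p.1 => hp.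
    by apply: (lin_eq_on hp) => w hw; rewrite htau ?hw.
  by apply: (lin_eq_on hp) => w hw; rewrite htau ?hw ?orbT.
have hc0 : all (fun p => lin tau0 p == 0) (map snd s).
  by rewrite all_map; apply/allP => p ps /=; rewrite -lin0 //; exact: (allP hc).
have vanish (f : wd -> C) : (forall bl, alt bl -> (1 < size bl)%N -> cent f tau0 bl = 0) ->
    lin f (ncprod (map snd s)) = 0.
  move=> cf; apply: (lin_ncprod_centered hc0) => us hus.
  have [h|h] := boolP ([::] \in us); first exact: cent_nil_block.
  apply: cf; first exact: (alt_of_types hus).
  by move: hus; rewrite all2E size_map => /andP[/eqP -> _].
split; first exact: vanish.
rewrite vanish //; apply/esym.
(* Two consecutive factors have different types, so one lies in the second algebra; there phi agrees
   with tau and the centered factor makes the product of the phi values vanish. *)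
have [p ps pY] : exists2 p, p \in s & p.1 = false.
  case: s s1 hsort {hs hc lin0 hc0 vanish} => [|p [|q s]] //= _ /andP[pq _].
  case ep: p.1 pq => pq; last by exists p; rewrite ?mem_head.
  by exists q; rewrite ?inE ?eqxx ?orbT //; case: (q.1) pq.
rewrite (big_rem p ps) /= (_ : lin phi p.2 = 0) ?mul0r //.
have := allP hs p ps; rewrite pY => hp.
by rewrite (lin_eq_on hp hphi); apply/eqP; exact: (allP hc).
Qed.

End ConditionalFreeness.

(** * Assembly: limits of expectations, conditional freeness, almost sure limits *)

Theorem theorem3p10 (R : realType) (k l : nat)
  (A : forall N : nat, 'I_k -> 'M[R[i]]_N.+1)
  (B : forall N : nat, 'I_l -> 'M[R[i]]_N.+1)
  (v : forall N : nat, 'cV[R[i]]_N.+1)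
  (tau0 phi0 : word k l -> R[i])
  (d : measure_display) (Omega : measurableType d) (P : probability Omega R)
  (U : forall N : nat, Omega -> 'M[R[i]]_N.+1) :
  (forall N, unit_vec (v N)) ->
  (forall Q : ncpoly R k l, inA1 Q ->
     cvgC (fun N => trn (evalp (mxs (A N) (B N)) Q)) (lin tau0 Q)) ->
  (forall Q : ncpoly R k l, inA1 Q ->
     cvgC (fun N => vstate (v N) (evalp (mxs (A N) (B N)) Q)) (lin phi0 Q)) ->
  (forall Q : ncpoly R k l, inA2 Q ->
     cvgC (fun N => trn (evalp (mxs (A N) (B N)) Q)) (lin tau0 Q)) ->
  (forall N, haar_unitary P (U N)) ->
  exists tau phi : word k l -> R[i],
    (forall w, pureX w || pureY w -> tau w = tau0 w) /\
    (forall w, pureX w -> phi w = phi0 w) /\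
        (forall Q : ncpoly R k l,
           cvgC (fun N => Ec P (fun om =>
                   trn (evalp (mxs (A N) (conjB (U N om) (B N))) Q))) (lin tau Q)) /\
        (forall Q : ncpoly R k l,
           cvgC (fun N => Ec P (fun om =>
                   vstate (v N) (evalp (mxs (A N) (conjB (U N om) (B N))) Q))) (lin phi Q)) /\
        cond_free tau phi /\
        (forall w, pureY w -> phi w = tau w) /\
        ((forall N i, selfadj (A N i)) -> (forall N j, selfadj (B N j)) ->
         forall Q : ncpoly R k l,
           {ae P, forall om, cvgC (fun N =>
               trn (evalp (mxs (A N) (conjB (U N om) (B N))) Q)) (lin tau Q)} /\
           {ae P, forall om, cvgC (fun N =>
               vstate (v N) (evalp (mxs (A N) (conjB (U N om) (B N))) Q)) (lin phi Q)}).
Proof.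
move=> unitv hA hv hB haarU.
have word1 (f : word k l -> R[i]) (w : word k l) : lin f [:: (1, w)] = f w.
  by rewrite /lin big_cons big_nil mul1r addr0.
have eval1 N (w : word k l) : evalp (mxs (A N) (B N)) [:: (1, w)] = evalw (mxs (A N) (B N)) w.
  by rewrite /evalp big_cons big_nil scale1r addr0.
have t_cvg (u : word k l) : pureX u || pureY u -> cvgC (fun N => twd (A N) (B N) u) (tau0 u).
  move=> /orP[hu|hu].
    have h := hA [:: (1, u)]; rewrite /inA1 /= hu word1 in h.
    by apply: cvgC_ext (h isT) => N; rewrite eval1.
  have h := hB [:: (1, u)]; rewrite /inA2 /= hu word1 in h.
  by apply: cvgC_ext (h isT) => N; rewrite eval1.
have v_cvg (u : word k l) : pureX u -> cvgC (fun N => vstate (v N) (evalw (mxs (A N) (B N)) u)) (phi0 u).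
  move=> hu; have h := hv [:: (1, u)]; rewrite /inA1 /= hu word1 in h.
  by apply: cvgC_ext (h isT) => N; rewrite eval1.
have tb_cvg (u : word k l) : blockp u -> cvgC (fun N => twd (A N) (B N) u) (tau0 u).
  by case/andP => _; exact: t_cvg.
have bound_twd (u : word k l) : blockp u -> exists K : R, forall N, nc (twd (A N) (B N) u) <= K.
  by move=> /tb_cvg /cvgC_bounded[K _ hK]; exists K.
have bound_vst (u : word k l) : pureX u ->
    exists K : R, forall N, nc (vstate (v N) (evalw (mxs (A N) (B N)) u)) <= K.
  by move=> /v_cvg /cvgC_bounded[K _ hK]; exists K.
have e0 N : evalw (mxs (A N) (B N)) [::] = 1%:M by rewrite /evalw big_nil.
have tau0_nil : tau0 [::] = 1.
  apply: (cvgC_unique (t_cvg [::] isT)); apply: cvgC_ext (cvgC_cst 1) => N.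
  by rewrite /twd e0 /trn mxtrace1 divff // pnatr_eq0.
have phi0_nil : phi0 [::] = 1.
  apply: (cvgC_unique (v_cvg [::] isT)); apply: cvgC_ext (cvgC_cst 1) => N.
  by rewrite e0 /vstate mulmx1; exact/esym/unitv.
(* Limits of the centered products. The nonzero values are the empty product and the vector state of
   a deterministic list, where centering by tau leaves phi minus tau. *)
pose g (b : bool) (bl : seq (word k l)) : R[i] :=
  if bl == [::] then 1 else
  if ~~ b && pureX (flatten bl) then phi0 (flatten bl) - tau0 (flatten bl) else 0.
pose t N := twd (A N) (B N).
pose F (b : bool) N w om := wval (A N) (B N) (v N) b w (U N om).
pose f (b : bool) N (w : word k l) := @haarE R N d Omega P (U N) (wval (A N) (B N) (v N) b w).
have fval_cvg b bl (M : forall N, 'M[R[i]]_N.+1) : alt bl -> ~~ b && pureX (flatten bl) ->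
    bl != [::] -> cvgC (fun N => fval (A N) (B N) (v N) b bl (M N)) (g b bl).
  rewrite /g => abl /andP[hb hX] hn; rewrite (negbTE hn) hb hX /=.
  have [u -> hu] := alt_pureX abl hX hn; rewrite /= cats0.
  apply: cvgC_ext (cvgCB (v_cvg u hu) (t_cvg u _)) => [N|]; last by rewrite hu.
  by rewrite (negbTE hb) fval_pureX.
have f_cvg b bl : alt bl -> cvgC (fun N => cent (f b N) (t N) bl) (g b bl).
  move=> abl; have gbl := alt_good abl.
  have eE N : cent (f b N) (t N) bl =
      @Ecf R k l N (A N) (B N) (v N) d Omega P (U N) [:: (b, bl)] by exact: cent_moment.
  have [ebl|hn] := eqVneq bl [::].
    apply: cvgC_ext (cvgC_cst (g b bl)) => N.
    by rewrite eE /g ebl eqxx Ecf_nil // Ecf_empty.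
  have [h|h] := boolP (~~ b && pureX (flatten bl)).
    have [u ebl hu] := alt_pureX abl (proj2 (andP h)) hn.
    have hb : b = false by case/andP: h => /negbTE.
    (* An arbitrary choice: the value of a single X block is the same at every matrix. *)
    have M0 : forall N, 'M[R[i]]_N.+1 by move=> N; exact: 0.
    apply: cvgC_ext (fval_cvg b bl M0 abl h hn) => N.
    by rewrite eE ebl hb fval_pureX // Ecf_pureX // Ecf_empty mulr1.
  rewrite /g (negbTE hn) (negbTE h).
  apply: cvgC_ext (moment_cvg0 unitv haarU bound_twd bound_vst (c := [:: (b, bl)]) _ _) => [N||].
  - by rewrite eE.
  - by rewrite /valid /= abl.
  - rewrite cex_cons /ex /= (flatten_nil gbl) (negbTE hn).
    by case: b h {fval_cvg eE} => //= h; rewrite h.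
have [tau [tau_cvg tau_cent]] := functional_limit tb_cvg (f_cvg true).
have [phi [phi_cvg phi_cent]] := functional_limit tb_cvg (f_cvg false).
have tau_nil : tau [::] = 1 by have := tau_cent [::] isT.
have phi_nil : phi [::] = 1 by have := phi_cent [::] isT.
have tau_pure w : pureX w || pureY w -> tau w = tau0 w.
  have [-> _|hw hp] := eqVneq w [::]; first by rewrite tau_nil tau0_nil.
  have hb : blockp w by rewrite /blockp hw.
  have := tau_cent [:: w]; rewrite alt1 /= cats0 tau_nil mulr1 /g /= => /(_ hb) h.
  by apply/eqP; rewrite -subr_eq0 h.
have phi_pure w : blockp w -> phi w = tau0 w + (if pureX w then phi0 w - tau0 w else 0).
  move=> hb; have := phi_cent [:: w]; rewrite alt1 /= !cats0 phi_nil mulr1 /g /= cats0.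
  by move=> /(_ hb) <-; ring.
have phi_Y w : pureY w -> phi w = tau w.
  move=> hw; have [->|w0] := eqVneq w [::]; first by rewrite phi_nil tau_nil.
  have hb : blockp w by rewrite /blockp w0 hw orbT.
  by rewrite phi_pure // tau_pure ?hw ?orbT // -if_neg -(block_notXY hb) hw addr0.
have evalE (b : bool) N om Q :
    \tr (kmx (v N) b *m evalp (mxs (A N) (conjB (U N om) (B N))) Q) = lin (fun w => F b N w om) Q.
  exact: evalp_lin.
exists tau, phi; split; first exact: tau_pure.
split.
  move=> w hw; have [->|w0] := eqVneq w [::]; first by rewrite phi_nil phi0_nil.
  by rewrite phi_pure ?hw; [ring|rewrite /blockp w0 hw].
split.
  move=> Q; apply: cvgC_ext (cvgC_lin Q tau_cvg) => N.
  rewrite -(haarE_lin (A N) (B N) (v N) (haarU N)); congr Ec; apply/funext => om.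
  by rewrite -(kmx_trn (v N)) evalE.
split.
  move=> Q; apply: cvgC_ext (cvgC_lin Q phi_cvg) => N.
  rewrite -(haarE_lin (A N) (B N) (v N) (haarU N)); congr Ec; apply/funext => om.
  by rewrite -kmx_vstate evalE.
split.
  apply: (cond_free_of_cent tau0_nil tau_pure phi_Y) => bl abl sbl.
    by rewrite tau_cent // /g /=; case: eqP sbl => // ->.
  rewrite phi_cent // /g /=; case: eqP sbl => [-> //|/eqP hn sbl].
  by case: ifP => // hX; have [u ebl _] := alt_pureX abl hX hn; rewrite ebl in sbl.
split; first exact: phi_Y.
move=> sA sB.
have ae := ae_fval_all unitv haarU bound_twd bound_vst sA sB.
have F_cvg b om : (forall (b : bool) (bl : seq (word k l)), alt bl ->
      (if b then bl != [::] else ~~ pureX (flatten bl)) ->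
      cvgC (fun N => fval (A N) (B N) (v N) b bl (U N om)) 0) ->
    forall bl, alt bl -> cvgC (fun N => cent (fun w => F b N w om) (t N) bl) (g b bl).
  move=> hom bl abl; have uU N : unitary (U N om) by have [h _ _] := haarU N.
  suff h : cvgC (fun N => fval (A N) (B N) (v N) b bl (U N om)) (g b bl).
    by apply: cvgC_ext h => N; rewrite cent_wval //; exact: alt_good.
  have [ebl|hn] := eqVneq bl [::].
    apply: cvgC_ext (cvgC_cst (g b bl)) => N.
    by rewrite /g ebl eqxx fval_nil.
  have [h|h] := boolP (~~ b && pureX (flatten bl)); first exact: fval_cvg.
  rewrite /g (negbTE hn) (negbTE h); apply: hom => //.
  by case: b h => //= h; exact: hn.
move=> Q; split.
  apply: filterS ae => om hom.
  (* For this outcome the centered products have the same limits [g] as in expectation, which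
     identifies the limit on words as the functional [tau] already built. *)
  have h := functional_cvg tb_cvg (F_cvg true om hom) tau_cent.
  by apply: cvgC_ext (cvgC_lin Q h) => N; rewrite -evalE kmx_trn.
apply: filterS ae => om hom.
have h := functional_cvg tb_cvg (F_cvg false om hom) phi_cent.
by apply: cvgC_ext (cvgC_lin Q h) => N; rewrite -evalE kmx_vstate.
Qed.
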